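(* The Mellin transform of $B_{\nu,-}^{-\alpha}f$ is determined by the formula $$\left((B_{\nu,-}^{-\alpha}f)(x)\right)^*(s)=\frac{1}{2^{2\alpha}}\,\frac{\Gamma\left(\frac{s}{2}\right)\,\Gamma\left(\frac{s}{2}-\frac{\nu-1}{2}\right)}{\Gamma\left(\alpha+\frac{s}{2}-\frac{\nu-1}{2}\right)\,\Gamma\left(\alpha+\frac{s}{2}\right)}\; f^*(2\alpha+s).$$
   Context: The Mellin transform of a function $f$ is $Mf(s)=f^*(s)=\int_0^\infty x^{s-1}f(x)\,dx$. For $\nu\ge 0$ and $\alpha>0$, the right-sided fractional Bessel integral $B_{\nu,-}^{-\alpha}$ (a negative fractional power of the Bessel operator $B_\nu=\frac{d^2}{dx^2}+\frac{\nu}{x}\frac{d}{dx}$) is defined for $f\in C^{[2\alpha]+1}(0,+\infty)$ by $$(B_{\nu,-}^{-\alpha}f)(x)=\frac{1}{\Gamma(2\alpha)}\int_x^\infty\left(\frac{y^2-x^2}{2y}\right)^{2\alpha-1}{}_2F_1\left(\alpha+\frac{\nu-1}{2},\alpha;2\alpha;1-\frac{x^2}{y^2}\right)f(y)\,dy,$$ where ${}_2F_1$ is the Gauss hypergeometric function and $[2\alpha]$ is the integer part of $2\alpha$.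
   Formalization: The formula is stated and proved for Re s > max(0, ν−1) with f^*(2α+s) absolutely convergent; the statement gives no convergence conditions, and without them the integrals can diverge (e.g. f = 1). *)

(* Defs.v *)
From HB Require Import structures.
From mathcomp Require Import all_boot all_order all_algebra.
From mathcomp Require Import all_classical all_reals all_analysis.
From mathcomp.real_closed Require Import complex.

Set Implicit Arguments.
Unset Strict Implicit.
Unset Printing Implicit Defensive.

Import Order.TTheory GRing.Theory Num.Theory.
Import numFieldNormedType.Exports.

Local Open Scope classical_set_scope.
Local Open Scope ring_scope.
Local Open Scope complex_scope.

Section Defs.
Context {R : realType}.

(* Lebesgue integrability and Lebesgue integral of complex-valued functions of
   a real variable, taken on the real and imaginary parts. *)
Definition cintegrable (D : set R) (f : R -> R[i]) : Prop :=
  lebesgue_measure.-integrable D (fun x => (complex.Re (f x))%:E) /\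
  lebesgue_measure.-integrable D (fun x => (complex.Im (f x))%:E).

Definition cintegral (D : set R) (f : R -> R[i]) : R[i] :=
  (\int[lebesgue_measure]_(x in D) complex.Re (f x))%R +i*
  (\int[lebesgue_measure]_(x in D) complex.Im (f x))%R.

(* x ^ z = exp (z ln x), used for x > 0 only. *)
Definition cpow (x : R) (z : R[i]) : R[i] :=
  (x `^ complex.Re z)%:C *
  (cos (complex.Im z * ln x) +i* sin (complex.Im z * ln x)).

(* Euler's integral: this is the Gamma function on the half-plane Re z > 0, and
   is not meant to be used elsewhere. *)
Definition Gamma (z : R[i]) : R[i] :=
  cintegral `]0, +oo[ (fun t => cpow t (z - 1) * (expR (- t))%:C).

Definition mellin_integrand (f : R -> R[i]) (s : R[i]) : R -> R[i] :=
  fun x => cpow x (s - 1) * f x.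

Definition mellin_cvg (f : R -> R[i]) (s : R[i]) : Prop :=
  cintegrable `]0, +oo[ (mellin_integrand f s).

Definition mellin (f : R -> R[i]) (s : R[i]) : R[i] :=
  cintegral `]0, +oo[ (mellin_integrand f s).

Definition rising (a : R) (n : nat) : R := \prod_(i < n) (a + i%:R).

(* The Gauss series; it converges for |z| < 1 when c is not a nonpositive
   integer. *)
Definition hyp2F1 (a b c z : R) : R :=
  limn (series (fun n : nat =>
    rising a n * rising b n / (rising c n * n`!%:R) * z ^+ n)).

Definition real_Cn_pos (n : nat) (g : R -> R) : Prop :=
  (forall (k : nat) (x : R), (k < n)%N -> 0 < x -> derivable (derive1n k g) x 1) /\
  (forall x : R, 0 < x -> {for x, continuous (derive1n n g)}).

(* The class C^n(0, +oo); values of f outside (0, +oo) are irrelevant. *)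
Definition Cn_pos (n : nat) (f : R -> R[i]) : Prop :=
  real_Cn_pos n (fun x => complex.Re (f x)) /\
  real_Cn_pos n (fun x => complex.Im (f x)).

Definition bessel_kernel (nu alpha x y : R) : R :=
  ((y ^+ 2 - x ^+ 2) / (2 * y)) `^ (2 * alpha - 1) *
  hyp2F1 (alpha + (nu - 1) / 2) alpha (2 * alpha) (1 - x ^+ 2 / y ^+ 2).

Definition bessel_integrand (nu alpha : R) (f : R -> R[i]) (x : R) : R -> R[i] :=
  fun y => (bessel_kernel nu alpha x y)%:C * f y.

Definition bessel_cvg (nu alpha : R) (f : R -> R[i]) (x : R) : Prop :=
  cintegrable `]x, +oo[ (bessel_integrand nu alpha f x).

Definition bessel_integral (nu alpha : R) (f : R -> R[i]) (x : R) : R[i] :=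
  (Gamma (2 * alpha)%:C)^-1 *
  cintegral `]x, +oo[ (bessel_integrand nu alpha f x).

End Defs.

(* Main.v *)
Require Import Defs.
From mathcomp Require Import all_boot all_order all_algebra.
From mathcomp Require Import all_classical all_reals all_analysis.
From mathcomp Require Import measurable_realfun.
From mathcomp.real_closed Require Import complex.
From mathcomp Require Import ring lra.

Import Order.TTheory GRing.Theory Num.Theory.
Import numFieldNormedType.Exports.
Local Open Scope ring_scope.
Local Open Scope complex_scope.

(** Write [c = 2 alpha], [b = alpha] and [a = alpha + (nu - 1) / 2], so that [-1 < a]
    and [0 < b <= c].  The kernel of the Bessel integral is homogeneous: for
    [0 < x < y] it equals [(y / 2) `^ (c - 1) * k (x / y)], where
    [k r = (1 - r ^+ 2) `^ (c - 1) * hyp2F1 a b c (1 - r ^+ 2)] on [ ]0, 1[ ], and it is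
    natural to put [k r = 0] for [r >= 1].  Hence [Gamma c] times the Bessel integral
    is the multiplicative convolution of [k] with [h y = (y / 2) `^ (c - 1) * f y],
    and the Mellin transform turns such a convolution into a product: this is
    Fubini's theorem followed by a scaling ([mellin_convolution]).  The factor
    coming from [h] is [2 `^ (1 - c)] times the Mellin transform of [f] at [c + s].
    What is left is to compute the moment [\int r `^ (s - 1) * k r] over [ ]0, 1[ ]
    ([hyp_moment]).

    The hypergeometric series is integrated term by term.  The substitution
    [t = r ^+ 2] turns the [n]-th term into one half of [Beta (c + n) (s / 2)], and
    the relation between the Beta and Gamma functions transforms the series into a
    multiple of the sum of [rising a n / n`! * Beta (b + n) d], with
    [d = s / 2 + (c - b)].  The latter is the integral over [ ]0, 1[ ] of
    [t `^ (d - 1) * (1 - t) `^ (b - 1)] against the binomial series of [t `^ (- a)],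
    hence it is [Beta b (d - a)] ([gauss_sum]); this is Gauss's summation theorem
    in a form that needs no analytic continuation.

    The relation between Beta and Gamma ([Beta_Gamma]) is one more multiplicative
    convolution, that of [(1 - r) `^ (p - 1)] with [y `^ (p - 1) * expR (- y)].  The
    binomial series comes from the exponential series integrated against the
    integrand of the Gamma function.  Dividing by values of the Gamma function
    requires that it does not vanish for [0 < Re z] ([Gamma_neq0]): if it did, the
    functional equation would give zeros at all the points [z + n], which is
    impossible for large [n] because the integrand is then concentrated where its
    phase is almost constant.

    For absolute convergence, the absolute values of the terms of the
    hypergeometric series are bounded by those of the binomial series of exponent
    [a], since [b <= c]; and those have a constant sign after the first one, so
    their sum is at most [2 + t `^ (- a)].  Convergence of the Bessel integral at
    every [x] uses two more facts.  Near [y = x] the kernel behaves like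
    [(y - x) `^ (c - 1)] and [f] is bounded.  For large [y], the sum [hyp_abs] of the
    absolute series at [1 - r ^+ 2] is nonincreasing in [r], so that the convergence
    of its moment of order [Re s] implies a pointwise bound [A * r `^ (- Re s)]; this
    is exactly the growth that the Mellin convergence of [f] absorbs. *)

(** * Affine changes of variable for nonnegative integrands *)

Section ChangeOfVariable.
Local Set Implicit Arguments.
Local Unset Strict Implicit.
Local Open Scope classical_set_scope.
Local Open Scope ereal_scope.
Context {R : realType}.
Implicit Types (D E : set R).
Local Notation mu := (@lebesgue_measure R).

(** A Borel measure that agrees with Lebesgue measure on half-open intervals is
    Lebesgue measure; the pushforward by [phi], rescaled by [k], is such a measure. *)
Lemma ge0_integral_change_of_variable (phi : R -> R) (k : {nonneg R}) :
  measurable_fun setT phi ->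
  (forall a b, (a <= b)%R -> mu `]a, b] = k%:num%:E * mu (phi @^-1` `]a, b])) ->
  forall (D : set R) (g : R -> \bar R), measurable D -> measurable_fun D g ->
    (forall x, D x -> 0 <= g x) ->
  \int[mu]_(x in D) g x = k%:num%:E * \int[mu]_(x in phi @^-1` D) g (phi x).
Proof.
move=> mphi phiE D g mD mg g0.
pose nu : {measure set (measurableTypeR R) -> \bar R} :=
  mscale k (pushforward mu (phi : R -> measurableTypeR R)).
rewrite -[in RHS](@ge0_integral_pushforward _ _ (measurableTypeR R) (measurableTypeR R) R phi mphi mu D g)//; last first.
  by move=> y; rewrite inE; exact: g0.
rewrite -ge0_integral_mscale//.
apply: eq_measure_integral => A mA _; apply: (@lebesgue_measure_unique R (nu mphi)) => //.
by move=> X [[a b] /= _ <-]; have [ab|ba] := leP a b; [exact: phiE|rewrite set_itv_ge ?measure0// bnd_simp -leNgt ltW].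
Qed.

Lemma ge0_integral_scale (c : R) (D : set R) (g : R -> \bar R) : (0 < c)%R ->
  measurable D -> measurable_fun D g -> (forall x, D x -> 0 <= g x) ->
  \int[mu]_(x in ( *%R c) @^-1` D) g (c * x)%R = (c^-1)%:E * \int[mu]_(x in D) g x.
Proof.
move=> c0 mD mg g0.
have mc : measurable_fun [set: R] ( *%R c) by exact: mulrl_measurable.
rewrite (@ge0_integral_change_of_variable ( *%R c) (NngNum (ltW c0)) mc _ D g)//.
  by rewrite /= muleA -EFinM mulVf ?gt_eqF// mul1e.
move=> a b ab /=.
have -> : ( *%R c @^-1` `]a, b]%classic = `]c^-1 * a, c^-1 * b]%classic)%R.
  apply/seteqP; split => x /=; rewrite !in_itv/=.
    by rewrite ltr_pdivrMl// ler_pdivlMl.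
  by rewrite ltr_pdivrMl// ler_pdivlMl.
rewrite !lebesgue_measure_itv/= !lte_fin ltr_pM2l ?invr_gt0//.
case: ifPn => // _; last by rewrite mule0.
by rewrite -!EFinD -EFinM -mulrBr mulrA divff ?gt_eqF// mul1r.
Qed.

Lemma ge0_integral_shift (c : R) (D : set R) (g : R -> \bar R) :
  measurable D -> measurable_fun D g -> (forall x, D x -> 0 <= g x) ->
  \int[mu]_(x in (fun x => x + c)%R @^-1` D) g (x + c)%R = \int[mu]_(x in D) g x.
Proof.
move=> mD mg g0.
have mc : measurable_fun [set: R] (fun x => x + c)%R by exact: measurable_funD.
rewrite [RHS](@ge0_integral_change_of_variable _ 1%:nng%R mc)//= ?mul1e// => a b ab.
have -> : ((fun x : R => x + c) @^-1` `]a, b]%classic = `]a - c, b - c]%classic)%R.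
  by apply/seteqP; split => x /=; rewrite !in_itv/= => /andP[? ?]; apply/andP; split; lra.
rewrite !lebesgue_measure_itv/= !lte_fin ltrD2r mul1e.
by case: ifPn => // _; rewrite -!EFinD; congr EFin; lra.
Qed.

End ChangeOfVariable.

(** * Complex-valued integrals *)

Section ComplexIntegral.
Local Set Implicit Arguments.
Local Unset Strict Implicit.
Local Open Scope classical_set_scope.
Context {R : realType}.
Implicit Types (D E : set R) (f g : R -> R[i]).
Local Notation mu := (@lebesgue_measure R).
Local Notation Re := (@complex.Re R).
Local Notation Im := (@complex.Im R).

(** Equivalent to the modulus, but real-valued and without square root, and
    still submultiplicative. *)
Definition abs1 (z : R[i]) : R := `|Re z| + `|Im z|.

Lemma Re_mulc (z w : R[i]) : Re (z * w) = Re z * Re w - Im z * Im w.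
Proof. by case: z w => [a b] [c d]. Qed.

Lemma Im_mulc (z w : R[i]) : Im (z * w) = Re z * Im w + Im z * Re w.
Proof. by case: z w => [a b] [c d]. Qed.

Lemma Re_realM (x : R) (z : R[i]) : Re (x%:C * z) = x * Re z.
Proof. by rewrite Re_mulc /= mul0r subr0. Qed.

Lemma Im_realM (x : R) (z : R[i]) : Im (x%:C * z) = x * Im z.
Proof. by rewrite Im_mulc /= mul0r addr0. Qed.

Lemma complex_eq (z w : R[i]) : Re z = Re w -> Im z = Im w -> z = w.
Proof. by case: z w => [a b] [c d] /= -> ->. Qed.

Lemma abs1_ge0 (z : R[i]) : 0 <= abs1 z.
Proof. by rewrite addr_ge0. Qed.

Lemma abs1M (z w : R[i]) : abs1 (z * w) <= abs1 z * abs1 w.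
Proof.
rewrite /abs1 Re_mulc Im_mulc mulrDl !mulrDr -!normrM.
rewrite (le_trans (lerD (ler_normB _ _) (ler_normD _ _)))//; lra.
Qed.

Lemma abs1_Re (z : R[i]) : `|Re z| <= abs1 z. Proof. by rewrite lerDl. Qed.
Lemma abs1_Im (z : R[i]) : `|Im z| <= abs1 z. Proof. by rewrite lerDr. Qed.

Lemma abs1_real (x : R) (z : R[i]) : abs1 (x%:C * z) = `|x| * abs1 z.
Proof. by rewrite /abs1 Re_realM Im_realM !normrM mulrDr. Qed.

Definition cmeasurable d (T : measurableType d) (D : set T) (f : T -> R[i]) :=
  measurable_fun D (fun x => Re (f x)) /\ measurable_fun D (fun x => Im (f x)).

Lemma cmeasurableM d (T : measurableType d) (D : set T) (f g : T -> R[i]) :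
  cmeasurable D f -> cmeasurable D g -> cmeasurable D (fun x => f x * g x).
Proof.
move=> [fr fi] [gr gi]; split.
- under eq_fun do rewrite Re_mulc.
  by apply: measurable_funB; exact: measurable_funM.
- under eq_fun do rewrite Im_mulc.
  by apply: measurable_funD; exact: measurable_funM.
Qed.

Lemma cmeasurable_real d (T : measurableType d) (D : set T) (h : T -> R) :
  measurable_fun D h -> cmeasurable D (fun x => (h x)%:C).
Proof. by split. Qed.

Lemma cmeasurable_cst d (T : measurableType d) (D : set T) (z : R[i]) :
  cmeasurable D (fun _ => z).
Proof. by split. Qed.

Lemma cmeasurableS d (T : measurableType d) (D D' : set T) (f : T -> R[i]) :
  measurable D -> D' `<=` D -> cmeasurable D f -> cmeasurable D' f.
Proof. by move=> mD DD [? ?]; split; apply: (measurable_funS mD). Qed.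

Lemma measurable_abs1 d (T : measurableType d) (D : set T) (f : T -> R[i]) :
  cmeasurable D f -> measurable_fun D (fun x => abs1 (f x)).
Proof.
move=> [mr mi]; apply: measurable_funD.
  by apply: (measurableT_comp (@normr_measurable R setT)).
by apply: (measurableT_comp (@normr_measurable R setT)).
Qed.

Lemma eq_cmeasurable d (T : measurableType d) (D : set T) (f g : T -> R[i]) :
  (forall x, D x -> f x = g x) -> cmeasurable D f -> cmeasurable D g.
Proof.
by move=> fg [mr mi]; split; [apply: eq_measurable_fun mr|apply: eq_measurable_fun mi] => x /set_mem Dx;
  rewrite fg.
Qed.

Lemma cintegrable_cmeasurable D f : cintegrable D f -> cmeasurable D f.
Proof. by move=> [/measurable_int/measurable_EFinP ? /measurable_int/measurable_EFinP ?]. Qed.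

Lemma integrable_mull D (k : R) (h : R -> R) : measurable D ->
  mu.-integrable D (fun x => (h x)%:E) -> mu.-integrable D (fun x => (k * h x)%:E).
Proof.
move=> mD ih.
have : mu.-integrable D (fun x => k%:E * (h x)%:E)%E by exact: integrableZl.
by [].
Qed.

Lemma integrable_add D (h h' : R -> R) : measurable D ->
  mu.-integrable D (fun x => (h x)%:E) -> mu.-integrable D (fun x => (h' x)%:E) ->
  mu.-integrable D (fun x => (h x + h' x)%:E).
Proof.
move=> mD ih ih'.
have : mu.-integrable D ((EFin \o h) \+ (EFin \o h'))%E by exact: integrableD.
by [].
Qed.

(** One real dominating function controls both parts. *)
Lemma cintegrable_le D f (g : R -> R) : measurable D ->
  cmeasurable D f -> (forall x, D x -> abs1 (f x) <= g x) ->
  mu.-integrable D (EFin \o g) -> cintegrable D f.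
Proof.
move=> mD [mr mi] fg ig; split; apply: le_integrable ig => //.
- exact/measurable_EFinP.
- move=> x Dx /=; rewrite lee_fin (le_trans (abs1_Re _))// (le_trans (fg _ Dx))//.
  by rewrite ler_norm.
- exact/measurable_EFinP.
- move=> x Dx /=; rewrite lee_fin (le_trans (abs1_Im _))// (le_trans (fg _ Dx))//.
  by rewrite ler_norm.
Qed.

Lemma integrable_abs1 D f : measurable D -> cintegrable D f ->
  mu.-integrable D (fun x => (abs1 (f x))%:E).
Proof.
move=> mD [ir ii]; rewrite (_ : (fun _ => _) =
  ((EFin \o (Num.norm \o (fun x => Re (f x)))) \+ (EFin \o (Num.norm \o (fun x => Im (f x)))))%E); last first.
  by apply/funext => x.
by apply: integrableD => //; apply: integrable_norm.
Qed.

Lemma eq_cintegrable D f g : measurable D -> (forall x, D x -> f x = g x) ->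
  cintegrable D f -> cintegrable D g.
Proof.
by move=> mD fg [ir ii]; split; [apply: eq_integrable ir|apply: eq_integrable ii] => // x /set_mem Dx;
  rewrite fg.
Qed.

Lemma eq_cintegral D f g : (forall x, D x -> f x = g x) ->
  cintegral D f = cintegral D g.
Proof.
by move=> fg; congr Complex; apply: eq_Rintegral => x /set_mem Dx; rewrite fg.
Qed.

Lemma cintegrableZ D f (c : R[i]) : measurable D -> cintegrable D f ->
  cintegrable D (fun x => c * f x).
Proof.
move=> mD If; apply: (@cintegrable_le _ _ (fun x => abs1 c * abs1 (f x))) => //.
- by apply: cmeasurableM; [exact: cmeasurable_cst|exact: cintegrable_cmeasurable].
- by move=> x Dx; exact: abs1M.
- by apply: integrable_mull => //; exact: integrable_abs1.
Qed.

Lemma cintegralZ D f (c : R[i]) : measurable D -> cintegrable D f ->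
  cintegral D (fun x => c * f x) = c * cintegral D f.
Proof.
move=> mD [ir ii]; apply: complex_eq; rewrite /cintegral ?Re_mulc ?Im_mulc/=.
- rewrite -!RintegralZl// -RintegralB//.
  + by apply: eq_Rintegral => x _; rewrite Re_mulc.
  + exact: (integrable_mull _ mD ir).
  + exact: (integrable_mull _ mD ii).
- rewrite -!RintegralZl// -RintegralD//.
  + by apply: eq_Rintegral => x _; rewrite Im_mulc.
  + exact: (integrable_mull _ mD ii).
  + exact: (integrable_mull _ mD ir).
Qed.

Lemma cintegrableD D f g : measurable D -> cintegrable D f -> cintegrable D g ->
  cintegrable D (fun x => f x + g x).
Proof.
move=> mD [fr fi] [gr gi]; split.
- apply: eq_integrable (integrable_add mD fr gr) => // x _ /=; by case: (f x) (g x) => [? ?] [? ?].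
- apply: eq_integrable (integrable_add mD fi gi) => // x _ /=; by case: (f x) (g x) => [? ?] [? ?].
Qed.

Lemma cintegralD D f g : measurable D -> cintegrable D f -> cintegrable D g ->
  cintegral D (fun x => f x + g x) = cintegral D f + cintegral D g.
Proof.
move=> mD [fr fi] [gr gi]; apply: complex_eq; rewrite /cintegral/= -RintegralD//;
by apply: eq_Rintegral => x _; case: (f x) (g x) => [? ?] [? ?].
Qed.

Lemma cintegral_real D (h : R -> R) :
  cintegral D (fun x => (h x)%:C) = (\int[mu]_(x in D) h x)%:C.
Proof.
by rewrite /cintegral/= /Rintegral integral0.
Qed.

Lemma cintegrable_real D (h : R -> R) : measurable D ->
  mu.-integrable D (EFin \o h) -> cintegrable D (fun x => (h x)%:C).
Proof. by move=> mD ih; split => //=; exact: integrable0. Qed.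

Lemma cintegrable_sum D (F : nat -> R -> R[i]) n : measurable D ->
  (forall k, cintegrable D (F k)) ->
  cintegrable D (fun x => \sum_(k < n) F k x) /\
  cintegral D (fun x => \sum_(k < n) F k x) = \sum_(k < n) cintegral D (F k).
Proof.
move=> mD iF; elim: n => [|n [ih1 ih2]].
  have -> : (fun x => \sum_(k < 0) F k x) = (fun x => (0 : R)%:C).
    by apply/funext => x; rewrite big_ord0.
  rewrite cintegral_real big_ord0 /Rintegral integral0; split => //.
  by apply: cintegrable_real => //; exact: integrable0.
have -> : (fun x => \sum_(k < n.+1) F k x) = (fun x => \sum_(k < n) F k x + F n x).
  by apply/funext => x; rewrite big_ord_recr.
by rewrite big_ord_recr/= cintegralD// ih2; split=> //; exact: cintegrableD.
Qed.

End ComplexIntegral.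

(** * Exchange of integrals over a product of sets *)

Section Fubini.
Local Set Implicit Arguments.
Local Unset Strict Implicit.
Local Open Scope classical_set_scope.
Context {R : realType}.
Implicit Types (D E : set R).
Local Notation mu := (@lebesgue_measure R).
Local Notation Re := (@complex.Re R).
Local Notation Im := (@complex.Im R).

(** The theorem for product measures on the whole plane, applied to the function
    extended by 0 outside the rectangle. *)
Lemma tonelli_on D E (f : R * R -> R) : measurable D -> measurable E ->
  measurable_fun (D `*` E) f -> (forall x y, D x -> E y -> 0 <= f (x, y)) ->
  (\int[mu]_(x in D) \int[mu]_(y in E) (f (x, y))%:E =
   \int[mu]_(y in E) \int[mu]_(x in D) (f (x, y))%:E)%E /\
  measurable_fun D (fun x => \int[mu]_(y in E) (f (x, y))%:E)%E.
Proof.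
move=> mD mE mf f0.
pose g := (EFin \o f) \_ (D `*` E).
have mg : measurable_fun setT g.
  by apply/(measurable_restrictT _ _).1; [exact: measurableX|exact/measurable_EFinP].
have g0 z : (0 <= g z)%E.
  apply: erestrict_ge0 => -[x y] [/= Dx Ey]; rewrite lee_fin; exact: f0.
have gE x y : g (x, y) = (fun x => ((fun y => (f (x, y))%:E) \_ E) y) \_ D x :> \bar R.
  by rewrite /g !patchE/= in_setX/=; case: (x \in D) => //=; rewrite patchE.
have EQ x : D x -> (\int[mu]_y g (x, y) = \int[mu]_(y in E) (f (x, y))%:E)%E.
  move=> Dx; rewrite [RHS]integral_mkcond; apply: eq_integral => y _.
  by rewrite gE patchE mem_set.
split; last first.
  apply: (eq_measurable_fun (fubini_F mu g)).
    by move=> x /set_mem; exact: EQ.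
  by apply: measurable_funTS; exact: measurable_fun_fubini_tonelli_F.
transitivity (\int[mu]_x \int[mu]_y g (x, y))%E.
  rewrite integral_mkcond; apply: eq_integral => x _.
  rewrite patchE; case: ifPn => [/set_mem/EQ//|xD].
  by rewrite integral0_eq// => y _; rewrite gE patchE (negbTE xD).
rewrite fubini_tonelli//.
rewrite [RHS]integral_mkcond; apply: eq_integral => y _.
rewrite patchE; case: ifPn => [yE|yE].
  rewrite [RHS]integral_mkcond; apply: eq_integral => x _.
  by rewrite gE !patchE yE.
by rewrite integral0_eq// => x _; rewrite gE !patchE (negbTE yE); case: ifP.
Qed.

Lemma fubini_on D E (f : R * R -> R) : measurable D -> measurable E ->
  measurable_fun (D `*` E) f ->
  (\int[mu]_(x in D) \int[mu]_(y in E) `|f (x, y)|%:E < +oo)%E ->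
  (\int[mu]_(x in D) \int[mu]_(y in E) (f (x, y))%:E =
   \int[mu]_(y in E) \int[mu]_(x in D) (f (x, y))%:E)%E /\
  mu.-integrable D (fun x => \int[mu]_(y in E) (f (x, y))%:E)%E.
Proof.
move=> mD mE mf foo.
pose g := (EFin \o f) \_ (D `*` E).
have mg : measurable_fun setT g.
  by apply/(measurable_restrictT _ _).1; [exact: measurableX|exact/measurable_EFinP].
have gE x y : g (x, y) = (fun x => ((fun y => (f (x, y))%:E) \_ E) y) \_ D x :> \bar R.
  by rewrite /g !patchE/= in_setX/=; case: (x \in D) => //=; rewrite patchE.
have EQ x : D x -> (\int[mu]_y g (x, y) = \int[mu]_(y in E) (f (x, y))%:E)%E.
  move=> Dx; rewrite [RHS]integral_mkcond; apply: eq_integral => y _.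
  by rewrite gE patchE mem_set.
have ig : (mu \x mu)%E.-integrable setT g.
  apply/integrable12ltyP => //; move: foo; apply: le_lt_trans.
  rewrite [leRHS]integral_mkcond le_eqVlt; apply/orP; left; apply/eqP.
  apply: eq_integral => x _.
  have [xD|xD] := boolP (x \in D).
    rewrite [RHS]patchE xD [RHS]integral_mkcond; apply: eq_integral => y _.
    by rewrite gE !patchE xD; case: ifP => //; rewrite abse0.
  by rewrite patchE (negbTE xD) integral0_eq// => y _; rewrite gE patchE (negbTE xD) abse0.
split; last first.
  have iF : mu.-integrable D (fubini_F mu g).
    by apply: (integrableS _ _ _ (integrable_fubini_F ig)).
  by apply: eq_integrable iF => // x /set_mem; exact: EQ.
transitivity (\int[mu]_x \int[mu]_y g (x, y))%E.
  rewrite integral_mkcond; apply: eq_integral => x _.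
  rewrite patchE; case: ifPn => [/set_mem/EQ//|xD].
  by rewrite integral0_eq// => y _; rewrite gE patchE (negbTE xD).
rewrite Fubini//.
rewrite [RHS]integral_mkcond; apply: eq_integral => y _.
rewrite patchE; case: ifPn => [yE|yE].
  rewrite [RHS]integral_mkcond; apply: eq_integral => x _.
  by rewrite gE !patchE yE.
by rewrite integral0_eq// => x _; rewrite gE !patchE (negbTE yE); case: ifP.
Qed.

(** The sections are integrable at every point, so that both inner integrals are
    determined by the integrals of the parts without exceptional sets. *)
Lemma cfubini_on D E (f : R * R -> R[i]) : measurable D -> measurable E ->
  cmeasurable (D `*` E) f ->
  (\int[mu]_(x in D) \int[mu]_(y in E) (abs1 (f (x, y)))%:E < +oo)%E ->
  (forall x, D x -> cintegrable E (fun y => f (x, y))) ->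
  (forall y, E y -> cintegrable D (fun x => f (x, y))) ->
  cintegrable D (fun x => cintegral E (fun y => f (x, y))) /\
  cintegral D (fun x => cintegral E (fun y => f (x, y))) =
  cintegral E (fun y => cintegral D (fun x => f (x, y))).
Proof.
move=> mD mE [mr mi] foo iE iD.
have ma : measurable_fun (D `*` E) (fun z => abs1 (f z)) by exact: measurable_abs1.
have H (p : R[i] -> R) : (forall z, `|p z| <= abs1 z) ->
    measurable_fun (D `*` E) (fun z => p (f z)) ->
    (\int[mu]_(x in D) \int[mu]_(y in E) `|p (f (x, y))|%:E < +oo)%E.
  move=> pa mp; move: foo; apply: le_lt_trans.
  have ma' : measurable_fun (D `*` E) (fun z => `|p (f z)|).
    exact: (measurableT_comp (@normr_measurable R setT)).
  have sec x (h : R * R -> R) : D x -> measurable_fun (D `*` E) h -> measurable_fun E (fun y => (h (x, y))%:E).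
    move=> Dx mh; apply/measurable_EFinP.
    apply: (@measurable_comp _ _ _ _ _ _ (D `*` E) h E (fun y => (x, y))) => //.
    - exact: measurableX.
    - by move=> _ [y Ey <-].
    - exact: measurable_funTS (pair1_measurable x).
  apply: ge0_le_integral => //.
  - by move=> x Dx; exact: integral_ge0.
  - by have [_] := tonelli_on mD mE ma' (fun x y _ _ => normr_ge0 _).
  - by have [_] := tonelli_on mD mE ma (fun x y _ _ => abs1_ge0 _).
  - move=> x Dx; apply: ge0_le_integral => //.
    + exact: (sec x (fun z => `|p (f z)|)).
    + exact: (sec x (fun z => abs1 (f z))).
    + by move=> y _; rewrite lee_fin.
have [Er Ir] := fubini_on mD mE mr (H _ (@abs1_Re R) mr).
have [Ei Ii] := fubini_on mD mE mi (H _ (@abs1_Im R) mi).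
have G (p : R[i] -> R) (A B : set R) (h : R -> R -> R[i]) x : measurable B ->
    (forall x, A x -> mu.-integrable B (fun y => (p (h x y))%:E)) -> A x ->
    (fine (\int[mu]_(y in B) (p (h x y))%:E))%:E = (\int[mu]_(y in B) (p (h x y))%:E)%E.
  by move=> mB hh Ax; rewrite fineK//; apply: integrable_fin_num => //; exact: hh.
split; first split.
- apply: eq_integrable Ir => // x /set_mem Dx /=.
  rewrite (G Re D E (fun x y => f (x, y)))// => x' Dx'; exact: (iE x' Dx').1.
- apply: eq_integrable Ii => // x /set_mem Dx /=.
  rewrite (G Im D E (fun x y => f (x, y)))// => x' Dx'; exact: (iE x' Dx').2.
- rewrite [in LHS]/cintegral/= [in RHS]/cintegral/= ; congr Complex.
  + congr fine; transitivity (\int[mu]_(x in D) \int[mu]_(y in E) (Re (f (x, y)))%:E)%E.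
      apply: eq_integral => x /set_mem Dx.
      rewrite (G Re D E (fun x y => f (x, y)))// => x' Dx'; exact: (iE x' Dx').1.
    rewrite Er; apply: eq_integral => y /set_mem Ey.
    rewrite (G Re E D (fun y x => f (x, y)))// => x' Dx'; exact: (iD x' Dx').1.
  + congr fine; transitivity (\int[mu]_(x in D) \int[mu]_(y in E) (Im (f (x, y)))%:E)%E.
      apply: eq_integral => x /set_mem Dx.
      rewrite (G Im D E (fun x y => f (x, y)))// => x' Dx'; exact: (iE x' Dx').2.
    rewrite Ei; apply: eq_integral => y /set_mem Ey.
    rewrite (G Im E D (fun y x => f (x, y)))// => x' Dx'; exact: (iD x' Dx').2.
Qed.

End Fubini.

(** * Complex powers of positive reals *)

Section ComplexPower.
Local Set Implicit Arguments.
Local Unset Strict Implicit.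
Local Open Scope classical_set_scope.
Context {R : realType}.
Local Notation Re := (@complex.Re R).
Local Notation Im := (@complex.Im R).

Lemma Re_cpow (x : R) (z : R[i]) : Re (cpow x z) = x `^ Re z * cos (Im z * ln x).
Proof. by rewrite /cpow Re_realM. Qed.

Lemma Im_cpow (x : R) (z : R[i]) : Im (cpow x z) = x `^ Re z * sin (Im z * ln x).
Proof. by rewrite /cpow Im_realM. Qed.

Lemma Re_addc (z w : R[i]) : Re (z + w) = Re z + Re w.
Proof. by case: z w => [? ?] [? ?]. Qed.
Lemma Im_addc (z w : R[i]) : Im (z + w) = Im z + Im w.
Proof. by case: z w => [? ?] [? ?]. Qed.
Lemma Re_oppc (z : R[i]) : Re (- z) = - Re z. Proof. by case: z. Qed.
Lemma Im_oppc (z : R[i]) : Im (- z) = - Im z. Proof. by case: z. Qed.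

Lemma cpowD (x : R) (z w : R[i]) : 0 < x -> cpow x (z + w) = cpow x z * cpow x w.
Proof.
move=> x0; have xn0 : x != 0 by rewrite gt_eqF.
apply: complex_eq; [rewrite [RHS]Re_mulc|rewrite [RHS]Im_mulc];
  rewrite !Re_cpow !Im_cpow ?Re_cpow Re_addc Im_addc mulrDl powRD ?xn0 ?implybT//.
  by rewrite cosD; ring.
by rewrite sinD; ring.
Qed.

Lemma cpowM (x y : R) (z : R[i]) : 0 < x -> 0 < y ->
  cpow (x * y) z = cpow x z * cpow y z.
Proof.
move=> x0 y0; apply: complex_eq; [rewrite [RHS]Re_mulc|rewrite [RHS]Im_mulc];
  rewrite !Re_cpow !Im_cpow ?Re_cpow powRM ?ltW// lnM ?posrE// mulrDr.
  by rewrite cosD; ring.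
by rewrite sinD; ring.
Qed.

Lemma cpow_real (x a : R) : cpow x a%:C = (x `^ a)%:C.
Proof. by apply: complex_eq; rewrite ?(Re_cpow, Im_cpow)/= mul0r ?cos0 ?sin0 ?mulr1 ?mulr0. Qed.

Lemma cpow1 (x : R) : 0 < x -> cpow x 1 = x%:C.
Proof. by move=> x0; rewrite -[1 in LHS]/((1:R)%:C) cpow_real powRr1// ltW. Qed.

Lemma cpow0 (x : R) : cpow x 0 = 1.
Proof. by rewrite -[0 in LHS]/((0:R)%:C) cpow_real powRr0. Qed.

Lemma abs1_cpow (x : R) (z : R[i]) : abs1 (cpow x z) <= 2 * x `^ Re z.
Proof.
rewrite /abs1 Re_cpow Im_cpow !normrM (ger0_norm (powR_ge0 _ _)).
rewrite -mulrDr mulrC ler_wpM2r ?powR_ge0//.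
by have := lerD (cos_max (Im z * ln x)) (sin_max (Im z * ln x)).
Qed.

(** As [cpow x z] has modulus [x `^ Re z], multiplying by it changes [abs1] by this
    factor up to 2; the lower bound results from multiplying back by
    [cpow x (- z)]. *)
Lemma abs1_cpowM (x : R) (z w : R[i]) : abs1 (cpow x z * w) <= 2 * x `^ Re z * abs1 w.
Proof. by rewrite (le_trans (abs1M _ _))// ler_wpM2r ?abs1_ge0// abs1_cpow. Qed.

Lemma abs1_le_cpowM (x : R) (z w : R[i]) : 0 < x ->
  x `^ Re z * abs1 w <= 2 * abs1 (cpow x z * w).
Proof.
move=> x0; have -> : w = cpow x (- z) * (cpow x z * w).
  by rewrite mulrA -cpowD// addNr cpow0 mul1r.
rewrite [X in _ <= 2 * abs1 X](_ : _ = cpow x z * w); last first.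
  by rewrite [in LHS]mulrA [in LHS]mulrA -[in LHS]cpowD// subrr cpow0 mul1r.
apply: le_trans (ler_wpM2l (powR_ge0 _ _) (abs1_cpowM _ _ _)) _.
rewrite Re_oppc powRN mulrA mulrCA divff ?mulr1//.
by rewrite gt_eqF// powR_gt0.
Qed.

Lemma cmeasurable_cpow (z : R[i]) : cmeasurable setT (fun x : R => cpow x z).
Proof.
have mi : measurable_fun setT (fun x : R => Im z * ln x).
  by apply: measurable_funM => //; exact: measurable_ln.
split.
  under eq_fun do rewrite Re_cpow; apply: measurable_funM; first exact: measurable_powR.
  by apply: measurableT_comp mi; apply: continuous_measurable_fun; exact: continuous_cos.
under eq_fun do rewrite Im_cpow; apply: measurable_funM; first exact: measurable_powR.
by apply: measurableT_comp mi; apply: continuous_measurable_fun; exact: continuous_sin.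
Qed.

End ComplexPower.

(** * From nonnegative to complex-valued changes of variable *)

Section SignedChangeOfVariable.
Local Set Implicit Arguments.
Local Unset Strict Implicit.
Local Open Scope classical_set_scope.
Context {R : realType}.
Implicit Types (D E : set R) (C : (R -> R) -> Prop).
Local Notation mu := (@lebesgue_measure R).
Local Notation P := (`]0%R : R, +oo[%classic).
Local Notation Re := (@complex.Re R).
Local Notation Im := (@complex.Im R).

(** A change-of-variable formula known for the nonnegative functions of a class [C]
    extends to all of [C] by splitting into positive and negative parts, as soon as
    [C] contains these parts. Both the class of measurable functions and that of
    continuous functions are used. *)
Definition lattice_closed C := forall g, C g ->
  [/\ C (g^\+)%R, C (g^\-)%R & C (fun x => `|g x|)].

Definition ge0_cov C D E (phi w : R -> R) := forall g : R -> R, C g ->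
  (forall x, D x -> 0 <= g x) ->
  (\int[mu]_(x in D) (g x)%:E = \int[mu]_(x in E) (g (phi x) * w x)%:E)%E.

Lemma cov_signed C D E phi w (g : R -> R) : lattice_closed C ->
  ge0_cov C D E phi w -> (forall x, E x -> 0 <= w x) -> C g ->
  (\int[mu]_(x in D) (g x)%:E = \int[mu]_(x in E) (g (phi x) * w x)%:E)%E.
Proof.
move=> CC cov w0 /CC[Cp Cn _].
rewrite [LHS]integralE [RHS]integralE; congr (_ - _)%E.
- transitivity (\int[mu]_(x in D) ((g^\+)%R x)%:E)%E.
    by apply: eq_integral => x _; rewrite -[X in X^\+%E]/(EFin \o g) funerpos.
  rewrite cov//; apply: eq_integral => x /set_mem Ex.
  rewrite -[X in X^\+%E]/(EFin \o (fun x => g (phi x) * w x)) funerpos/=.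
  by rewrite /funrpos maxr_pMl ?mul0r// w0.
- transitivity (\int[mu]_(x in D) ((g^\-)%R x)%:E)%E.
    by apply: eq_integral => x _; rewrite -[X in X^\-%E]/(EFin \o g) funerneg.
  rewrite cov//; apply: eq_integral => x /set_mem Ex.
  rewrite -[X in X^\-%E]/(EFin \o (fun x => g (phi x) * w x)) funerneg/=.
  by rewrite /funrneg maxr_pMl ?mul0r ?mulNr// w0.
Qed.

Lemma cov_integrable C D E phi w (g : R -> R) : lattice_closed C ->
  ge0_cov C D E phi w -> (forall x, E x -> 0 <= w x) -> C g ->
  measurable_fun E (fun x => g (phi x) * w x) ->
  mu.-integrable D (EFin \o g) ->
  mu.-integrable E (EFin \o (fun x => g (phi x) * w x)).
Proof.
move=> CC cov w0 Cg mg /integrableP[_ ig]; apply/integrableP; split.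
  exact/measurable_EFinP.
move: ig; rewrite -[X in (X < _)%E]/(\int[mu]_(x in D) (`|g x|)%:E)%E.
have [_ _ Ca] := CC _ Cg.
rewrite (cov (fun x => `|g x|) Ca) => [|x _ //]; apply: le_lt_trans.
rewrite le_eqVlt; apply/orP; left; apply/eqP; apply: eq_integral => x /set_mem Ex.
by rewrite /= normrM (ger0_norm (w0 _ Ex)).
Qed.

Lemma ccov C D E phi w (f : R -> R[i]) : lattice_closed C ->
  measurable E ->
  ge0_cov C D E phi w -> (forall x, E x -> 0 <= w x) ->
  C (fun x => Re (f x)) -> C (fun x => Im (f x)) ->
  cmeasurable E (fun x => (w x)%:C * f (phi x)) ->
  cintegrable D f ->
  cintegrable E (fun x => (w x)%:C * f (phi x)) /\
  cintegral D f = cintegral E (fun x => (w x)%:C * f (phi x)).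
Proof.
move=> CC mE cov w0 Cr Ci [mr mi] [ir ii].
have rE x : Re ((w x)%:C * f (phi x)) = Re (f (phi x)) * w x by rewrite Re_realM mulrC.
have iE x : Im ((w x)%:C * f (phi x)) = Im (f (phi x)) * w x by rewrite Im_realM mulrC.
split.
  split.
    under eq_fun do rewrite rE.
    apply: (cov_integrable CC cov w0 Cr _ ir).
    by under eq_fun do rewrite -rE.
  under eq_fun do rewrite iE.
  apply: (cov_integrable CC cov w0 Ci _ ii).
  by under eq_fun do rewrite -iE.
apply: complex_eq; rewrite /cintegral/=; congr fine.
  by rewrite (cov_signed CC cov w0 Cr); under [RHS]eq_integral do rewrite rE.
by rewrite (cov_signed CC cov w0 Ci); under [RHS]eq_integral do rewrite iE.
Qed.

Lemma lattice_closed_measurable D : measurable D -> lattice_closed (fun g => measurable_fun D g).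
Proof.
move=> mD g mg; split.
- exact: measurable_funrpos.
- exact: measurable_funrneg.
- exact: (measurableT_comp (@normr_measurable R setT)).
Qed.

Lemma cintegral_scale (c : R) (f : R -> R[i]) : 0 < c ->
  cintegrable P f ->
  cintegrable P (fun x => f (c * x)) /\
  cintegral P (fun x => f (c * x)) = (c^-1)%:C * cintegral P f.
Proof.
move=> c0 If; have mP : measurable P by [].
have preP : ( *%R c @^-1` P = P).
  by apply/seteqP; split => x /=; rewrite !in_itv/= !andbT pmulr_rgt0.
have PP (x : R) : P x -> P (c * x).
  by rewrite /= !in_itv/= !andbT => x0; exact: mulr_gt0.
have [fr fi] := cintegrable_cmeasurable If.
have mc (g : R -> R) : measurable_fun P g ->
    measurable_fun P (fun x : R => g (c * x)).
  move=> mg; apply: (@measurable_comp _ _ _ _ _ _ P g) => //.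
  by move=> _ [x /PP + <-].
have cov : ge0_cov (fun g => measurable_fun P g) P P ( *%R c) (fun=> c).
  move=> g mg g0.
  under [RHS]eq_integral do rewrite mulrC EFinM.
  rewrite ge0_integralZl//=; last first.
  - by rewrite lee_fin ltW.
  - move=> x; rewrite in_itv/= andbT => x0; rewrite lee_fin; apply: g0.
    by rewrite /= in_itv/= andbT mulr_gt0.
  - by apply/measurable_EFinP; exact: mc.
  have := @ge0_integral_scale R c P (EFin \o g) c0 mP.
  rewrite preP => -> //; last exact/measurable_EFinP.
  by rewrite muleA -EFinM divff ?gt_eqF// mul1e.
have [] := ccov (lattice_closed_measurable mP) mP cov _ fr fi _ If.
- by move=> x _; exact: ltW.
- by apply: cmeasurableM; [exact: cmeasurable_cst|split; [exact: mc fr|exact: mc fi]].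
move=> i1 e1; have := cintegrableZ (c^-1)%:C mP i1; have := cintegralZ (c^-1)%:C mP i1.
have -> : (fun x => (c^-1)%:C * (c%:C * f (c * x))) = (fun x => f (c * x)).
  by apply/funext => x; rewrite mulrA -rmorphM/= mulVf ?gt_eqF// mul1r.
by move=> -> ?; rewrite e1.
Qed.

End SignedChangeOfVariable.

(** * Integrals over an open half-line by exhaustion *)

Section Exhaustion.
Local Set Implicit Arguments.
Local Unset Strict Implicit.
Local Open Scope classical_set_scope.
Context {R : realType}.
Local Notation mu := (@lebesgue_measure R).
Local Notation P := (`]0%R : R, +oo[%classic).

Lemma real_dominated_convergence (D : set R) (g : nat -> R -> R) (f h : R -> R) :
  measurable D -> (forall n, measurable_fun D (g n)) -> measurable_fun D f ->
  (forall x, D x -> g ^~ x @ \oo --> f x) ->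
  mu.-integrable D (fun x => (h x)%:E) ->
  (forall n x, D x -> `|g n x| <= h x) ->
  mu.-integrable D (fun x => (f x)%:E) /\
  (\int[mu]_(x in D) (g n x)%:E @[n --> \oo] --> \int[mu]_(x in D) (f x)%:E)%E.
Proof.
move=> mD mg mf gf ih gh.
have [||||i _ c] := @dominated_convergence _ _ R mu D mD (fun n => EFin \o g n) (EFin \o f)
  (EFin \o h) _ _ _ ih.
- by move=> n; apply/measurable_EFinP; exact: mg.
- by apply/measurable_EFinP; exact: mf.
- by apply: aeW => x Dx; apply: cvg_EFin; [exact: nearW|exact: gf].
- by apply: aeW => x n Dx; rewrite lee_fin gh.
by split.
Qed.

(** The fundamental theorem with hypotheses on the closed interval, which are
    the ones available for functions that are smooth on an open half-line. *)
Lemma FTC_itv (f F : R -> R) (a b : R) : a < b ->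
  (forall x, a <= x <= b -> is_derive x 1 F (f x)) ->
  (forall x, a <= x <= b -> {for x, continuous f}) ->
  (\int[mu]_(x in `[a, b]) (f x)%:E = (F b - F a)%:E)%E.
Proof.
move=> ab dF cf; rewrite (@continuous_FTC2 _ f F)//.
- apply: continuous_in_subspaceT => x; rewrite inE/= in_itv/=; exact: cf.
- have cF x : a <= x <= b -> {for x, continuous F}.
    by move=> xab; apply/differentiable_continuous/derivable1_diffP; have [] := dF x xab.
  split.
  + by move=> x; rewrite in_itv/= => /andP[/ltW ax /ltW xb]; have [] := dF x _; rewrite ?ax.
  + by apply: cvg_at_right_filter; apply: cF; rewrite lexx ltW.
  + by apply: cvg_at_left_filter; apply: cF; rewrite lexx ltW.
- move=> x; rewrite in_itv/= => /andP[/ltW ax /ltW xb].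
  by rewrite derive1E; apply: derive_val; apply: dF; rewrite ax.
Qed.

(** The compact intervals [cutoff n, n + 2] exhaust the open half-line; the shift by 2
    keeps [cutoff n] at most one half, so that [cutoff n, 1 - cutoff n] is also
    an interval, exhausting [ ]0, 1[ ]. *)
Definition cutoff (n : nat) : R := (n.+2%:R)^-1.

Lemma cutoff_gt0 n : 0 < cutoff n. Proof. by rewrite invr_gt0. Qed.

Lemma cutoff_le (m n : nat) : (m <= n)%N -> cutoff n <= cutoff m.
Proof. by move=> mn; rewrite lef_pV2 ?posrE// ler_nat. Qed.

Lemma cutoff_lt1 n : cutoff n < 1.
Proof. by rewrite invf_lt1// ltr1n. Qed.

Lemma exists_cutoff_le (x : R) : 0 < x -> exists n, cutoff n <= x.
Proof.
move=> x0; exists (Num.truncn x^-1); rewrite -[leRHS]invrK lef_pV2 ?posrE ?invr_gt0//.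
by rewrite (le_trans (ltW (truncnS_gt _)))// ler_nat.
Qed.

Lemma nondecreasing_itv (a b : nat -> R) : (forall m n, (m <= n)%N -> a n <= a m) ->
  (forall m n, (m <= n)%N -> b m <= b n) ->
  nondecreasing_seq (fun n => `[a n, b n]%classic : set R).
Proof.
move=> aa bb m n mn; rewrite subsetEset => x /=; rewrite !in_itv/= => /andP[mx xm]; apply/andP; split.
  exact: le_trans (aa _ _ mn) mx.
exact: le_trans xm (bb _ _ mn).
Qed.

Lemma exhaust_oy : \bigcup_n `[cutoff n, n.+2%:R] = P.
Proof.
apply/seteqP; split => [x [n _] /=|x /=].
  by rewrite !in_itv/= andbT => /andP[+ _]; apply: lt_le_trans; exact: cutoff_gt0.
rewrite in_itv/= andbT => x0; have [n nx] := exists_cutoff_le x0.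
exists (maxn n (Num.truncn x)) => //=; rewrite in_itv/=; apply/andP; split.
  by apply: le_trans nx; apply: cutoff_le; exact: leq_maxl.
by rewrite (le_trans (ltW (truncnS_gt x)))// ler_nat !ltnS (leq_trans (leq_maxr n _))// ltnW.
Qed.

Lemma nd_exhaust_oy : nondecreasing_seq (fun n => `[cutoff n, n.+2%:R]%classic : set R).
Proof. by apply: nondecreasing_itv => m n mn; [exact: cutoff_le|rewrite ler_nat !ltnS]. Qed.

Lemma ge0_cvg_exhaust_oy (f : R -> R) :
  measurable_fun P f ->
  (forall x : R, 0 < x -> 0 <= f x) ->
  (\int[mu]_(x in `[cutoff n, n.+2%:R]) (f x)%:E @[n --> \oo] -->
   \int[mu]_(x in P) (f x)%:E)%E.
Proof.
move=> mf f0.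
have sub n : `[cutoff n, n.+2%:R] `<=` P.
  by rewrite -exhaust_oy => x; exists n.
rewrite -exhaust_oy; apply: ge0_nondecreasing_set_cvg_integral.
- exact: nd_exhaust_oy.
- by [].
- by move=> n; apply: measurable_funS (sub n) _ => //; exact/measurable_EFinP.
- by move=> n x /sub /=; rewrite in_itv/= andbT lee_fin; exact: f0.
Qed.

(** For a nonnegative integrand a bounded primitive is enough to get integrability;
    no limit at the ends has to be known. *)
Lemma ge0_integral_primitive_le (f F : R -> R) (M : R) :
  (forall x : R, 0 < x -> is_derive x 1 F (f x)) ->
  (forall x : R, 0 < x -> {for x, continuous f}) ->
  (forall x : R, 0 < x -> 0 <= f x) ->
  (forall x : R, 0 < x -> 0 <= F x <= M) ->
  (\int[mu]_(x in P) (f x)%:E <= M%:E)%E.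
Proof.
move=> dF cf f0 FM.
have mf : measurable_fun P f.
  apply: open_continuous_measurable_fun; first exact: interval_open.
  by move=> x; rewrite inE/= in_itv/= andbT; exact: cf.
have H := ge0_cvg_exhaust_oy mf f0.
rewrite -(cvg_lim _ H)//; apply: lime_le; first by apply/cvg_ex; eexists; exact: H.
apply: nearW => n.
have an x : cutoff n <= x <= n.+2%:R -> 0 < x by move=> /andP[+ _]; apply: lt_le_trans; exact: cutoff_gt0.
have ab : cutoff n < n.+2%:R by rewrite (lt_trans (cutoff_lt1 n))// ltr1n.
rewrite (FTC_itv ab (fun x h => dF x (an x h)) (fun x h => cf x (an x h))).
have /andP[Fa _] := FM _ (cutoff_gt0 n); have /andP[_ Fb] := FM _ (ltr0Sn R n.+1).
by rewrite lee_fin; lra.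
Qed.

Lemma integral_primitive (f F : R -> R) (A B : R) :
  (forall x : R, 0 < x -> is_derive x 1 F (f x)) ->
  (forall x : R, 0 < x -> {for x, continuous f}) ->
  mu.-integrable P (EFin \o f) ->
  F (cutoff n) @[n --> \oo] --> A -> F n.+2%:R @[n --> \oo] --> B ->
  (\int[mu]_(x in P) (f x)%:E = (B - A)%:E)%E.
Proof.
move=> dF cf If FA FB.
have mP : measurable P by [].
have sub n : `[cutoff n, n.+2%:R] `<=` P.
  by rewrite -exhaust_oy => x; exists n.
have mf : measurable_fun P (EFin \o f) by exact: measurable_int If.
pose g n := f \_ `[cutoff n, n.+2%:R].
have mf' : measurable_fun P f by exact/measurable_EFinP.
have mg n : measurable_fun P (g n).
  apply/measurable_restrict => //; apply: (measurable_funS _ _ mf') => //.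
have gf x : P x -> g ^~ x @ \oo --> f x.
  rewrite -exhaust_oy => -[n _ nx].
  apply: (@cvg_near_cst _ _ (f x)).
  exists n => // m /= nm; rewrite /g patchE mem_set//.
  by have := nd_exhaust_oy nm; rewrite subsetEset; exact.
have ia : mu.-integrable P (fun x => `|f x|%:E) by exact: integrable_norm If.
have ga n x : P x -> `|g n x| <= `|f x|.
  by rewrite /g patchE; case: ifP => // _ _; rewrite normr0.
have [_ H] := real_dominated_convergence mP mg mf' gf ia ga.
apply/esym; apply: (cvg_unique _ _ H) => //.
have -> : (fun n => \int[mu]_(x in P) (g n x)%:E)%E = (fun n => (F n.+2%:R - F (cutoff n))%:E).
  apply/funext => n /=.
  have an x : cutoff n <= x <= n.+2%:R -> 0 < x by move=> /andP[+ _]; apply: lt_le_trans; exact: cutoff_gt0.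
  have ->: (\int[mu]_(x in P) (g n x)%:E = \int[mu]_(x in `[cutoff n, n.+2%:R]) (f x)%:E)%E.
    rewrite -[in RHS](setIidr (sub n)) integral_mkcondr.
    by apply: eq_integral => x _; rewrite /g restrict_EFin.
  have ab : cutoff n < n.+2%:R by rewrite (lt_trans (cutoff_lt1 n))// ltr1n.
  by rewrite -(FTC_itv ab (fun x h => dF x (an x h)) (fun x h => cf x (an x h))).
by apply: cvg_EFin; [exact: nearW|apply: cvgB].
Qed.

End Exhaustion.

(** * The substitution by the square on the unit interval *)

Section SquareSubstitution.
Local Set Implicit Arguments.
Local Unset Strict Implicit.
Local Open Scope classical_set_scope.
Context {R : realType}.
Local Notation mu := (@lebesgue_measure R).
Local Notation I01 := (`]0%R : R, 1%R[%classic).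
Local Notation cutoff := (@cutoff R).

Lemma cutoff_le_half n : cutoff n <= 1 / 2.
Proof. by rewrite /cutoff mul1r lef_pV2 ?posrE// ler_nat. Qed.

Lemma exhaust_oo (a b : nat -> R) :
  (forall m n, (m <= n)%N -> a n <= a m) -> (forall m n, (m <= n)%N -> b m <= b n) ->
  (forall n, 0 < a n) -> (forall n, b n < 1) ->
  (forall x, 0 < x -> exists n, a n <= x) -> (forall x, x < 1 -> exists n, x <= b n) ->
  \bigcup_n `[a n, b n] = I01 :> set R.
Proof.
move=> aa bb a0 b1 ea eb; apply/seteqP; split => [x [n _] /=|x /=].
  rewrite !in_itv/= => /andP[ax xb].
  by rewrite (lt_le_trans _ ax) ?a0// (le_lt_trans xb).
rewrite in_itv/= => /andP[/ea[m mx] /eb[n xn]].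
exists (maxn m n) => //=; rewrite in_itv/=; apply/andP; split.
  by apply: le_trans mx; apply: aa; exact: leq_maxl.
by apply: (le_trans xn); apply: bb; exact: leq_maxr.
Qed.

Lemma ge0_cvg_exhaust_oo (a b : nat -> R) (f : R -> R) :
  (forall m n, (m <= n)%N -> a n <= a m) -> (forall m n, (m <= n)%N -> b m <= b n) ->
  (forall n, 0 < a n) -> (forall n, b n < 1) ->
  (forall x, 0 < x -> exists n, a n <= x) -> (forall x, x < 1 -> exists n, x <= b n) ->
  measurable_fun I01 f -> (forall x : R, 0 < x < 1 -> 0 <= f x) ->
  (\int[mu]_(x in `[a n, b n]) (f x)%:E @[n --> \oo] -->
   \int[mu]_(x in I01) (f x)%:E)%E.
Proof.
move=> aa bb a0 b1 ea eb mf f0.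
have E := exhaust_oo aa bb a0 b1 ea eb.
have sub n : `[a n, b n] `<=` I01 by rewrite -E => x; exists n.
rewrite -E; apply: ge0_nondecreasing_set_cvg_integral.
- exact: nondecreasing_itv.
- by [].
- by move=> n; apply: measurable_funS (sub n) _ => //; exact/measurable_EFinP.
- by move=> n x /sub /=; rewrite in_itv/= lee_fin; exact: f0.
Qed.

Definition continuous01 (g : R -> R) := forall x : R, 0 < x < 1 -> {for x, continuous g}.

Lemma measurable_continuous01 g : continuous01 g -> measurable_fun I01 g.
Proof.
move=> cg; apply: open_continuous_measurable_fun; first exact: interval_open.
by move=> x; rewrite inE/= in_itv/=; exact: cg.
Qed.

Lemma lattice_closed_continuous01 : lattice_closed continuous01.
Proof.
move=> g cg; split=> x x01; have cx := cg x x01.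
- by apply: continuous_max => //; exact: cst_continuous.
- by apply: continuous_max; [exact: continuousN|exact: cst_continuous].
- by apply: continuous_comp => //; exact: norm_continuous.
Qed.

(** The substitution rule holds on compact subintervals; the images of the
    intervals [cutoff n, 1 - cutoff n] under the square exhaust [ ]0, 1[ ] as well. *)
Lemma cov_sqr : ge0_cov continuous01 I01 I01 (fun x => x ^+ 2) (fun x => 2 * x).
Proof.
move=> g cg g0.
have g0' (x : R) : 0 < x < 1 -> 0 <= g x by move=> x01; apply: g0; rewrite /= in_itv.
have sq01 (x : R) : 0 < x < 1 -> 0 < x ^+ 2 < 1.
  by move=> /andP[x0 x1]; rewrite exprn_gt0//= expr_lt1// ltW.
pose b n : R := 1 - cutoff n.
have bb m n : (m <= n)%N -> b m <= b n by move=> mn; rewrite lerB// cutoff_le.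
have b1 n : b n < 1 by rewrite ltrBlDr ltrDl cutoff_gt0.
have b0 n : 0 < b n by rewrite subr_gt0 cutoff_lt1.
have eb (x : R) : x < 1 -> exists n, x <= b n.
  rewrite -subr_gt0 => /exists_cutoff_le[n nx]; exists n; rewrite /b; lra.
have ab n : cutoff n <= b n by have := cutoff_le_half n; rewrite /b; lra.
have cgq : continuous01 (fun x => g (x ^+ 2) * (2 * x)).
  move=> x x01; apply: continuousM.
    by apply: (continuous_comp (@exprn_continuous _ 2 x)); apply: cg; exact: sq01.
  exact: mulrl_continuous.
have H1 := ge0_cvg_exhaust_oo (a := cutoff) (b := b) (f := fun x => g (x ^+ 2) * (2 * x))
  (@cutoff_le R) bb (@cutoff_gt0 R) b1 (@exists_cutoff_le R) eb (measurable_continuous01 cgq).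
have H2 := ge0_cvg_exhaust_oo (a := fun n => cutoff n ^+ 2) (b := fun n => b n ^+ 2) (f := g).
apply: (cvg_unique _ (H2 _ _ _ _ _ _ _ _)) => //.
- by move=> m n mn; apply: lerXn2r; rewrite ?nnegrE ?(ltW (cutoff_gt0 _)) ?cutoff_le.
- by move=> m n mn; apply: lerXn2r; rewrite ?nnegrE ?(ltW (b0 _)) ?bb.
- by move=> n; rewrite exprn_gt0// cutoff_gt0.
- by move=> n; rewrite expr_lt1// ltW.
- move=> x x0; have [n nx] := exists_cutoff_le x0; exists n.
  apply: le_trans nx; rewrite expr2 ger_pMl ?cutoff_gt0//; exact/ltW/cutoff_lt1.
- move=> x; rewrite -subr_gt0 => x1.
  have /exists_cutoff_le[n nx] : 0 < (1 - x) / 2 by rewrite divr_gt0.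
  exists n; rewrite /b; have := cutoff_gt0 (R := R) n; nra.
- exact: measurable_continuous01.
have -> : (fun n => \int[mu]_(x in `[(cutoff n ^+ 2)%R, (b n ^+ 2)%R]) (g x)%:E)%E =
          (fun n => \int[mu]_(x in `[cutoff n, b n]) (g (x ^+ 2) * (2 * x))%:E)%E.
  apply/funext => n.
  have in01 (x : R) : cutoff n <= x <= b n -> 0 < x < 1.
    move=> /andP[ax xb]; apply/andP; split; first exact: lt_le_trans (cutoff_gt0 n) ax.
    exact: le_lt_trans xb (b1 n).
  have dE (x : R) : (fun x : R => x ^+ 2)^`() x = 2 * x.
    by rewrite exp_derive1 expr1.
  have dfun : (fun x : R => x ^+ 2)^`() = (fun x => 2 * x) by apply/funext.
  have cq (x : R) : {for x, continuous (fun x : R => x ^+ 2)} by exact: exprn_continuous.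
  have c2 (x : R) : {for x, continuous (fun x : R => 2 * x)} by exact: mulrl_continuous.
  rewrite (@integration_by_substitution_increasing R (fun x : R => x ^+ 2) g (cutoff n) (b n))//.
  - by apply: eq_integral => x _; rewrite dfun.
  - move=> x y; rewrite !in_itv/= => /in01/andP[x0 _] /in01/andP[y0 _] xy.
    by rewrite ltrXn2r// ?nnegrE ltW.
  - by rewrite dfun => x _; exact: c2.
  - by rewrite dfun; apply/cvg_ex; exists (2 * cutoff n); apply: cvg_at_right_filter; exact: c2.
  - by rewrite dfun; apply/cvg_ex; exists (2 * b n); apply: cvg_at_left_filter; exact: c2.
  - split.
    + by move=> x _; exact: exprn_derivable.
    + by apply: cvg_at_right_filter; exact: cq.
    + by apply: cvg_at_left_filter; exact: cq.
  - apply: continuous_in_subspaceT => x; rewrite inE/= in_itv/= => /andP[ax xb].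
    apply: cg; apply/andP; split.
      by apply: lt_le_trans ax; rewrite exprn_gt0// cutoff_gt0.
    by apply: (le_lt_trans xb); rewrite expr_lt1// ltW.
apply: H1 => x x01; rewrite mulr_ge0 ?g0' ?sq01// mulr_ge0//.
by move: x01 => /andP[/ltW].
Qed.

End SquareSubstitution.

(** * The Gamma function: convergence, functional equation, absence of zeros *)

Section GammaFunction.
Local Set Implicit Arguments.
Local Unset Strict Implicit.
Local Open Scope classical_set_scope.
Context {R : realType}.
Local Notation mu := (@lebesgue_measure R).
Local Notation Re := (@complex.Re R).
Local Notation Im := (@complex.Im R).
Local Notation P := (`]0%R : R, +oo[%classic).
Local Notation cutoff := (@cutoff R).

(** The tangent of the logarithm at [K]: powers of [1 + t] are bounded by a constant
    times [expR t]. *)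
Lemma mul_ln_le (K t : R) : 0 < K -> 0 <= t ->
  K * ln (1 + t) <= t + (K * ln K + 1 - K).
Proof.
move=> K0 t0; have t1 : 0 < 1 + t by rewrite ltr_pwDl.
have : ln ((1 + t) / K) <= (1 + t) / K - 1.
  have := @le_ln1Dx R ((1 + t) / K - 1); rewrite addrCA subrr addr0; apply.
  by rewrite ltrBrDl subrr divr_gt0.
rewrite ln_div ?posrE// => H; have := ler_wpM2l (ltW K0) H.
rewrite !mulrBr mulrCA divff ?gt_eqF// !mulr1; lra.
Qed.

(** The derivative of [(t / (1 + t)) `^ x], written through logarithms. *)
Definition gamma_dominant (x t : R) : R :=
  expR (x * (ln t - ln (1 + t))) * (x * (t^-1 - (1 + t)^-1)).

Lemma integrable_gamma_dominant (x : R) : 0 < x ->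
  mu.-integrable P (fun t => (gamma_dominant x t)%:E).
Proof.
move=> x0.
have c1 (t : R) : 0 < t -> {for t, continuous (fun t : R => 1 + t)}.
  by move=> _; apply: continuousD; [exact: cst_continuous|exact: cvg_id].
have cl (t : R) : 0 < t -> {for t, continuous (fun t : R => ln (1 + t))}.
  by move=> t0; apply: (continuous_comp (c1 _ t0)); apply: continuous_ln; rewrite addr_gt0.
have cont (t : R) : 0 < t -> {for t, continuous (gamma_dominant x)}.
  move=> t0; apply: continuousM.
    apply: continuous_comp; last exact: continuous_expR.
    apply: continuousM; first exact: cst_continuous.
    by apply: continuousB; [exact: continuous_ln|exact: cl].
  apply: continuousM; first exact: cst_continuous.
  apply: continuousB; first by apply: inv_continuous; rewrite gt_eqF.
  by apply: continuousV; [rewrite gt_eqF ?addr_gt0|exact: c1].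
have ge0 (t : R) : 0 < t -> 0 <= gamma_dominant x t.
  move=> t0; rewrite mulr_ge0 ?expR_ge0// mulr_ge0 ?ltW// subr_gt0.
  by rewrite ltf_pV2 ?posrE ?addr_gt0// ltrDr.
apply/integrableP; split.
  apply/measurable_EFinP; apply: open_continuous_measurable_fun; first exact: interval_open.
  by move=> t; rewrite inE/= in_itv/= andbT; exact: cont.
have -> : (\int[mu]_(t in P) `|(gamma_dominant x t)%:E| = \int[mu]_(t in P) (gamma_dominant x t)%:E)%E.
  apply: eq_integral => t /set_mem; rewrite /= in_itv/= andbT => t0.
  by rewrite ger0_norm// ge0.
apply: (@le_lt_trans _ _ 1%:E); last exact: ltry.
apply: (@ge0_integral_primitive_le R _ (fun t => expR (x * (ln t - ln (1 + t)))) 1) => //.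
- move=> t t0.
  have t1 : 0 < 1 + t by rewrite addr_gt0.
  have d1 : is_derive t 1 (cst 1 + idfun : R -> R) (0 + 1) by apply: is_deriveD.
  have d2 := @is_derive1_comp R (@ln R) (cst 1 + idfun) t _ _ (is_derive1_ln t1) d1.
  have d3 := is_deriveZ x (is_deriveB (is_derive1_ln t0) d2).
  have := is_derive1_comp (is_derive_expR _) d3.
  move=> h; apply: (is_derive_eq h).
  by rewrite /gamma_dominant /= add0r mulr1.
- move=> t t0; rewrite expR_ge0/= -expR0 ler_expR pmulr_rle0// subr_le0.
  by rewrite ler_ln ?posrE ?addr_gt0// lerDr.
Qed.

(** The integrand of [Gamma x] is at most a constant times an integrand that has
    the bounded primitive [(t / (1 + t)) `^ x]. *)
Lemma gamma_integrand_le (x : R) : 0 < x -> exists C, forall t, 0 < t ->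
  t `^ (x - 1) * expR (- t) <= C * gamma_dominant x t.
Proof.
move=> x0; pose K := x + 1.
have K0 : 0 < K by rewrite addr_gt0.
exists (expR (K * ln K + 1 - K) / x) => t t0.
have t1 : 0 < 1 + t by rewrite addr_gt0.
have -> : gamma_dominant x t = x * (t `^ (x - 1) * expR (- (K * ln (1 + t)))).
  rewrite /gamma_dominant /powR gt_eqF// -expRD.
  have -> : (x - 1) * ln t + - (K * ln (1 + t)) = x * (ln t - ln (1 + t)) - ln t - ln (1 + t).
    by rewrite /K; ring.
  rewrite [in RHS]expRD expRD !expRN !lnK ?posrE//.
  by field; rewrite !gt_eqF.
rewrite mulrA divfK ?gt_eqF// mulrCA ler_pM2l ?powR_gt0// -expRD ler_expR.
by have := mul_ln_le K0 (ltW t0); lra.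
Qed.

Lemma integrable_gamma (x : R) : 0 < x ->
  mu.-integrable P (fun t => (t `^ (x - 1) * expR (- t))%:E).
Proof.
move=> x0; have [C HC] := gamma_integrand_le x0.
have mP : measurable P by [].
apply: le_integrable (integrable_mull C mP (integrable_gamma_dominant x0)) => //.
  apply/measurable_EFinP; apply: measurable_funM.
    by apply: measurable_funTS; exact: measurable_powR.
  by apply: measurableT_comp.
move=> t /=; rewrite in_itv/= andbT => t0; rewrite lee_fin ger0_norm; last first.
  by rewrite mulr_ge0 ?powR_ge0 ?expR_ge0.
exact: le_trans (HC _ t0) (ler_norm _).
Qed.

Definition gamma_integrand (z : R[i]) (t : R) : R[i] := cpow t (z - 1) * (expR (- t))%:C.

Lemma itv_oyE (x : R) : P x = (0 < x) :> Prop.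
Proof. by rewrite /= in_itv/= andbT. Qed.

Lemma cmeasurable_gamma_integrand (z : R[i]) : cmeasurable setT (gamma_integrand z).
Proof.
apply: cmeasurableM; first exact: cmeasurable_cpow.
by apply: cmeasurable_real; apply: measurableT_comp.
Qed.

Lemma cintegrable_gamma (z : R[i]) : 0 < Re z -> cintegrable P (gamma_integrand z).
Proof.
move=> z0; have mP : measurable P by [].
apply: (cintegrable_le (g := fun t => 2 * (t `^ (Re z - 1) * expR (- t)))) => //.
- by apply: cmeasurableS (cmeasurable_gamma_integrand z).
- move=> t; rewrite itv_oyE => t0; rewrite (le_trans (abs1_cpowM _ _ _))//.
  by rewrite Re_addc /= /abs1/= normr0 addr0 (ger0_norm (expR_ge0 _)) mulrA.
- exact: integrable_mull (integrable_gamma z0).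
Qed.

(** The Gamma function on real arguments, as a real number. *)
Definition rGamma (x : R) : R := \int[mu]_(t in P) (t `^ (x - 1) * expR (- t)).

Lemma Gamma_real (x : R) : Gamma x%:C = (rGamma x)%:C.
Proof.
rewrite /Gamma -cintegral_real; congr cintegral; apply/funext => t.
by rewrite -[1%R]/((1:R)%:C) -rmorphB/= cpow_real -rmorphM.
Qed.

Lemma rGamma_gt0 (x : R) : 0 < x -> 0 < rGamma x.
Proof.
move=> x0; have ig := integrable_gamma x0.
pose m := expR (- (`|x - 1| + 2)).
pose J := (`[1, 2]%classic : set R).
have mJ : measurable J by rewrite /J.
have sub : J `<=` P.
  by move=> t; rewrite itv_oyE /J/= in_itv/= => /andP[t1 _]; exact: lt_le_trans t1.
rewrite -lte_fin /rGamma /Rintegral fineK; last exact: integrable_fin_num.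
apply: (@lt_le_trans _ _ (\int[mu]_(t in J) m%:E)%E).
  have muJ : mu J = 1%:E.
    by rewrite /J lebesgue_measure_itv/= lte_fin ltr1n -EFinB; congr EFin; lra.
  by rewrite integral_cst//= muJ mule1 lte_fin expR_gt0.
apply: (@le_trans _ _ (\int[mu]_(t in J) (t `^ (x - 1) * expR (- t))%:E)%E).
  apply: ge0_le_integral => //.
  - by move=> t _; rewrite lee_fin expR_ge0.
  - exact: measurable_funS sub (measurable_int _ ig).
  - move=> t; rewrite /J/= in_itv/= => /andP[t1 t2]; rewrite lee_fin.
    have t0 : 0 < t by exact: lt_le_trans t1.
    rewrite /powR gt_eqF// -expRD ler_expR.
    have l0 := ln_ge0 t1.
    have l1 : ln t <= 1 by have := ln_sublinear t0; have := @le_ln1Dx R (t - 1); rewrite addrCA subrr addr0 => /(_ _) H _; apply: le_trans (H _) _; lra.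
    have : - `|x - 1| <= (x - 1) * ln t.
      rewrite lerNl -mulNr (le_trans (ler_norm _))// normrM normrN (ger0_norm l0).
      by rewrite ler_piMr.
    lra.
apply: ge0_subset_integral => //; first exact: measurable_int ig.
by move=> t _; rewrite lee_fin mulr_ge0 ?powR_ge0 ?expR_ge0.
Qed.

Lemma cvg_cutoff : cutoff n @[n --> \oo] --> (0 : R).
Proof.
by have := @cvg_harmonic R; rewrite -cvg_shiftS.
Qed.

(** The real and imaginary parts of [cpow t z * expR (- t)] for [z] with parts
    [x] and [y] correspond to the phases [c = 0] and [c = - (pi / 2)], so that
    one primitive serves both parts in the integration by parts. *)
Definition gamma_prim (x y c t : R) : R := expR (x * ln t - t) * cos (y * ln t + c).

Definition gamma_prim' (x y c t : R) : R :=
  expR (x * ln t - t) * ((x / t - 1) * cos (y * ln t + c) - y / t * sin (y * ln t + c)).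

Lemma is_derive_gamma_prim x y c (t : R) : 0 < t ->
  is_derive t 1 (gamma_prim x y c) (gamma_prim' x y c t).
Proof.
move=> t0.
have d1 := is_deriveB (is_deriveZ x (is_derive1_ln t0)) (is_derive_id t (1:R)).
have d2 := is_deriveD (is_deriveZ y (is_derive1_ln t0)) (is_derive_cst c t (1:R)).
have d3 := is_derive1_comp (is_derive_expR _) d1.
have d4 := is_derive1_comp (is_derive_cos _) d2.
have h := is_deriveM d3 d4.
apply: (is_derive_eq h).
by rewrite /gamma_prim' /= -![_ *: _]/(_ * _) addr0; ring.
Qed.

Lemma continuous_gamma_prim' x y c (t : R) : 0 < t ->
  {for t, continuous (gamma_prim' x y c)}.
Proof.
move=> t0.
have cl : {for t, continuous (@ln R)} by exact: continuous_ln.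
have cV (a : R) : {for t, continuous (fun t : R => a / t)}.
  apply: continuousM; first exact: cst_continuous.
  by apply: inv_continuous; rewrite gt_eqF.
have cL (a b : R) : {for t, continuous (fun t : R => a * ln t + b)}.
  apply: continuousD; last exact: cst_continuous.
  by apply: continuousM => //; exact: cst_continuous.
apply: continuousM.
  apply: continuous_comp; last exact: continuous_expR.
  apply: continuousB; last exact: cvg_id.
  by apply: continuousM => //; exact: cst_continuous.
apply: continuousB; apply: continuousM.
- by apply: continuousB => //; exact: cst_continuous.
- by apply: (continuous_comp (cL y c)); exact: continuous_cos.
- exact: cV.
- by apply: (continuous_comp (cL y c)); exact: continuous_sin.
Qed.

Lemma gamma_prim_le x y c t : `|gamma_prim x y c t| <= expR (x * ln t - t).
Proof. by rewrite normrM ger0_norm ?expR_ge0// ler_piMr ?expR_ge0// cos_max. Qed.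

Lemma norm_le_cvg0 (u v : nat -> R) : (forall n, `|u n| <= v n) ->
  v n @[n --> \oo] --> (0 : R) -> u n @[n --> \oo] --> (0 : R).
Proof.
move=> uv v0; apply: (@squeeze_cvgr _ _ _ _ (fun n => - v n) v) => //.
  by apply: nearW => n; rewrite -ler_norml.
by rewrite -oppr0; apply: cvgN.
Qed.

Lemma gamma_prim_cvg0 x y c : 0 < x -> gamma_prim x y c (cutoff n) @[n --> \oo] --> 0.
Proof.
move=> x0; apply: (@norm_le_cvg0 _ (fun n => cutoff n `^ x)).
  move=> n; apply: (le_trans (gamma_prim_le _ _ _ _)).
  rewrite /powR gt_eqF ?cutoff_gt0// ler_expR.
  by rewrite gerBl ltW// cutoff_gt0.
have /cvg_at_rightP := powR_cvg0 x0; apply; split; last exact: cvg_cutoff.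
by move=> n; exact: cutoff_gt0.
Qed.

Lemma gamma_prim_cvgy x y c : 0 < x -> gamma_prim x y c n.+2%:R @[n --> \oo] --> 0.
Proof.
move=> x0; pose K := x + 1; pose C := K * ln K + 1 - K.
have K0 : 0 < K by rewrite addr_gt0.
apply: (@norm_le_cvg0 _ (fun n => expR C * cutoff n)); last first.
  by rewrite -(mulr0 (expR C)); apply: cvgM; [exact: cvg_cst|exact: cvg_cutoff].
move=> n; apply: (le_trans (gamma_prim_le _ _ _ _)).
pose t : R := n.+2%:R; rewrite -/t /cutoff -/t.
have t0 : 0 < t by rewrite ltr0n.
have H := mul_ln_le K0 (ltW t0).
have lt : ln t <= ln (1 + t) by rewrite ler_ln ?posrE ?addr_gt0// lerDr.
apply: (@le_trans _ _ (expR (C - ln t))).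
  rewrite ler_expR; have := ler_wpM2l (ltW K0) lt.
  by rewrite /C /K in H *; move: H; lra.
by rewrite expRD expRN lnK.
Qed.

Lemma integral_gamma_prim' x y c : 0 < x ->
  mu.-integrable P (fun t => (gamma_prim' x y c t)%:E) ->
  (\int[mu]_(t in P) (gamma_prim' x y c t)%:E = 0)%E.
Proof.
move=> x0 ig.
rewrite (integral_primitive (fun t t0 => @is_derive_gamma_prim x y c t t0)
  (fun t t0 => @continuous_gamma_prim' x y c t t0) ig (@gamma_prim_cvg0 x y c x0) (@gamma_prim_cvgy x y c x0)).
by rewrite subrr.
Qed.

Lemma gamma_integrandE (z : R[i]) (t : R) : 0 < t ->
  gamma_integrand (z + 1) t = t%:C * gamma_integrand z t.
Proof.
move=> t0; rewrite /gamma_integrand mulrA -[X in X * cpow _ _]cpow1// -cpowD//.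
by rewrite -addrA addrCA.
Qed.

(** [z * gamma_integrand z - gamma_integrand (z + 1)] is the derivative of
    [cpow t z * expR (- t)], which tends to 0 at both ends. *)
Lemma Gamma_add1 (z : R[i]) : 0 < Re z -> Gamma (z + 1) = z * Gamma z.
Proof.
move=> z0; have mP : measurable P by [].
have z1 : 0 < Re (z + 1) by rewrite Re_addc addr_gt0 /=.
have iz := cintegrable_gamma z0; have iz1 := cintegrable_gamma z1.
pose h t := z * gamma_integrand z t + (-1) * gamma_integrand (z + 1) t.
have ih : cintegrable P h by apply: cintegrableD => //; exact: cintegrableZ.
have hE : cintegral P h = z * Gamma z - Gamma (z + 1).
  rewrite cintegralD//; [|exact: cintegrableZ..].
  by rewrite !cintegralZ// mulN1r.
have gE t : 0 < t -> gamma_integrand z t =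
    (expR (Re z * ln t - t) / t)%:C * (cos (Im z * ln t) +i* sin (Im z * ln t)).
  move=> t0; rewrite /gamma_integrand mulrC mulrA.
  have -> : Im z = Im (z - 1) by rewrite Im_addc Im_oppc /= subr0.
  rewrite -rmorphM/= Re_addc Re_oppc /=; congr (_%:C * _).
  have tE : t^-1 = expR (- ln t) by rewrite expRN lnK.
  rewrite /powR gt_eqF// tE -!expRD; congr expR; ring.
have hR t : 0 < t -> Re (h t) = gamma_prim' (Re z) (Im z) 0 t.
  move=> t0; rewrite /h gamma_integrandE// gE//.
  rewrite Re_addc Re_mulc Re_realM Im_realM mulN1r Re_oppc Re_realM Re_realM /=.
  rewrite /gamma_prim' addr0; field; by rewrite gt_eqF.
have hI t : 0 < t -> Im (h t) = gamma_prim' (Re z) (Im z) (- (pi / 2)) t.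
  move=> t0.
  rewrite /gamma_prim' cosBpihalf sinBpihalf /h gamma_integrandE// gE//.
  rewrite Im_addc Im_mulc Re_realM Im_realM mulN1r Im_oppc Im_realM Im_realM /=.
  field; by rewrite gt_eqF.
suff h0 : cintegral P h = 0 by apply/esym/subr0_eq; rewrite -hE.
have [ir ii] := ih.
have vanish (p : R[i] -> R) c : (forall t, 0 < t -> p (h t) = gamma_prim' (Re z) (Im z) c t) ->
    mu.-integrable P (fun t => (p (h t))%:E) -> (\int[mu]_(t in P) (p (h t))%:E = 0)%E.
  move=> hp ip.
  have ig : mu.-integrable P (fun t => (gamma_prim' (Re z) (Im z) c t)%:E).
    by apply: eq_integrable ip => // t /set_mem; rewrite itv_oyE => t0; rewrite hp.
  rewrite -[RHS](integral_gamma_prim' z0 ig); apply: eq_integral => t /set_mem.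
  by rewrite itv_oyE => t0; rewrite hp.
by rewrite /cintegral /Rintegral (vanish _ _ hR ir) (vanish _ _ hI ii).
Qed.

Lemma rGamma_add1 (x : R) : 0 < x -> rGamma (x + 1) = x * rGamma x.
Proof.
move=> x0; apply: complexI; rewrite -Gamma_real rmorphD/= Gamma_add1//.
by rewrite Gamma_real -rmorphM.
Qed.

Lemma norm_sin_le (x : R) : `|sin x| <= `|x|.
Proof.
wlog x0 : x / 0 <= x.
  move=> H; have [|x0] := leP 0 x; first exact: H.
  by rewrite -normrN -sinN -(normrN x) H// oppr_ge0 ltW.
have [] := @MVT_segment R (@sin R) (@cos R) 0 x x0.
  by apply: continuous_subspaceT; exact: continuous_sin.
move=> c _; rewrite sin0 !subr0 => ->.
by rewrite normrM ler_piMl// cos_max.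
Qed.

Lemma cos_ge_quadratic (x : R) : 1 - x ^+ 2 / 2 <= cos x.
Proof.
have -> : x = (x / 2) *+ 2 by rewrite -mulr_natr divfK// pnatr_eq0.
rewrite cos_mulr2n cos2sin2 -mulr_natr.
have : sin (x / 2) ^+ 2 <= (x / 2) ^+ 2.
  by rewrite -[leLHS]real_normK ?num_real// -[leRHS]real_normK ?num_real// lerXn2r ?nnegrE ?norm_sin_le.
by rewrite -mulr_natr; lra.
Qed.

(** The right-hand side has simple moments with respect to the Gamma density,
    unlike the square of the logarithm. The substitution [u = v ^+ 2] reduces
    it to [ln v <= v - v^-1]. *)
Lemma sqr_ln_le (u : R) : 0 < u -> ln u ^+ 2 <= 4 * (u + u^-1 - 2).
Proof.
move=> u0.
wlog u1 : u u0 / 1 <= u.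
  move=> H; have [|u1] := leP 1 u; first exact: H.
  have := H u^-1; rewrite invr_gt0 u0 invf_ge1// (ltW u1) lnV ?posrE// sqrrN invrK => /(_ isT isT).
  by rewrite (addrC u^-1).
pose v := Num.sqrt u.
have v0 : 0 < v by rewrite sqrtr_gt0.
have uE : u = v ^+ 2 by rewrite sqr_sqrtr// ltW.
have v1 : 1 <= v by rewrite -sqrtr1 ler_wsqrtr.
have lv : ln v <= v - 1.
  by have := @le_ln1Dx R (v - 1); rewrite addrCA subrr addr0; apply; lra.
have lv0 := ln_ge0 v1.
have w : v - 1 <= v - v^-1 by rewrite lerB// invf_le1.
have -> : u + u^-1 - 2 = (v - v^-1) ^+ 2 by rewrite uE; field; by rewrite gt_eqF.
have -> : ln u = 2 * ln v by rewrite uE lnXn// mulr2n; ring.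
rewrite exprMn -natrX ler_pM2l//.
by rewrite lerXn2r ?nnegrE//; lra.
Qed.

(** The oscillating factor [cpow t (i y)] hardly varies where the density
    [t `^ (k - 1) * expR (- t)] concentrates, namely near [t = k]. Once rotated to be
    1 at [t = k], its real part is [cos (y * ln (t / k))], which is at least
    [1 - 2 * y ^+ 2 * (t / k + k / t - 2)], and the mean of this bound is
    [1 - 2 * y ^+ 2 / (k - 1)] by the functional equation. *)
Lemma Gamma_neq0_large (z : R[i]) : 1 < Re z -> 2 * Im z ^+ 2 < Re z - 1 -> Gamma z != 0.
Proof.
set k := Re z; set y := Im z => k1 yk; have mP : measurable P by [].
have k0 : 0 < k by exact: lt_trans k1.
have k10 : 0 < k - 1 by rewrite subr_gt0.
(* The conjugate of the phase of the integrand at [t = k]. *)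
pose w : R[i] := cos (y * ln k) -i* sin (y * ln k).
suff : 0 < Re (w * Gamma z) by apply: contraTneq => ->; rewrite mulr0 ltxx.
have iz := cintegrable_gamma k0.
rewrite -cintegralZ// -[X in 0 < X]/(\int[mu]_(t in P) Re (w * gamma_integrand z t)).
have [ir _] := cintegrableZ w mP iz.
pose g x t : R := t `^ (x - 1) * expR (- t).
have gk t : 0 < t -> g (k + 1) t = t * g k t.
  move=> t0; rewrite /g addrK mulrA mulr_powRB1 ?ltW//.
have gk' t : 0 < t -> g (k - 1) t = t^-1 * g k t.
  move=> t0; rewrite /g powRB ?(gt_eqF t0) ?implybT// powRr1 ?(ltW t0)//; ring.
(* The minorant of the rotated integrand, written as a combination of the Gamma
   densities of parameters [k], [k + 1] and [k - 1]. *)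
pose low t : R := (1 + 4 * y ^+ 2) * g k t + ((- (2 * y ^+ 2 / k)) * g (k + 1) t + (- (2 * y ^+ 2 * k)) * g (k - 1) t).
have ig x : 0 < x -> mu.-integrable P (fun t => (g x t)%:E) by exact: integrable_gamma.
have k11 : 0 < k + 1 by rewrite addr_gt0.
have il2 : mu.-integrable P (fun t => ((- (2 * y ^+ 2 / k)) * g (k + 1) t + (- (2 * y ^+ 2 * k)) * g (k - 1) t)%:E).
  by apply: integrable_add => //; apply: integrable_mull => //; exact: ig.
have il : mu.-integrable P (fun t => (low t)%:E).
  by apply: integrable_add => //; apply: integrable_mull => //; exact: ig.
have lowE : \int[mu]_(t in P) low t = rGamma k * (1 - 2 * y ^+ 2 / (k - 1)).
  rewrite RintegralD//; last by apply: integrable_mull => //; exact: ig.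
  rewrite RintegralD//; [|by apply: integrable_mull => //; exact: ig..].
  rewrite !RintegralZl//; [|exact: ig..].
  rewrite -!/(rGamma _) rGamma_add1//.
  have -> : rGamma k = (k - 1) * rGamma (k - 1) by rewrite -rGamma_add1// subrK.
  by field; rewrite !gt_eqF.
apply: (@lt_le_trans _ _ (\int[mu]_(t in P) low t)).
  rewrite lowE mulr_gt0 ?rGamma_gt0// subr_gt0 ltr_pdivrMr// mul1r//.
apply: le_Rintegral => // t; rewrite itv_oyE => t0.
have -> : Re (w * gamma_integrand z t) = g k t * cos (y * ln (t / k)).
  rewrite /gamma_integrand (mulrC (cpow _ _)) Re_mulc Re_realM Im_realM Re_cpow Im_cpow /=.
  rewrite Re_addc Im_addc Re_oppc Im_oppc /= subr0 ln_div ?posrE// mulrBr cosB /g -/k -/y.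
  by ring.
have -> : low t = g k t * (1 - 2 * y ^+ 2 * (t / k + (t / k)^-1 - 2)).
  by rewrite /low gk// gk'//; field; rewrite !gt_eqF.
rewrite ler_wpM2l//; first by rewrite /g mulr_ge0 ?powR_ge0 ?expR_ge0.
apply: le_trans (cos_ge_quadratic _).
rewrite lerB// exprMn.
have := sqr_ln_le (divr_gt0 t0 k0).
have := sqr_ge0 y; nra.
Qed.

Lemma Gamma_neq0 (z : R[i]) : 0 < Re z -> Gamma z != 0.
Proof.
move=> z0; apply/negP => /eqP G0.
have H n : Gamma (z + n%:R) = 0 /\ 0 < Re (z + n%:R).
  elim: n => [|n [ih1 ih2]]; first by rewrite addr0.
  rewrite mulrSr addrA Gamma_add1// ih1 mulr0; split => //.
  by rewrite Re_addc /= addr_gt0.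
have ReE n : Re (z + n%:R) = Re z + n%:R.
  by rewrite Re_addc -(rmorph_nat (real_complex R)).
have ImE n : Im (z + n%:R) = Im z.
  by rewrite Im_addc -(rmorph_nat (real_complex R)) addr0.
pose n := (Num.truncn (2 * Im z ^+ 2)).+2.
have Hn : 2 * Im z ^+ 2 < n%:R - 1.
  have -> : n%:R - 1 = (Num.truncn (2 * Im z ^+ 2)).+1%:R :> R by rewrite /n -[in LHS]addn1 natrD addrK.
  exact: truncnS_gt.
have := @Gamma_neq0_large (z + n%:R); rewrite ReE ImE (H n).1 eqxx.
have : 0 <= 2 * Im z ^+ 2 by rewrite mulr_ge0// sqr_ge0.
move=> ? F; suff : false by []; apply: F; lra.
Qed.

End GammaFunction.

(** * Mellin transform of a multiplicative convolution *)

Section MellinConvolution.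
Local Set Implicit Arguments.
Local Unset Strict Implicit.
Local Open Scope classical_set_scope.
Context {R : realType}.
Local Notation mu := (@lebesgue_measure R).
Local Notation Re := (@complex.Re R).
Local Notation P := (`]0%R : R, +oo[%classic).

Let mP : measurable P. Proof. by []. Qed.

Lemma measurable_ratio (k : R -> R) : measurable_fun setT k ->
  measurable_fun (P `*` P) (fun z : R * R => k (z.1 / z.2)).
Proof.
move=> mk; apply: (eq_measurable_fun (fun z : R * R => k (z.1 * z.2 `^ (-1)))).
  move=> [x y] /set_mem [/= _]; rewrite in_itv/= andbT => y0.
  by rewrite powR_inv1// ltW.
apply: measurable_funTS.
apply: (measurableT_comp mk); apply: measurable_funM; first exact: measurable_fst.
by apply: (measurableT_comp (measurable_powR (-1))); exact: measurable_snd.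
Qed.

Lemma measurable_div_snd (k : R -> R) (x : R) : measurable_fun setT k ->
  measurable_fun P (fun y => k (x / y)).
Proof.
move=> mk; apply: (eq_measurable_fun (fun y : R => k (x * y `^ (-1)))).
  by move=> y /set_mem; rewrite itv_oyE => y0; rewrite powR_inv1// ltW.
apply: measurable_funTS; apply: (measurableT_comp mk).
by apply: measurable_funM => //; exact: measurable_powR.
Qed.

Lemma measurable_comp_snd d (T : measurableType d) (D : set R) (E : set R) (h : R -> T) :
  measurable D -> measurable E ->
  measurable_fun E h -> measurable_fun (D `*` E) (fun z : R * R => h z.2).
Proof.
move=> mD mE mh; apply: (@measurable_comp _ _ _ _ _ _ E h (D `*` E) snd) => //.
- by move=> _ [[x y] [/= _ Ey] <-].
- exact: measurable_funTS measurable_snd.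
Qed.

Lemma measurable_comp_fst d (T : measurableType d) (D : set R) (E : set R) (h : R -> T) :
  measurable D -> measurable E ->
  measurable_fun D h -> measurable_fun (D `*` E) (fun z : R * R => h z.1).
Proof.
move=> mD mE mh; apply: (@measurable_comp _ _ _ _ _ _ D h (D `*` E) fst) => //.
- by move=> _ [[x y] [/= Dx _] <-].
- exact: measurable_funTS measurable_fst.
Qed.

Lemma measurable_powRP (s : R) : measurable_fun P (fun x => x `^ s).
Proof. by apply: measurable_funTS; exact: measurable_powR. Qed.

(** After exchanging the integrals, the scaling [x = y * r] separates the variables. *)
Lemma tonelli_mellin (k h : R -> R) (s : R) :
  measurable_fun setT k -> measurable_fun P h ->
  (forall x, 0 <= k x) -> (forall x, 0 < x -> 0 <= h x) ->
  (\int[mu]_(x in P) \int[mu]_(y in P) (x `^ (s - 1) * (k (x / y) * h y))%:E =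
   (\int[mu]_(r in P) (r `^ (s - 1) * k r)%:E) *
   (\int[mu]_(y in P) (y `^ s * h y)%:E))%E.
Proof.
move=> mk mh k0 h0.
pose f z := z.1 `^ (s - 1) * (k (z.1 / z.2) * h z.2).
have mf : measurable_fun (P `*` P) f.
  apply: measurable_funM; first by apply: (@measurable_comp_fst _ _ P P (fun x => x `^ (s - 1))) => //; exact: measurable_powRP.
  by apply: measurable_funM; [exact: measurable_ratio|exact: measurable_comp_snd].
have f0 x y : P x -> P y -> 0 <= f (x, y).
  by rewrite !itv_oyE => _ y0; rewrite !mulr_ge0 ?powR_ge0 ?h0.
have [-> _] := tonelli_on mP mP mf f0.
have mphi : measurable_fun P (fun r => r `^ (s - 1) * k r).
  by apply: measurable_funM; [exact: measurable_powRP|exact: measurable_funTS].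
rewrite -ge0_integralZl//=; last 3 first.
- by apply/measurable_EFinP; apply: measurable_funM => //; exact: measurable_powRP.
- by move=> y; rewrite in_itv/= andbT => y0; rewrite lee_fin mulr_ge0 ?powR_ge0 ?h0.
- by apply: integral_ge0 => r _; rewrite lee_fin mulr_ge0 ?powR_ge0.
apply: eq_integral => y /set_mem; rewrite itv_oyE => y0.
have yV0 : 0 < y^-1 by rewrite invr_gt0.
transitivity (\int[mu]_(x in P) ((y `^ (s - 1) * h y)%:E * ((y^-1 * x) `^ (s - 1) * k (y^-1 * x))%:E))%E.
  apply: eq_integral => x /set_mem; rewrite itv_oyE => x0.
  rewrite -EFinM /f/=; congr EFin.
  have -> : x `^ (s - 1) = y `^ (s - 1) * (y^-1 * x) `^ (s - 1).
    by rewrite -powRM ?(ltW y0) ?mulr_ge0 ?(ltW x0) ?(ltW yV0)// mulrA divff ?gt_eqF// mul1r.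
  by rewrite (mulrC x); ring.
have preP : ( *%R y^-1 @^-1` P = P)%classic.
  by apply/seteqP; split => x; rewrite /= !in_itv/= !andbT pmulr_rgt0.
have mphiy : measurable_fun P (fun x => (y^-1 * x) `^ (s - 1) * k (y^-1 * x)).
  apply: (@measurable_comp _ _ _ _ _ _ P (fun r => r `^ (s - 1) * k r)) => //.
  by move=> _ [x xP <-]; move: xP; rewrite !itv_oyE; exact: mulr_gt0.
rewrite ge0_integralZl_EFin//; last 3 first.
- by move=> x _; rewrite lee_fin mulr_ge0 ?powR_ge0.
- exact/measurable_EFinP.
- by rewrite mulr_ge0 ?powR_ge0 ?h0.
have := @ge0_integral_scale R y^-1 P (fun r => (r `^ (s - 1) * k r)%:E) yV0 mP.
rewrite preP => ->; last 2 first.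
- exact/measurable_EFinP.
- by move=> x _; rewrite lee_fin mulr_ge0 ?powR_ge0.
rewrite invrK [RHS]muleC muleA; congr (_ * _)%E; rewrite -EFinM; congr EFin.
have -> : y `^ s = y * y `^ (s - 1).
  by rewrite powRB ?(gt_eqF y0) ?implybT// powRr1 ?(ltW y0)// mulrCA divff ?mulr1 ?gt_eqF.
ring.
Qed.

(** The same computation as in [tonelli_mellin], which provides the absolute
    convergence that Fubini's theorem requires. *)
Lemma mellin_convolution (k : R -> R) (h : R -> R[i]) (s : R[i]) :
  measurable_fun setT k -> cmeasurable P h ->
  mu.-integrable P (fun r => (r `^ (Re s - 1) * k r)%:E) ->
  mu.-integrable P (fun y => (y `^ Re s * abs1 (h y))%:E) ->
  (forall x, 0 < x -> cintegrable P (fun y => (k (x / y))%:C * h y)) ->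
  cintegrable P (fun x => cpow x (s - 1) * cintegral P (fun y => (k (x / y))%:C * h y)) /\
  cintegral P (fun x => cpow x (s - 1) * cintegral P (fun y => (k (x / y))%:C * h y)) =
  cintegral P (fun r => cpow r (s - 1) * (k r)%:C) * cintegral P (fun y => cpow y s * h y).
Proof.
move=> mk mh ik ih ikh.
pose f z := cpow z.1 (s - 1) * ((k (z.1 / z.2))%:C * h z.2).
have Res1 : Re (s - 1) = Re s - 1 by rewrite Re_addc Re_oppc.
have mf : cmeasurable (P `*` P) f.
  have [cr ci] := cmeasurable_cpow (R := R) (s - 1).
  have [hr hi] := mh.
  apply: cmeasurableM.
    split; apply: (@measurable_comp_fst _ _ P P (fun x : R => _ (cpow x (s - 1)))) => //; exact: measurable_funTS.
  apply: cmeasurableM; first by apply: cmeasurable_real; exact: measurable_ratio.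
  by split; apply: (@measurable_comp_snd _ _ P P (fun x : R => _ (h x))).
have mah : measurable_fun P (fun y => abs1 (h y)) by exact: measurable_abs1.
have mak : measurable_fun setT (fun x => `|k x|) by apply: measurableT_comp.
pose phi r := cpow r (s - 1) * (k r)%:C.
have iphi : cintegrable P phi.
  apply: (cintegrable_le (g := fun r => 2 * `|r `^ (Re s - 1) * k r|)) => //.
  - apply: cmeasurableS (cmeasurableM (cmeasurable_cpow (s - 1)) (cmeasurable_real mk)) => //.
  - move=> r _; rewrite (le_trans (abs1_cpowM _ _ _))// Res1 /abs1 /= normr0 addr0.
    by rewrite normrM (ger0_norm (powR_ge0 _ _)) mulrA.
  - by apply: integrable_mull => //; exact: integrable_norm ik.
pose psi y := cpow y s * h y.
have ipsi : cintegrable P psi.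
  apply: (cintegrable_le (g := fun y => 2 * (y `^ Re s * abs1 (h y)))) => //.
  - by apply: cmeasurableM => //; apply: cmeasurableS (cmeasurable_cpow s).
  - by move=> r _; rewrite (le_trans (abs1_cpowM _ _ _))// mulrA.
  - exact: integrable_mull.
have fE y x : 0 < x -> 0 < y -> f (x, y) = (cpow y (s - 1) * h y) * phi (y^-1 * x).
  move=> x0 y0; rewrite /f/= /phi.
  have -> : cpow x (s - 1) = cpow y (s - 1) * cpow (y^-1 * x) (s - 1).
    by rewrite -cpowM ?mulr_gt0 ?invr_gt0// mulrA divff ?gt_eqF// mul1r.
  by rewrite (mulrC x); ring.
have sc y : 0 < y -> cintegrable P (fun x => f (x, y)) /\
    cintegral P (fun x => f (x, y)) = psi y * cintegral P phi.
  move=> y0; have yV0 : 0 < y^-1 by rewrite invr_gt0.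
  have [i1 e1] := cintegral_scale yV0 iphi.
  have EQ x : P x -> (cpow y (s - 1) * h y) * phi (y^-1 * x) = f (x, y).
    by rewrite itv_oyE => x0; rewrite fE.
  split; first by apply: (eq_cintegrable _ EQ) => //; exact: cintegrableZ.
  rewrite -(eq_cintegral EQ) cintegralZ// e1 invrK /psi.
  have -> : cpow y s = y%:C * cpow y (s - 1).
    by rewrite -[X in X * cpow _ _]cpow1// -cpowD// addrCA subrr addr0.
  ring.
have ffin : (\int[mu]_(x in P) \int[mu]_(y in P) (abs1 (f (x, y)))%:E < +oo)%E.
  have H := @tonelli_mellin (fun x => `|k x|) (fun y => 2 * abs1 (h y)) (Re s) mak.
  have m2h : measurable_fun P (fun y => 2 * abs1 (h y)) by apply: measurable_funM.
  have Ha y : 0 < y -> 0 <= 2 * abs1 (h y) by rewrite mulr_ge0 ?abs1_ge0.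
  have {}H := H m2h (fun _ => normr_ge0 _) Ha.
  pose g z := z.1 `^ (Re s - 1) * (`|k (z.1 / z.2)| * (2 * abs1 (h z.2))).
  have mg : measurable_fun (P `*` P) g.
    apply: measurable_funM; first by apply: (@measurable_comp_fst _ _ P P (fun x => x `^ (Re s - 1))) => //; exact: measurable_powRP.
    by apply: measurable_funM; [exact: (measurable_ratio mak)|exact: (measurable_comp_snd _ _ m2h)].
  have g0 x y : P x -> P y -> 0 <= g (x, y).
    by move=> _ _; rewrite !mulr_ge0 ?powR_ge0 ?abs1_ge0.
  have fg z : abs1 (f z) <= g z.
    rewrite (le_trans (abs1_cpowM _ _ _))// Res1 abs1_real /g.
    by rewrite le_eqVlt; apply/orP; left; apply/eqP; ring.
  have maf := measurable_abs1 mf.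
  have sec x (u : R * R -> R) : P x -> measurable_fun (P `*` P) u -> measurable_fun P (fun y => (u (x, y))%:E).
    move=> Px mu'; apply/measurable_EFinP.
    apply: (@measurable_comp _ _ _ _ _ _ (P `*` P) u P (fun y => (x, y))) => //.
    - exact: measurableX.
    - by move=> _ [y Ey <-].
    - exact: measurable_funTS (pair1_measurable x).
  apply: (@le_lt_trans _ _ (\int[mu]_(x in P) \int[mu]_(y in P) (g (x, y))%:E)%E).
    apply: ge0_le_integral => //.
    - by move=> x Px; apply: integral_ge0 => y _; rewrite lee_fin abs1_ge0.
    - by have [_] := tonelli_on mP mP maf (fun x y _ _ => abs1_ge0 _).
    - by have [_] := tonelli_on mP mP mg g0.
    - move=> x Px; apply: ge0_le_integral => //.
      + by move=> y _; rewrite lee_fin abs1_ge0.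
      + exact: (sec x (fun z => abs1 (f z))).
      + exact: (sec x g).
      + by move=> y _; rewrite lee_fin fg.
  rewrite [X in (X < _)%E]H.
  apply: lte_mul_pinfty.
  - by apply: integral_ge0 => r _; rewrite lee_fin mulr_ge0 ?powR_ge0.
  - have /integrable_fin_num := integrable_norm ik; move=> /(_ mP); congr (_ \is a fin_num).
    apply: eq_integral => r _ /=.
    by rewrite normrM (ger0_norm (powR_ge0 _ _)).
  - have /integrable_lty := integrable_mull 2 mP ih; move=> /(_ mP); congr (_ < _)%E.
    by apply: eq_integral => y _; congr EFin; ring.
have inner x : 0 < x -> cintegrable P (fun y => f (x, y)) /\
   cintegral P (fun y => f (x, y)) = cpow x (s - 1) * cintegral P (fun y => (k (x / y))%:C * h y).
  move=> x0; split; first exact: (cintegrableZ (cpow x (s - 1)) mP (ikh x x0)).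
  by rewrite -(cintegralZ (cpow x (s - 1)) mP (ikh x x0)).
have [||i e] := cfubini_on mP mP mf ffin.
- by move=> x; rewrite itv_oyE => /inner[].
- by move=> y; rewrite itv_oyE => /sc[].
have EQ x : P x -> cintegral P (fun y => f (x, y)) =
    cpow x (s - 1) * cintegral P (fun y => (k (x / y))%:C * h y).
  by rewrite itv_oyE => /inner[].
split; first exact: eq_cintegrable mP EQ i.
rewrite -(eq_cintegral EQ).
rewrite e -(cintegralZ (cintegral P phi) mP ipsi).
by apply: eq_cintegral => y; rewrite itv_oyE => /sc[_ ->]; rewrite mulrC.
Qed.

End MellinConvolution.

(** * Integrands vanishing outside a subset *)

Section Subset.
Local Set Implicit Arguments.
Local Unset Strict Implicit.
Local Open Scope classical_set_scope.
Context {R : realType}.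
Local Notation mu := (@lebesgue_measure R).

Lemma measurable_EFin (D : set R) (f : R -> R) : measurable_fun D f ->
  measurable_fun (D : set (measurableTypeR R)) (fun x => (f x)%:E).
Proof. by move=> mf; apply/measurable_EFinP; exact: mf. Qed.

Lemma integral_subset0 (D E : set R) (f : R -> \bar R) : D `<=` E ->
  (forall x, E x -> ~ D x -> f x = 0%E) ->
  (\int[mu]_(x in E) f x = \int[mu]_(x in D) f x)%E.
Proof.
move=> DE f0; rewrite integral_mkcond [RHS]integral_mkcond; apply: eq_integral => x _.
rewrite !patchE; have [Ex|nEx] := pselect (E x); last first.
  by rewrite !memNset//; move/DE.
rewrite [in LHS]mem_set//; have [Dx|nDx] := pselect (D x); first by rewrite mem_set.
by rewrite memNset// f0.
Qed.

Lemma integrable_subset0 (D E : set R) (f : R -> R) : measurable D -> measurable E ->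
  D `<=` E -> (forall x, E x -> ~ D x -> f x = 0) ->
  mu.-integrable D (fun x => (f x)%:E) <-> mu.-integrable E (fun x => (f x)%:E).
Proof.
move=> mD mE DE f0; split; last by move=> iE; apply: integrableS iE.
move=> iD; have iD' := (@integrable_mkcond _ (measurableTypeR R) R mu D (EFin \o f) mD).1 iD.
apply: (@integrable_mkcond _ (measurableTypeR R) R mu E (EFin \o f) mE).2.
apply: eq_integrable iD' => // x _; rewrite !patchE.
have [Dx|nDx] := pselect (D x); first by rewrite !mem_set//; exact: DE.
rewrite memNset//; have [Ex|nEx] := pselect (E x); last by rewrite memNset.
by rewrite mem_set//= f0.
Qed.

Lemma cintegral_subset0 (D E : set R) (f : R -> R[i]) : measurable D -> measurable E ->
  D `<=` E -> (forall x, E x -> ~ D x -> f x = 0) ->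
  (cintegrable D f <-> cintegrable E f) /\ cintegral E f = cintegral D f.
Proof.
move=> mD mE DE f0; split.
  split=> -[ir ii]; split.
  - by apply/(@integrable_subset0 D E) => // x Ex nDx; rewrite f0.
  - by apply/(@integrable_subset0 D E) => // x Ex nDx; rewrite f0.
  - by apply/(@integrable_subset0 D E) => // x Ex nDx; rewrite f0.
  - by apply/(@integrable_subset0 D E) => // x Ex nDx; rewrite f0.
by rewrite /cintegral /Rintegral !(@integral_subset0 D E)// => x Ex nDx; rewrite f0.
Qed.

Definition restrict01 (g : R -> R) (r : R) : R := if 0 < r < 1 then g r else 0.

Lemma restrict01_in g (r : R) : 0 < r < 1 -> restrict01 g r = g r.
Proof. by rewrite /restrict01 => ->. Qed.

Lemma restrict01_out g (r : R) : ~~ (0 < r < 1) -> restrict01 g r = 0.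
Proof. by rewrite /restrict01 => /negbTE ->. Qed.

Lemma measurable_restrict01 g : measurable_fun (`]0%R : R, 1%R[%classic) g ->
  measurable_fun setT (restrict01 g).
Proof.
move=> mg; have -> : restrict01 g = g \_ (`]0%R : R, 1%R[%classic).
  apply/funext => r; rewrite patchE /restrict01.
  have -> : (r \in (`]0%R : R, 1%R[%classic)) = (0 < r < 1); last by case: ifP.
  by apply/idP/idP => [/set_mem/=|h]; [rewrite in_itv|rewrite inE /= in_itv].
by apply/(measurable_restrictT _ _).1.
Qed.

End Subset.

(** * The Beta integral *)

Section BetaIntegral.
Local Set Implicit Arguments.
Local Unset Strict Implicit.
Local Open Scope classical_set_scope.
Context {R : realType}.
Local Notation mu := (@lebesgue_measure R).
Local Notation Re := (@complex.Re R).
Local Notation P := (`]0%R : R, +oo[%classic).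
Local Notation I01 := (`]0%R : R, 1%R[%classic).

Let mP : measurable P. Proof. by []. Qed.
Let mI : measurable I01. Proof. by []. Qed.
Let IP : I01 `<=` P.
Proof. by move=> x; rewrite itv_oyE /= in_itv/= => /andP[]. Qed.

Lemma itv01E (x : R) : I01 x = (0 < x < 1) :> Prop.
Proof. by rewrite /= in_itv. Qed.

Definition onem_powR (p r : R) : R := (1 - r) `^ (p - 1).

Lemma measurable_onem_powR p : measurable_fun setT (onem_powR p).
Proof.
apply: (measurableT_comp (measurable_powR (p - 1))).
exact: measurable_funB.
Qed.

Let kp p := restrict01 (onem_powR p).

Let mkp p : measurable_fun setT (kp p).
Proof. by apply: measurable_restrict01; apply: measurable_funTS; exact: measurable_onem_powR. Qed.

Let kp_ge0 p r : 0 <= kp p r.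
Proof. by rewrite /kp /restrict01; case: ifP => // _; exact: powR_ge0. Qed.

Let h (p y : R) : R := y `^ (p - 1) * expR (- y).

Let mh p : measurable_fun P (h p).
Proof.
apply: measurable_funM; first by apply: measurable_funTS; exact: measurable_powR.
by apply: measurableT_comp.
Qed.

Lemma EFin_rGamma (x : R) : 0 < x ->
  (rGamma x)%:E = (\int[mu]_(t in P) (t `^ (x - 1) * expR (- t))%:E)%E.
Proof.
move=> x0; rewrite /rGamma /Rintegral fineK//; apply: integrable_fin_num => //.
exact: integrable_gamma.
Qed.

(** The substitution [y = x + t] in the convolution of [(1 - r) `^ (p - 1)] with
    the exponential density reproduces the exponential. *)
Lemma integral_beta_exp (p x : R) : 0 < x ->
  (\int[mu]_(y in P) (kp p (x / y) * h p y)%:E =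
   (expR (- x))%:E * \int[mu]_(t in P) (h p t)%:E)%E.
Proof.
move=> x0.
have sub : `]x, +oo[ `<=` P.
  by move=> y; rewrite itv_oyE /= in_itv/= andbT; exact: lt_trans.
rewrite (@integral_subset0 _ `]x, +oo[ P)//; last first.
  move=> y; rewrite itv_oyE => y0 /=; rewrite in_itv/= andbT => /negP.
  rewrite -leNgt => yx; rewrite /kp restrict01_out ?mul0r//.
  by rewrite negb_and -!leNgt ler_pdivlMr// mul1r yx orbT.
pose g t := expR (- x) * h p t.
have mg : measurable_fun P g by apply: measurable_funM.
have g0 t : P t -> (0 <= (g t)%:E)%E.
  by move=> _; rewrite lee_fin !mulr_ge0 ?expR_ge0 ?powR_ge0.
rewrite -ge0_integralZl_EFin ?expR_ge0//; last 2 first.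
- by move=> t _; rewrite lee_fin mulr_ge0 ?expR_ge0 ?powR_ge0.
- by apply: measurable_EFin; exact: mh.
have pre : ((fun y : R => y + - x) @^-1` P)%classic = `]x, +oo[%classic.
  by apply/seteqP; split => y; rewrite /= !in_itv/= !andbT subr_gt0.
have := @ge0_integral_shift R (- x) P (EFin \o g) mP.
rewrite pre => <-//; last exact/measurable_EFinP.
apply: eq_integral => y /set_mem /=; rewrite in_itv/= andbT => xy.
have y0 : 0 < y by exact: lt_trans xy.
congr EFin; rewrite /g /h /kp restrict01_in; last first.
  by rewrite divr_gt0//= ltr_pdivrMr// mul1r.
rewrite /onem_powR mulrA -powRM ?(ltW y0)//; last first.
  by rewrite subr_ge0 ler_pdivrMr// mul1r ltW.
rewrite mulrBl divfK ?gt_eqF// mul1r mulrCA -expRD; congr (_ * expR _); ring.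
Qed.

(** The Beta integral times the positive number [rGamma (s + p)] is the finite
    number [rGamma p * rGamma s], so it cannot be infinite. *)
Lemma integrable_beta_kp (p s : R) : 0 < p -> 0 < s ->
  mu.-integrable P (fun r => (r `^ (s - 1) * kp p r)%:E).
Proof.
move=> p0 s0.
have sp0 : 0 < s + p by rewrite addr_gt0.
have h0 (y : R) : 0 < y -> 0 <= h p y by rewrite mulr_ge0 ?powR_ge0 ?expR_ge0.
have := tonelli_mellin s (mkp p) (mh p) (kp_ge0 p) h0.
have -> : (\int[mu]_(y in P) (y `^ s * h p y)%:E)%E = (rGamma (s + p))%:E.
  rewrite EFin_rGamma//; apply: eq_integral => y /set_mem; rewrite itv_oyE => y0; congr EFin.
  by rewrite /h mulrA -powRD ?(gt_eqF y0) ?implybT// addrA.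
set A := (\int[mu]_(r in P) (r `^ (s - 1) * kp p r)%:E)%E.
have -> : (\int[mu]_(x in P) \int[mu]_(y in P) (x `^ (s - 1) * (kp p (x / y) * h p y))%:E)%E =
   (rGamma p * rGamma s)%:E.
  rewrite EFinM (EFin_rGamma s0).
  rewrite -ge0_integralZl_EFin ?ltW ?rGamma_gt0//; last 2 first.
  - by move=> t _; rewrite lee_fin mulr_ge0 ?expR_ge0 ?powR_ge0.
  - by have /measurable_int := integrable_gamma s0.
  apply: eq_integral => x /set_mem; rewrite itv_oyE => x0.
  transitivity ((x `^ (s - 1))%:E * \int[mu]_(y in P) (kp p (x / y) * h p y)%:E)%E.
    rewrite -ge0_integralZl_EFin ?powR_ge0//.
    - by move=> y; rewrite itv_oyE => y0; rewrite lee_fin mulr_ge0 ?h0.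
    - apply/measurable_EFinP; apply: measurable_funM => //.
      exact: measurable_div_snd (mkp p).
    - exact: mh.
  rewrite integral_beta_exp//.
  have -> : (\int[mu]_(t in P) (h p t)%:E)%E = (rGamma p)%:E by rewrite EFin_rGamma.
  by rewrite -!EFinM; congr EFin; ring.
move=> E; apply/integrableP; split.
  apply/measurable_EFinP; apply: measurable_funM; first exact: measurable_powRP.
  by apply: measurable_funTS; exact: mkp.
have -> : (\int[mu]_(r in P) `|(r `^ (s - 1) * kp p r)%:E| = A)%E.
  by apply: eq_integral => r _; rewrite /= ger0_norm// mulr_ge0 ?powR_ge0.
rewrite ltey; apply/eqP => Aoo; move: E; rewrite Aoo.
by rewrite gt0_mulye// lte_fin rGamma_gt0.
Qed.

Lemma integrable_beta (p s : R) : 0 < p -> 0 < s ->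
  mu.-integrable I01 (fun r => (r `^ (s - 1) * onem_powR p r)%:E).
Proof.
move=> p0 s0; apply: (@eq_integrable _ _ _ mu I01 mI (fun r => (r `^ (s - 1) * kp p r)%:E)).
  by move=> r /set_mem; rewrite itv01E => r01; rewrite /kp restrict01_in.
by apply: integrableS (integrable_beta_kp p0 s0).
Qed.

Definition beta_integrand (p : R) (s : R[i]) (r : R) : R[i] :=
  cpow r (s - 1) * (onem_powR p r)%:C.

Definition Beta (p : R) (s : R[i]) : R[i] := cintegral I01 (beta_integrand p s).

Lemma cmeasurable_beta_integrand p s : cmeasurable setT (beta_integrand p s).
Proof.
apply: cmeasurableM; first exact: cmeasurable_cpow.
by apply: cmeasurable_real; exact: measurable_onem_powR.
Qed.

Lemma abs1_beta_integrand p s (r : R) :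
  abs1 (beta_integrand p s r) <= 2 * (r `^ (Re s - 1) * onem_powR p r).
Proof.
rewrite (le_trans (abs1_cpowM _ _ _))// Re_addc Re_oppc /abs1 /= normr0 addr0.
by rewrite ger0_norm ?powR_ge0// mulrA.
Qed.

Lemma cintegrable_beta p s : 0 < p -> 0 < Re s -> cintegrable I01 (beta_integrand p s).
Proof.
move=> p0 s0.
apply: (cintegrable_le (g := fun r => 2 * (r `^ (Re s - 1) * onem_powR p r))) => //.
- by apply: cmeasurableS (cmeasurable_beta_integrand p s).
- by move=> r _; exact: abs1_beta_integrand.
- by apply: integrable_mull => //; exact: integrable_beta.
Qed.

(** By [integral_beta_exp] the convolution of [(1 - r) `^ (p - 1)] with
    [y `^ (p - 1) * expR (- y)] is [Gamma p * expR (- x)], whose Mellin transform is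
    [Gamma p * Gamma s]. *)
Lemma Beta_Gamma (p : R) (s : R[i]) : 0 < p -> 0 < Re s ->
  Beta p s * Gamma (s + p%:C) = Gamma s * Gamma p%:C.
Proof.
move=> p0 s0.
have igp := integrable_gamma p0.
pose hc y : R[i] := (h p y)%:C.
have mhc : cmeasurable P hc by apply: cmeasurable_real; exact: mh.
have mk x : measurable_fun P (fun y => kp p (x / y)) by exact: measurable_div_snd (mkp p).
have innerR x : 0 < x -> mu.-integrable P (fun y => (kp p (x / y) * h p y)%:E).
  move=> x0; apply/integrableP; split.
    by apply: measurable_EFin; apply: measurable_funM; [exact: mk|exact: mh].
  rewrite (eq_integral (fun y : measurableTypeR R => (kp p ((x : R) / (y : R)) * h p y)%:E)); last first.
    by move=> y _; rewrite /= ger0_norm// !mulr_ge0 ?powR_ge0 ?expR_ge0.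
  rewrite integral_beta_exp// lte_mul_pinfty ?lee_fin ?expR_ge0//.
  exact: integrable_lty igp.
have hE (y : R) : 0 < y -> cpow y s * hc y = gamma_integrand (s + p%:C) y.
  move=> y0; rewrite /hc /h /gamma_integrand rmorphM/= mulrA; congr (_ * _).
  by rewrite -cpow_real -cpowD// rmorphB/= addrA.
have EQ x y : (kp p (x / y))%:C * hc y = (kp p (x / y) * h p y)%:C by rewrite -rmorphM.
have sp0 : 0 < Re (s + p%:C) by rewrite Re_addc /= addr_gt0.
have [|||_] := @mellin_convolution R (kp p) hc s (mkp p) mhc.
- exact: integrable_beta_kp.
- apply: (@le_integrable _ _ _ mu P mP _ (fun y => (2 * abs1 (gamma_integrand (s + p%:C) y))%:E)).
  + apply/measurable_EFinP; apply: measurable_funM; first exact: measurable_powRP.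
    exact: measurable_abs1.
  + move=> y; rewrite itv_oyE => y0; rewrite lee_fin -hE// ger0_norm ?mulr_ge0 ?powR_ge0 ?abs1_ge0//.
    by rewrite ger0_norm ?mulr_ge0 ?abs1_ge0// abs1_le_cpowM.
  + by apply: integrable_mull => //; apply: integrable_abs1 => //; exact: cintegrable_gamma.
- move=> x x0; apply: (@eq_cintegrable _ P (fun y => (kp p (x / y) * h p y)%:C)) => //.
  by apply: cintegrable_real => //; exact: innerR.
have -> : cintegral P (fun y => cpow y s * hc y) = Gamma (s + p%:C).
  by apply: eq_cintegral => y; rewrite itv_oyE; exact: hE.
have -> : cintegral P (fun r => cpow r (s - 1) * (kp p r)%:C) = Beta p s.
  have [|_ ->] := @cintegral_subset0 _ I01 P (fun r => cpow r (s - 1) * (kp p r)%:C) mI mP IP.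
  - by move=> r _; rewrite itv01E => /negP r01; rewrite /kp restrict01_out// mulr0.
  - by apply: eq_cintegral => r; rewrite itv01E => r01; rewrite /kp restrict01_in.
move=> <-.
rewrite Gamma_real mulrC -[Gamma s]/(cintegral P (gamma_integrand s)).
rewrite -cintegralZ//; last exact: cintegrable_gamma.
apply: eq_cintegral => x; rewrite itv_oyE => x0.
rewrite (@eq_cintegral _ P _ (fun y => (kp p (x / y) * h p y)%:C))//.
rewrite cintegral_real /Rintegral integral_beta_exp//.
have -> : (\int[mu]_(t in P) (h p t)%:E)%E = (rGamma p)%:E by rewrite EFin_rGamma.
by rewrite -EFinM/= rmorphM/= /gamma_integrand; ring.
Qed.

End BetaIntegral.

(** * Integration of series term by term *)

Section Termwise.
Local Set Implicit Arguments.
Local Unset Strict Implicit.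
Local Open Scope classical_set_scope.
Context {R : realType}.
Local Notation mu := (@lebesgue_measure R).
Local Notation Re := (@complex.Re R).
Local Notation Im := (@complex.Im R).

Definition ccvg (u : nat -> R[i]) (l : R[i]) :=
  (fun n => Re (u n)) @ \oo --> Re l /\ (fun n => Im (u n)) @ \oo --> Im l.

Lemma ccvg_unique u l l' : ccvg u l -> ccvg u l' -> l = l'.
Proof.
move=> [r i] [r' i']; apply: complex_eq.
  exact: (cvg_unique _ r r').
exact: (cvg_unique _ i i').
Qed.

Lemma ccvgZ u l (c : R[i]) : ccvg u l -> ccvg (fun n => c * u n) (c * l).
Proof.
move=> [r i]; split.
  under eq_fun do rewrite Re_mulc.
  by rewrite Re_mulc; apply: cvgB; apply: cvgM => //; exact: cvg_cst.
under eq_fun do rewrite Im_mulc.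
by rewrite Im_mulc; apply: cvgD; apply: cvgM => //; exact: cvg_cst.
Qed.

Lemma cvg_Rintegral (D : set R) (g : nat -> R -> R) (f : R -> R) : measurable D ->
  mu.-integrable D (fun x => (f x)%:E) ->
  (\int[mu]_(x in D) (g n x)%:E @[n --> \oo] --> \int[mu]_(x in D) (f x)%:E)%E ->
  (\int[mu]_(x in D) (g n x) @[n --> \oo] --> \int[mu]_(x in D) (f x))%R.
Proof.
move=> mD If H; apply: fine_cvg.
by rewrite [in X in _ --> X]/Rintegral fineK//; exact: integrable_fin_num.
Qed.

(** Dominated convergence of the partial sums, for each of the two parts. *)
Lemma termwise_integral (D : set R) (W : R -> R[i]) (d : nat -> R) (v S G : R -> R) :
  measurable D -> cmeasurable D W ->
  (forall x, D x -> series (fun n => d n * v x ^+ n) @ \oo --> S x) ->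
  (forall x N, D x -> `|series (fun n => d n * v x ^+ n) N| <= G x) ->
  mu.-integrable D (fun x => (G x * abs1 (W x))%:E) ->
  (forall n, cintegrable D (fun x => (v x ^+ n)%:C * W x)) ->
  cintegrable D (fun x => (S x)%:C * W x) /\
  ccvg (series (fun n => (d n)%:C * cintegral D (fun x => (v x ^+ n)%:C * W x)))
       (cintegral D (fun x => (S x)%:C * W x)).
Proof.
move=> mD mW cS bG iG iv.
pose p N x := series (fun n => d n * v x ^+ n) N.
have ip N : cintegrable D (fun x => (p N x)%:C * W x) /\
    cintegral D (fun x => (p N x)%:C * W x) =
    series (fun n => (d n)%:C * cintegral D (fun x => (v x ^+ n)%:C * W x)) N.
  have H := @cintegrable_sum R D (fun k x => (d k)%:C * ((v x ^+ k)%:C * W x)) N mD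
    (fun k => cintegrableZ (d k)%:C mD (iv k)).
  have E : (fun x => \sum_(k < N) (d k)%:C * ((v x ^+ k)%:C * W x)) = (fun x => (p N x)%:C * W x).
    apply/funext => x; rewrite /p /series/= big_mkord rmorph_sum/= mulr_suml.
    by apply: eq_bigr => k _; rewrite rmorphM/= mulrA.
  rewrite E in H; have [i1 e1] := H; split => //.
  by rewrite e1 /series/= big_mkord; apply: eq_bigr => k _; rewrite cintegralZ.
have part (q : R[i] -> R) : (forall (x : R) z, q (x%:C * z) = x * q z) ->
    (forall z, `|q z| <= abs1 z) -> measurable_fun D (fun x => q (W x)) ->
    (forall N, measurable_fun D (fun x => q ((p N x)%:C * W x))) ->
    mu.-integrable D (fun x => (q ((S x)%:C * W x))%:E) /\
    (\int[mu]_(x in D) (q ((p N x)%:C * W x))%:E @[N --> \oo] -->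
     \int[mu]_(x in D) (q ((S x)%:C * W x))%:E)%E.
  move=> qZ qa mq mqN.
  have cvgq x : D x -> (fun N => q ((p N x)%:C * W x)) @ \oo --> q ((S x)%:C * W x).
    move=> Dx; under eq_fun do rewrite qZ.
    by rewrite qZ; apply: cvgM; [exact: cS|exact: cvg_cst].
  apply: (@real_dominated_convergence _ _ _ _ (fun x => G x * abs1 (W x))) => //.
  - exact: (measurable_fun_cvg mqN).
  - move=> N x Dx; rewrite qZ normrM; apply: ler_pM => //; exact: bG.
have [Mr Mi] := mW.
have [ir cr] := part _ (@Re_realM R) (@abs1_Re R) Mr (fun N => (cintegrable_cmeasurable (ip N).1).1).
have [ii ci] := part _ (@Im_realM R) (@abs1_Im R) Mi (fun N => (cintegrable_cmeasurable (ip N).1).2).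
split; first by split.
split.
- under eq_fun do rewrite -(ip _).2.
  exact: (cvg_Rintegral mD ir cr).
- under eq_fun do rewrite -(ip _).2.
  exact: (cvg_Rintegral mD ii ci).
Qed.

(** Monotone convergence: for nonnegative terms, a bound on the sum of the
    integrals makes the sum integrable. *)
Lemma integrable_series_le (D : set R) (u : nat -> R -> R) (G : R -> R) (M : R) :
  measurable D -> (forall n, mu.-integrable D (fun x => (u n x)%:E)) ->
  (forall n x, D x -> 0 <= u n x) ->
  (forall x, D x -> series (u ^~ x) @ \oo --> G x) ->
  (forall N, series (fun n => \int[mu]_(x in D) u n x) N <= M) ->
  mu.-integrable D (fun x => (G x)%:E).
Proof.
move=> mD iu u0 cG bM.
pose p N x := series (u ^~ x) N.
have ip N : mu.-integrable D (fun x => (p N x)%:E) /\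
    \int[mu]_(x in D) p N x = series (fun n => \int[mu]_(x in D) u n x) N.
  elim: N => [|N [ih1 ih2]].
    have -> : p 0%N = fun=> 0 by apply/funext => x; rewrite /p /series/= big_geq.
    split; first exact: integrable0.
    by rewrite /Rintegral integral0 /series/= big_geq.
  have -> : p N.+1 = (fun x => p N x + u N x).
    by apply/funext => x; rewrite /p /series/= big_nat_recr.
  split; first exact: integrable_add.
  by rewrite (RintegralD (mu := mu) mD ih1 (iu N)) [X in X + _]ih2 /series/= big_nat_recr.
have p0 N x : D x -> 0 <= p N x.
  by move=> Dx; rewrite /p /series/= sumr_ge0// => k _; exact: u0.
have mp N : measurable_fun D (p N).
  by apply/measurable_EFinP; apply: (measurable_int mu); exact: (ip N).1.
have mG : measurable_fun D G by apply: (measurable_fun_cvg mp).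
have G0 x : D x -> 0 <= G x.
  move=> Dx; have := cG x Dx => H; rewrite -(cvg_lim _ H)//.
  apply: limr_ge; first by apply/cvg_ex; eexists; exact: H.
  by apply: nearW => N; exact: p0.
apply/integrableP; split; first exact: measurable_EFin.
have -> : (\int[mu]_(x in D) `|(G x)%:E| = \int[mu]_(x in D) (G x)%:E)%E.
  by apply: eq_integral => x /set_mem Dx; rewrite /= ger0_norm// G0.
apply: (@le_lt_trans _ _ M%:E); last exact: ltry.
have H := @cvg_monotone_convergence _ _ R mu D mD (fun N x => (p N x)%:E).
have -> : (\int[mu]_(x in D) (G x)%:E = \int[mu]_(x in D) limn (fun N => (p N x)%:E))%E.
  apply: eq_integral => x /set_mem Dx; apply/esym/cvg_lim => //.
  by apply: cvg_EFin; [exact: nearW|exact: cG].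
have {}H : (\int[mu]_(x in D) (p N x)%:E @[N --> \oo] -->
    \int[mu]_(x in D) limn (fun N => (p N x)%:E))%E.
  apply: H.
  - by move=> N; exact: measurable_EFin.
  - by move=> N x Dx; rewrite lee_fin p0.
  - move=> x Dx m n mn; rewrite lee_fin; apply: nondecreasing_series mn => k _ _; exact: u0.
rewrite -(cvg_lim _ H)//; apply: lime_le; first by apply/cvg_ex; eexists; exact: H.
apply: nearW => N; have [i1 e1] := ip N.
have -> : (\int[mu]_(x in D) (p N x)%:E = (\int[mu]_(x in D) p N x)%:E)%E.
  by rewrite /Rintegral fineK//; exact: integrable_fin_num.
by rewrite lee_fin e1.
Qed.

End Termwise.

(** * The binomial series *)

Section Binomial.
Local Set Implicit Arguments.
Local Unset Strict Implicit.
Local Open Scope classical_set_scope.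
Context {R : realType}.
Local Notation Re := (@complex.Re R).
Local Notation P := (`]0%R : R, +oo[%classic).

Lemma rising0 (a : R) : rising a 0 = 1. Proof. by rewrite /rising big_ord0. Qed.

Lemma risingS (a : R) n : rising a n.+1 = rising a n * (a + n%:R).
Proof. by rewrite /rising big_ord_recr. Qed.

Lemma rising_shift (a : R) n : rising a n.+1 = a * rising (a + 1) n.
Proof.
rewrite /rising big_ord_recl addr0; congr (_ * _).
by apply: eq_bigr => i _; rewrite /= /bump/= natrD addrA.
Qed.

Lemma rising_ge0 (a : R) n : 0 <= a -> 0 <= rising a n.
Proof. by move=> a0; apply: prodr_ge0 => i _; rewrite addr_ge0. Qed.

Lemma rising_gt0 (a : R) n : 0 < a -> 0 < rising a n.
Proof. by move=> a0; apply: prodr_gt0 => i _; rewrite ltr_wpDr. Qed.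

Lemma ler_rising (a b : R) n : 0 <= a -> a <= b -> rising a n <= rising b n.
Proof.
move=> a0 ab; apply: ler_prod => i _; rewrite addr_ge0//=; exact: lerD.
Qed.

Lemma rGamma_rising (a : R) n : 0 < a -> rGamma (a + n%:R) = rising a n * rGamma a.
Proof.
move=> a0; elim: n => [|n ih]; first by rewrite addr0 rising0 mul1r.
by rewrite -natr1 addrA rGamma_add1 ?ltr_wpDr// ih risingS mulrCA mulrA.
Qed.

Definition binomial_coeff (a : R) (n : nat) : R := rising a n / n`!%:R.

Lemma binomial_coeffS (a : R) n :
  binomial_coeff a n.+1 = binomial_coeff (a + 1) n.+1 - binomial_coeff (a + 1) n.
Proof.
rewrite /binomial_coeff rising_shift risingS factS natrM.
have f0 : (n`!%:R : R) != 0 by rewrite pnatr_eq0 -lt0n fact_gt0.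
have n0 : (n%:R + 1 : R) != 0 by rewrite natr1 pnatr_eq0.
by rewrite -natr1; field; rewrite f0 n0.
Qed.

(** [r `^ (- a) * Gamma a] is the integral of [x `^ (a - 1) * expR (- x)] times
    [expR ((1 - r) * x)], by scaling; expanding the last exponential yields the terms
    [(1 - r) ^+ n / n`! * Gamma (a + n)]. *)
Lemma binomial_series_gt0 (a r : R) : 0 < a -> 0 < r < 1 ->
  series (fun n => binomial_coeff a n * (1 - r) ^+ n) @ \oo --> r `^ (- a).
Proof.
move=> a0 /andP[r0 r1]; have mP : measurable P by [].
have r10 : 0 <= 1 - r by rewrite subr_ge0 ltW.
(* The weight is the integrand of [Gamma a], and [S] the exponential whose series is
   integrated term by term. *)
pose W := gamma_integrand (R := R) a%:C.
pose v (x : R) := (1 - r) * x.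
pose S x := expR (v x).
have iW := cintegrable_gamma (a0 : 0 < Re a%:C).
have mW : cmeasurable P W by exact: cintegrable_cmeasurable.
have cS x : series (fun n => n`!%:R^-1 * v x ^+ n) @ \oo --> S x.
  rewrite /S; have := is_cvg_series_exp_coeff (v x); rewrite /expR.
  by under [in X in _ -> X]eq_fun do rewrite mulrC.
have t_ge0 x n : 0 < x -> 0 <= n`!%:R^-1 * v x ^+ n.
  by move=> x0; rewrite mulr_ge0 ?exprn_ge0// mulr_ge0// ltW.
have bG x N : P x -> `|series (fun n => n`!%:R^-1 * v x ^+ n) N| <= S x.
  rewrite itv_oyE => x0; rewrite ger0_norm; last by rewrite sumr_ge0// => k _; exact: t_ge0.
  rewrite -(cvg_lim _ (cS x))//; apply: nondecreasing_cvgn_le; last first.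
    by apply/cvg_ex; eexists; exact: cS.
  by apply: nondecreasing_series => n _ _; exact: t_ge0.
have SW x : 0 < x -> (S x)%:C * W x = (r `^ (1 - a))%:C * W (r * x).
  move=> x0; rewrite /W /gamma_integrand cpowM// -[cpow r _]/(cpow r (a%:C - 1%:C)) -rmorphB/= cpow_real.
  rewrite cpow_real -!rmorphM/=; congr (_%:C).
  have rr : r `^ (1 - a) * r `^ (a - 1) = 1.
    by rewrite -powRD ?(gt_eqF r0) ?implybT// addrA subrK subrr powRr0.
  have ee : S x * expR (- x) = expR (- (r * x)).
    by rewrite /S -expRD; congr expR; rewrite /v; ring.
  transitivity ((r `^ (1 - a) * r `^ (a - 1)) * (x `^ (a - 1) * (S x * expR (- x)))).
    by rewrite rr mul1r; ring.
  by rewrite ee; ring.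
have iSW : cintegrable P (fun x => (S x)%:C * W x) /\
    cintegral P (fun x => (S x)%:C * W x) = (r `^ (- a))%:C * Gamma a%:C.
  have [i1 e1] := cintegral_scale r0 iW.
  have EQ x : P x -> (r `^ (1 - a))%:C * W (r * x) = (S x)%:C * W x.
    by rewrite itv_oyE => x0; rewrite SW.
  split; first exact: (eq_cintegrable mP EQ (cintegrableZ _ mP i1)).
  rewrite -(eq_cintegral EQ) (cintegralZ _ mP i1) e1 mulrA -rmorphM/=; congr (_%:C * _).
  by rewrite -powR_inv1 ?(ltW r0)// -powRD ?(gt_eqF r0) ?implybT// addrAC subrr add0r.
have vW n x : P x -> ((1 - r) ^+ n)%:C * gamma_integrand (a + n%:R)%:C x = (v x ^+ n)%:C * W x.
  rewrite itv_oyE => x0; rewrite /W /gamma_integrand.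
  rewrite -![(_%:C - 1)]/(_%:C - 1%:C) -!rmorphB/= !cpow_real -!rmorphM/=; congr (_%:C).
  rewrite addrAC powRD ?(gt_eqF x0) ?implybT// powR_mulrn ?(ltW x0)// exprMn; ring.
have an0 n : 0 < a + n%:R by rewrite ltr_wpDr.
have ivW n := cintegrable_gamma (an0 n : 0 < Re (a + n%:R)%:C).
have [||_ H] := @termwise_integral R P W (fun n => n`!%:R^-1) v S S mP mW (fun x _ => cS x) bG.
- have := integrable_abs1 mP iSW.1; apply: eq_integrable => // x _.
  by rewrite abs1_real ger0_norm ?expR_ge0.
- by move=> n; apply: (eq_cintegrable mP (vW n)); exact: (cintegrableZ _ mP (ivW n)).
have [Hr _] := H.
have G0 := rGamma_gt0 a0.
have -> : r `^ (- a) = (rGamma a)^-1 * Re (cintegral P (fun x => (S x)%:C * W x)).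
  by rewrite iSW.2 Re_realM Gamma_real /=; field; rewrite gt_eqF.
have -> : series (fun n => binomial_coeff a n * (1 - r) ^+ n) =
  (fun N => (rGamma a)^-1 * Re (series (fun n => (n`!%:R^-1)%:C * cintegral P (fun x => (v x ^+ n)%:C * W x)) N)).
  apply/funext => N; rewrite /series/=.
  have -> (F : nat -> R[i]) : Re (\sum_(0 <= k < N) F k) = \sum_(0 <= k < N) Re (F k).
    by apply: (big_morph Re) => //; exact: Re_addc.
  rewrite mulr_sumr; apply: eq_bigr => n _.
  rewrite -(eq_cintegral (vW n)) (cintegralZ _ mP (ivW n)) !Re_realM -[cintegral _ _]/(Gamma _) Gamma_real/=.
  rewrite rGamma_rising// /binomial_coeff; field.
  by rewrite (gt_eqF G0) andbT pnatr_eq0 -lt0n fact_gt0.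
by apply: cvgM => //; exact: cvg_cst.
Qed.

(** By Pascal's rule, multiplying the series of the positive exponent [a + 1] by
    [1 - (1 - r)] gives the series of [a]. *)
Lemma binomial_series (a r : R) : -1 < a -> 0 < r < 1 ->
  series (fun n => binomial_coeff a n * (1 - r) ^+ n) @ \oo --> r `^ (- a).
Proof.
move=> a1 r01; have /andP[r0 r1] := r01.
have a10 : 0 < a + 1 by rewrite -ltrBlDr sub0r.
have H := binomial_series_gt0 a10 r01.
set u := series _ in H.
rewrite -(@cvg_shiftS R).
have -> : [sequence (series (fun n => binomial_coeff a n * (1 - r) ^+ n)) n.+1]_n =
    (fun n => u n.+1 - (1 - r) * u n).
  apply/funext => N /=; rewrite /u /series/=.
  elim: N => [|N ih].
    by rewrite !big_nat1 big_geq// mulr0 subr0 /binomial_coeff !rising0.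
  have E (F : nat -> R) M : \sum_(0 <= k < M.+1) F k = \sum_(0 <= k < M) F k + F M.
    by rewrite big_nat_recr.
  rewrite [LHS]E ih [X in _ = X - _]E [X in _ = _ - _ * X]E.
  rewrite binomial_coeffS !exprS; ring.
have -> : r `^ (- a) = r `^ (- (a + 1)) - (1 - r) * r `^ (- (a + 1)).
  have -> : - a = 1 + - (a + 1) by ring.
  rewrite powRD ?(gt_eqF r0) ?implybT// powRr1 ?ltW//; ring.
apply: cvgB; first by rewrite (@cvg_shiftS R).
by apply: cvgM => //; exact: cvg_cst.
Qed.

(** After the first one, all the terms of the series have the sign of [a]. *)
Lemma binomial_series_abs_le (a r : R) N : -1 < a -> 0 < r < 1 ->
  series (fun n => `|binomial_coeff a n| * (1 - r) ^+ n) N <= 2 + r `^ (- a).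
Proof.
move=> a1 r01; have /andP[r0 r1] := r01.
have r10 : 0 <= 1 - r by rewrite subr_ge0 ltW.
have H := binomial_series a1 r01.
have ub (u : nat -> R) (l : R) (M : nat) : u @ \oo --> l ->
    (forall n, (M <= n)%N -> u n <= u n.+1) -> u M <= l.
  move=> ul nd; rewrite -(cvg_lim _ ul)//; apply: limr_ge; first by apply/cvg_ex; eexists; exact: ul.
  exists M => // n /= Mn; elim: n Mn => [|n ih]; first by rewrite leqn0 => /eqP ->.
  rewrite leq_eqVlt => /predU1P[->//|]; rewrite ltnS => Mn.
  exact: le_trans (ih Mn) (nd _ Mn).
have fn0 n : 0 < (n`!%:R : R)^-1 by rewrite invr_gt0 ltr0n fact_gt0.
have [a0|a0] := leP 0 a.
  rewrite (_ : series _ N = series (fun n => binomial_coeff a n * (1 - r) ^+ n) N); last first.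
    by apply: eq_bigr => n _; rewrite ger0_norm// mulr_ge0 ?rising_ge0// ltW.
  rewrite (@le_trans _ _ (r `^ (- a)))//; last by rewrite lerDr.
  apply: (ub _ _ _ H) => n _; rewrite /series/= big_nat_recr//= lerDl.
  by rewrite mulr_ge0 ?exprn_ge0// mulr_ge0 ?rising_ge0// ltW.
have neg n : binomial_coeff a n.+1 <= 0.
  rewrite /binomial_coeff rising_shift pmulr_lle0//; rewrite nmulr_rle0//.
  by rewrite ltW// rising_gt0// -ltrBlDr sub0r.
case: N => [|N].
  by rewrite /series/= big_geq// addr_ge0 ?powR_ge0.
have -> : series (fun n => `|binomial_coeff a n| * (1 - r) ^+ n) N.+1 =
   2 - series (fun n => binomial_coeff a n * (1 - r) ^+ n) N.+1.
  elim: N => [|N ih].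
    by rewrite /series/= !big_nat1 /binomial_coeff rising0 fact0 divr1 normr1; ring.
  rewrite /series/= in ih *; rewrite big_nat_recr//= ih [in RHS]big_nat_recr//=.
  by rewrite ler0_norm//; ring.
suff : 0 <= series (fun n => binomial_coeff a n * (1 - r) ^+ n) N.+1.
  by have := powR_ge0 r (- a); lra.
apply: (@le_trans _ _ (r `^ (- a))); first exact: powR_ge0.
rewrite -lerN2; apply: (ub (fun n => - series (fun n => binomial_coeff a n * (1 - r) ^+ n) n)).
  exact: cvgN.
move=> [//|n] _; rewrite lerN2 /series/= [leLHS]big_nat_recr//= gerDl.
by rewrite mulr_le0_ge0 ?exprn_ge0.
Qed.

End Binomial.

(** * Domination of the hypergeometric series *)

Section HypergeometricSeries.
Local Set Implicit Arguments.
Local Unset Strict Implicit.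
Local Open Scope classical_set_scope.
Context {R : realType}.

Lemma nondecreasing_series_cvg (u : nat -> R) (M : R) :
  (forall n, 0 <= u n) -> (forall N, series u N <= M) ->
  [/\ series u @ \oo --> limn (series u), (forall N, series u N <= limn (series u))
    & limn (series u) <= M].
Proof.
move=> u0 uM; have nd : nondecreasing_seq (series u) by apply: nondecreasing_series => n _ _.
have cu : cvgn (series u).
  apply: nondecreasing_is_cvgn => //; exists M => _ [N _ <-]; exact: uM.
split => //.
- by move=> N; exact: nondecreasing_cvgn_le.
- by apply: limr_le => //; apply: nearW => N; exact: uM.
Qed.

Context (a b c : R) (a_gtN1 : -1 < a) (b_gt0 : 0 < b) (b_le_c : b <= c).

Definition hyp_coeff (n : nat) : R := rising a n * rising b n / (rising c n * n`!%:R).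

(** The sum of the absolute series. Being nondecreasing in [z], it allows pointwise
    bounds to be deduced from bounds in the mean. *)
Definition hyp_abs (z : R) : R := limn (series (fun n => `|hyp_coeff n| * z ^+ n)).

Lemma c_gt0 : 0 < c. Proof. exact: lt_le_trans b_le_c. Qed.

(** The factor [rising b n / rising c n] is at most 1 because [b <= c]. *)
Lemma norm_hyp_coeff_le n : `|hyp_coeff n| <= `|binomial_coeff a n|.
Proof.
have -> : hyp_coeff n = binomial_coeff a n * (rising b n / rising c n).
  rewrite /hyp_coeff /binomial_coeff; field.
  by rewrite (gt_eqF (rising_gt0 _ c_gt0))/= pnatr_eq0 -lt0n fact_gt0.
rewrite normrM ler_piMr// ger0_norm; last first.
  by rewrite divr_ge0 ?rising_ge0// ltW// c_gt0.
by rewrite ler_pdivrMr ?rising_gt0 ?c_gt0// mul1r ler_rising// ltW.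
Qed.

Lemma hyp_abs_partial (r : R) N : 0 < r < 1 ->
  series (fun n => `|hyp_coeff n| * (1 - r) ^+ n) N <= 2 + r `^ (- a).
Proof.
move=> r01; apply: le_trans (binomial_series_abs_le N a_gtN1 r01).
have /andP[r0 r1] := r01; have r10 : 0 <= 1 - r by rewrite subr_ge0 ltW.
apply: ler_sum => n _; rewrite ler_wpM2r ?exprn_ge0//; exact: norm_hyp_coeff_le.
Qed.

Lemma hyp_absP (r : R) : 0 < r < 1 ->
  [/\ series (fun n => `|hyp_coeff n| * (1 - r) ^+ n) @ \oo --> hyp_abs (1 - r),
      (forall N, series (fun n => `|hyp_coeff n| * (1 - r) ^+ n) N <= hyp_abs (1 - r))
    & hyp_abs (1 - r) <= 2 + r `^ (- a)].
Proof.
move=> r01; apply: nondecreasing_series_cvg => [n|N]; last exact: hyp_abs_partial.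
by case/andP: r01 => r0 r1; rewrite mulr_ge0// exprn_ge0// subr_ge0 ltW.
Qed.

Lemma hyp_abs_ge0 (r : R) : 0 < r < 1 -> 0 <= hyp_abs (1 - r).
Proof. by move=> /hyp_absP[_ /(_ 0%N) + _]; rewrite /series/= big_geq. Qed.

Lemma hyp_abs_le (r r' : R) : 0 < r -> r <= r' -> r' < 1 -> hyp_abs (1 - r') <= hyp_abs (1 - r).
Proof.
move=> r0 rr' r1.
have r'01 : 0 < r' < 1 by rewrite (lt_le_trans r0).
have r01 : 0 < r < 1 by rewrite r0 (le_lt_trans rr').
have [c1 _ _] := hyp_absP r'01; have [_ b2 _] := hyp_absP r01.
rewrite -(cvg_lim _ c1)//; apply: limr_le; first by apply/cvg_ex; eexists; exact: c1.
apply: nearW => N; apply: le_trans (b2 N); apply: ler_sum => n _.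
by rewrite ler_wpM2l// lerXn2r ?nnegrE//; lra.
Qed.

Lemma hyp2F1P (r : R) : 0 < r < 1 ->
  [/\ series (fun n => hyp_coeff n * (1 - r) ^+ n) @ \oo --> hyp2F1 a b c (1 - r),
      (forall N, `|series (fun n => hyp_coeff n * (1 - r) ^+ n) N| <= hyp_abs (1 - r))
    & `|hyp2F1 a b c (1 - r)| <= hyp_abs (1 - r)].
Proof.
move=> r01; have [cA bA _] := hyp_absP r01.
have r10 : 0 <= 1 - r by case/andP: r01 => r0 r1; rewrite subr_ge0 ltW.
have cF : series (fun n => hyp_coeff n * (1 - r) ^+ n) @ \oo --> hyp2F1 a b c (1 - r).
  apply: normed_cvg.
  suff : cvgn (series (fun n => `|hyp_coeff n * (1 - r) ^+ n|)) by [].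
  have -> : (fun n => `|hyp_coeff n * (1 - r) ^+ n|) = (fun n => `|hyp_coeff n| * (1 - r) ^+ n).
    by apply/funext => n; rewrite normrM (ger0_norm (exprn_ge0 _ r10)).
  by apply/cvg_ex; eexists; exact: cA.
have bN N : `|series (fun n => hyp_coeff n * (1 - r) ^+ n) N| <= hyp_abs (1 - r).
  apply: le_trans (bA N); rewrite (le_trans (ler_norm_sum _ _ _))//.
  by apply: ler_sum => n _; rewrite normrM (ger0_norm (exprn_ge0 _ r10)).
split => //.
have cn : (fun N => `|series (fun n => hyp_coeff n * (1 - r) ^+ n) N|) @ \oo --> `|hyp2F1 a b c (1 - r)|.
  exact: cvg_norm.
rewrite -(cvg_lim _ cn)//.
by apply: limr_le; [apply/cvg_ex; eexists; exact: cn|apply: nearW].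
Qed.

End HypergeometricSeries.

(** * Gauss's summation theorem *)

Section GaussSum.
Local Set Implicit Arguments.
Local Unset Strict Implicit.
Local Open Scope classical_set_scope.
Context {R : realType}.
Local Notation mu := (@lebesgue_measure R).
Local Notation Re := (@complex.Re R).
Local Notation I01 := (`]0%R : R, 1%R[%classic).

Let mI : measurable I01. Proof. by []. Qed.

Lemma onem_powRX (p r : R) n : 0 < r < 1 ->
  (1 - r) ^+ n * onem_powR p r = onem_powR (p + n%:R) r.
Proof.
move=> /andP[r0 r1]; have s0 : 0 < 1 - r by rewrite subr_gt0.
have -> : onem_powR (p + n%:R) r = (1 - r) `^ ((p - 1) + n%:R) by congr (_ `^ _); ring.
by rewrite powRD ?(gt_eqF s0) ?implybT// powR_mulrn ?(ltW s0)// mulrC.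
Qed.

Lemma beta_integrandX p (s : R[i]) (r : R) n : I01 r ->
  beta_integrand (p + n%:R) s r = ((1 - r) ^+ n)%:C * beta_integrand p s r.
Proof.
rewrite itv01E => r01; rewrite /beta_integrand -onem_powRX// rmorphM/=; ring.
Qed.

Definition rBeta (p s : R) : R := \int[mu]_(r in I01) (r `^ (s - 1) * onem_powR p r).

Lemma Beta_real (p s : R) : Beta p s%:C = (rBeta p s)%:C.
Proof.
rewrite /Beta -cintegral_real; congr cintegral; apply/funext => r.
by rewrite /beta_integrand -[1%R]/((1:R)%:C) -rmorphB/= cpow_real -rmorphM.
Qed.

Lemma rBeta_ge0 (p s : R) : 0 <= rBeta p s.
Proof. by apply: Rintegral_ge0 => r _; rewrite mulr_ge0 ?powR_ge0. Qed.

Section gauss.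
Context (a b : R) (d : R[i]) (a_gtN1 : -1 < a) (b_gt0 : 0 < b)
  (d_gt0 : 0 < Re d) (da_gt0 : 0 < Re (d - a%:C)).

Let integrable_dominant :
  mu.-integrable I01 (fun r => ((2 + r `^ (- a)) * abs1 (beta_integrand b d r))%:E).
Proof.
have i1 := integrable_beta b_gt0 d_gt0.
have i2 := integrable_beta b_gt0 da_gt0.
have i3 := integrable_add mI (integrable_mull 4 mI i1) (integrable_mull 2 mI i2).
apply: le_integrable i3 => //.
  apply: measurable_EFin; apply: measurable_funM.
    by apply: measurable_funD => //; apply: measurable_funTS; exact: measurable_powR.
  by apply: measurable_abs1; apply: cmeasurableS (cmeasurable_beta_integrand b d).
move=> r; rewrite itv01E => /andP[r0 r1]; rewrite lee_fin.
rewrite ger0_norm ?mulr_ge0 ?addr_ge0 ?powR_ge0 ?abs1_ge0//.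
rewrite (le_trans _ (ler_norm _))//.
rewrite (le_trans (ler_wpM2l _ (abs1_beta_integrand b d r))) ?addr_ge0 ?powR_ge0//.
rewrite le_eqVlt; apply/orP; left; apply/eqP.
have -> : r `^ (Re (d - a%:C) - 1) = r `^ (- a) * r `^ (Re d - 1).
  rewrite -powRD ?(gt_eqF r0) ?implybT// Re_addc Re_oppc /=; congr (_ `^ _); ring.
ring.
Qed.

Let termwise (e : nat -> R) (S : R -> R) :
  (forall r : R, 0 < r < 1 -> series (fun n => e n * (1 - r) ^+ n) @ \oo --> S r) ->
  (forall (r : R) N, 0 < r < 1 -> `|series (fun n => e n * (1 - r) ^+ n) N| <= 2 + r `^ (- a)) ->
  ccvg (series (fun n => (e n)%:C * Beta (b + n%:R) d))
    (cintegral I01 (fun r => (S r)%:C * beta_integrand b d r)).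
Proof.
move=> cS bS; have mW := cmeasurable_beta_integrand b d.
have bn n : 0 < b + n%:R by rewrite ltr_wpDr.
have [|||||_] := @termwise_integral R I01 (beta_integrand b d) e (fun r => 1 - r) S
  (fun r => 2 + r `^ (- a)) mI.
- exact: cmeasurableS mW.
- by move=> r; rewrite itv01E; exact: cS.
- by move=> r N; rewrite itv01E; exact: bS.
- exact: integrable_dominant.
- move=> n; apply: (eq_cintegrable mI (fun r h => beta_integrandX b d n h)).
  exact: cintegrable_beta.
congr (ccvg (series _) _); apply/funext => n; congr (_ * _).
by apply: eq_cintegral => r h; rewrite -beta_integrandX.
Qed.

(** Integrating the binomial series of [r `^ (- a)] against
    [r `^ (d - 1) * (1 - r) `^ (b - 1)]. This is Gauss's evaluation of the hypergeometric
    series at 1, as [Beta (b + n) d / Beta b d] is [rising b n / rising (b + d) n]. *)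
Lemma gauss_sum :
  ccvg (series (fun n => (binomial_coeff a n)%:C * Beta (b + n%:R) d)) (Beta b (d - a%:C)).
Proof.
have -> : Beta b (d - a%:C) =
    cintegral I01 (fun r => (r `^ (- a))%:C * beta_integrand b d r).
  apply: eq_cintegral => r; rewrite itv01E => /andP[r0 r1].
  rewrite /beta_integrand -cpow_real mulrA -cpowD// rmorphN addrA (addrC _ d).
  by [].
apply: termwise => [r r01|r N r01]; first exact: binomial_series.
have /andP[r0 r1] := r01; have r10 : 0 <= 1 - r by rewrite subr_ge0 ltW.
apply: le_trans (binomial_series_abs_le N a_gtN1 r01).
rewrite (le_trans (ler_norm_sum _ _ _))//; apply: ler_sum => n _.
by rewrite normrM (ger0_norm (exprn_ge0 _ r10)).
Qed.

Lemma gauss_abs_sum : exists l,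
  ccvg (series (fun n => `|binomial_coeff a n|%:C * Beta (b + n%:R) d)) l.
Proof.
pose S r := limn (series (fun n => `|binomial_coeff a n| * (1 - r) ^+ n)).
exists (cintegral I01 (fun r => (S r)%:C * beta_integrand b d r)).
apply: termwise => [r r01|r N r01];
  have /andP[r0 r1] := r01; have r10 : 0 <= 1 - r by rewrite subr_ge0 ltW.
  have [] // := @nondecreasing_series_cvg R (fun n => `|binomial_coeff a n| * (1 - r) ^+ n) (2 + r `^ (- a)).
  - by move=> n; rewrite mulr_ge0 ?exprn_ge0.
  - by move=> N; exact: binomial_series_abs_le.
rewrite ger0_norm; first exact: binomial_series_abs_le.
by rewrite sumr_ge0// => k _; rewrite mulr_ge0 ?exprn_ge0.
Qed.

End gauss.

(** The absolute series is handled by the same integral, with the sum of the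
    absolute binomial series in place of [r `^ (- a)]. *)
Lemma gauss_abs_bound (a b d : R) : -1 < a -> 0 < b -> 0 < d -> 0 < d - a ->
  exists M, forall N, series (fun n => `|binomial_coeff a n| * rBeta (b + n%:R) d) N <= M.
Proof.
move=> a1 b0 d0 da.
have [|l [lr _]] := @gauss_abs_sum a b d%:C a1 b0 d0; first by rewrite Re_addc Re_oppc.
exists (Re l) => N.
have E M : Re (series (fun n => `|binomial_coeff a n|%:C * Beta (b + n%:R) d%:C) M) =
    series (fun n => `|binomial_coeff a n| * rBeta (b + n%:R) d) M.
  rewrite /series/= (big_morph Re (@Re_addc R) (erefl : Re 0 = 0)).
  by apply: eq_bigr => n _; rewrite Beta_real -rmorphM.
have {}lr : series (fun n => `|binomial_coeff a n| * rBeta (b + n%:R) d) @ \oo --> Re l.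
  by move: lr; under eq_fun do rewrite E.
rewrite -(cvg_lim _ lr)//; apply: nondecreasing_cvgn_le; last by apply/cvg_ex; eexists; exact: lr.
by apply: nondecreasing_series => n _ _; rewrite mulr_ge0 ?rBeta_ge0.
Qed.

Lemma Beta_GammaE (p : R) (s : R[i]) : 0 < p -> 0 < Re s ->
  Beta p s = Gamma s * Gamma p%:C / Gamma (s + p%:C).
Proof.
move=> p0 s0; have sp : Gamma (s + p%:C) != 0.
  by apply: Gamma_neq0; rewrite Re_addc addr_gt0.
by rewrite -(Beta_Gamma p0 s0) mulfK.
Qed.

(** The factor, independent of [n], that relates the terms of the moment to those of
    [gauss_sum]: [rising c n] cancels against [Beta (c + n) s], and [rising b n] is
    absorbed into [Beta (b + n) (s + (c - b))]. *)
Definition beta_ratio (b c : R) (s : R[i]) : R[i] :=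
  Gamma c%:C * Gamma s / (Gamma b%:C * Gamma (s + (c - b)%:C)).

Lemma hyp_coeff_Beta (a b c : R) (s : R[i]) n : 0 < b -> b <= c -> 0 < Re s ->
  (hyp_coeff a b c n)%:C * Beta (c + n%:R) s =
  beta_ratio b c s * ((binomial_coeff a n)%:C * Beta (b + n%:R) (s + (c - b)%:C)).
Proof.
move=> b0 bc s0; have c0 : 0 < c by exact: lt_le_trans bc.
have scb : 0 < Re (s + (c - b)%:C) by rewrite Re_addc/= ltr_wpDr// subr_ge0.
rewrite !Beta_GammaE ?ltr_wpDr//.
have -> : s + (c - b)%:C + (b + n%:R)%:C = s + (c + n%:R)%:C.
  by rewrite -addrA -rmorphD/= addrA subrK.
rewrite !Gamma_real !rGamma_rising// /beta_ratio !Gamma_real.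
have g1 := Gamma_neq0 scb.
have g2 : Gamma (s + (c + n%:R)%:C) != 0.
  by apply: Gamma_neq0; rewrite Re_addc/= addr_gt0// ltr_wpDr.
have g3 : (rGamma b)%:C != 0 by rewrite fmorph_eq0 gt_eqF// rGamma_gt0.
have g4 : (rising c n)%:C != 0 by rewrite fmorph_eq0 gt_eqF// rising_gt0.
have g5 : (n`!%:R : R[i]) != 0 by rewrite pnatr_eq0 -lt0n fact_gt0.
rewrite /hyp_coeff /binomial_coeff !(rmorphM, fmorphV)/=.
field.
by rewrite g2 g5 g1/=; apply/andP; split; [exact: g3|exact: g4].
Qed.

Lemma hyp_coeff_rBeta (a b c s : R) n : 0 < b -> b <= c -> 0 < s ->
  `|hyp_coeff a b c n| * rBeta (c + n%:R) s =
  `|Re (beta_ratio b c s%:C)| * (`|binomial_coeff a n| * rBeta (b + n%:R) (s + (c - b))).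
Proof.
move=> b0 bc s0.
have : (hyp_coeff a b c n * rBeta (c + n%:R) s)%:C =
    beta_ratio b c s%:C * (binomial_coeff a n * rBeta (b + n%:R) (s + (c - b)))%:C.
  have M (x y : R) : (x * y)%:C = x%:C * y%:C by rewrite rmorphM.
  by rewrite M [in RHS]M -!Beta_real rmorphD hyp_coeff_Beta.
move: (beta_ratio _ _ _) => K; rewrite [in X in _ = X]mulrC => /(congr1 Re).
rewrite Re_realM -[LHS]/(hyp_coeff a b c n * rBeta (c + n%:R) s) => /(congr1 Num.norm).
by rewrite !normrM !(ger0_norm (rBeta_ge0 _ _)) => ->; rewrite mulrC.
Qed.

End GaussSum.

(** * The moments of the hypergeometric kernel *)

Section KernelMoment.
Local Set Implicit Arguments.
Local Unset Strict Implicit.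
Local Open Scope classical_set_scope.
Context {R : realType}.
Local Notation mu := (@lebesgue_measure R).
Local Notation Re := (@complex.Re R).
Local Notation Im := (@complex.Im R).
Local Notation I01 := (`]0%R : R, 1%R[%classic).

Let mI : measurable I01. Proof. by []. Qed.

Lemma continuous_powR (p x : R) : 0 < x -> {for x, continuous (fun x => x `^ p)}.
Proof.
by move=> x0; apply/differentiable_continuous/derivable1_diffP; have [] := @is_derive1_powR R p x x0.
Qed.

Lemma continuous01_beta p (s : R[i]) :
  continuous01 (fun r => Re (beta_integrand p s r)) /\
  continuous01 (fun r => Im (beta_integrand p s r)).
Proof.
have co : continuous01 (onem_powR p).
  move=> r /andP[r0 r1]; apply: (continuous_comp (g := fun x : R => x `^ (p - 1))).
    by apply: continuousB; [exact: cst_continuous|exact: cvg_id].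
  by apply: continuous_powR; rewrite subr_gt0.
have cl (r : R) : 0 < r -> {for r, continuous (fun r : R => Im (s - 1) * ln r)}.
  by move=> r0; apply: continuousM; [exact: cst_continuous|exact: continuous_ln].
have rE : (fun r => Re (beta_integrand p s r)) =
    (fun r => r `^ Re (s - 1) * cos (Im (s - 1) * ln r) * onem_powR p r).
  by apply/funext => r; rewrite /beta_integrand mulrC Re_realM Re_cpow mulrC.
have iE : (fun r => Im (beta_integrand p s r)) =
    (fun r => r `^ Re (s - 1) * sin (Im (s - 1) * ln r) * onem_powR p r).
  by apply/funext => r; rewrite /beta_integrand mulrC Im_realM Im_cpow mulrC.
split; [rewrite rE|rewrite iE] => r r01; have /andP[r0 r1] := r01;
  apply: continuousM; last 1 first; try exact: co;
  apply: continuousM; try exact: continuous_powR.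
- by apply: (continuous_comp (cl _ r0)); exact: continuous_cos.
- by apply: (continuous_comp (cl _ r0)); exact: continuous_sin.
Qed.

Definition sqr_beta_integrand (p : R) (s : R[i]) (r : R) : R[i] :=
  cpow r (s - 1) * (onem_powR p (r ^+ 2))%:C.

Lemma cmeasurable_sqr_beta p s : cmeasurable setT (sqr_beta_integrand p s).
Proof.
apply: cmeasurableM; first exact: cmeasurable_cpow.
apply: cmeasurable_real; apply: (measurableT_comp (measurable_onem_powR p)).
exact: exprn_measurable.
Qed.

Lemma sqr_beta p (s : R[i]) : 0 < p -> 0 < Re s ->
  cintegrable I01 (sqr_beta_integrand p s) /\
  cintegral I01 (sqr_beta_integrand p s) = (1 / 2)%:C * Beta p (s / 2).
Proof.
move=> p0 s0.
have s20 : 0 < Re (s / 2).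
  have -> : s / 2 = (2^-1)%:C * s by rewrite mulrC fmorphV rmorph_nat.
  by rewrite Re_realM mulr_gt0.
have sE : s - 1 = 1 + (s / 2 - 1) + (s / 2 - 1).
  by rewrite [X in X - 1](_ : s = s / 2 + s / 2); [ring|field].
have gE (r : R) : 0 < r < 1 -> (2 * r)%:C * beta_integrand p (s / 2) (r ^+ 2) =
    2%:C * sqr_beta_integrand p s r.
  move=> /andP[r0 r1]; rewrite /beta_integrand /sqr_beta_integrand expr2 cpowM// sE !cpowD// cpow1//.
  by rewrite rmorphM/=; ring.
have [c1 c2] := continuous01_beta p (s / 2).
have ib := cintegrable_beta p0 s20.
have [||i e] := ccov (@lattice_closed_continuous01 R) mI cov_sqr _ c1 c2 _ ib.
- by move=> r; rewrite itv01E => /andP[r0 _]; rewrite mulr_ge0// ltW.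
- apply: (eq_cmeasurable (f := fun r => 2%:C * sqr_beta_integrand p s r)).
    by move=> r; rewrite itv01E => r01; rewrite gE.
  apply: cmeasurableM; first exact: cmeasurable_cst.
  by apply: cmeasurableS (cmeasurable_sqr_beta p s).
have EQ r : I01 r -> (1 / 2)%:C * ((2 * r)%:C * beta_integrand p (s / 2) (r ^+ 2)) =
    sqr_beta_integrand p s r.
  rewrite itv01E => r01; rewrite gE// mulrA -rmorphM/=.
  by rewrite mul1r mulVf ?pnatr_eq0// mul1r.
split; first exact: (eq_cintegrable mI EQ (cintegrableZ _ mI i)).
by rewrite -(eq_cintegral EQ) (cintegralZ _ mI i) -e.
Qed.

Context (a b c : R) (a_gtN1 : -1 < a) (b_gt0 : 0 < b) (b_le_c : b <= c).

Let c0 : 0 < c. Proof. exact: lt_le_trans b_le_c. Qed.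

Lemma sqr01 (r : R) : 0 < r < 1 -> 0 < r ^+ 2 < 1.
Proof. by move=> /andP[r0 r1]; rewrite exprn_gt0//= expr_lt1// ltW. Qed.

Lemma sqr_betaX p (s : R[i]) (r : R) n : I01 r ->
  sqr_beta_integrand (p + n%:R) s r = ((1 - r ^+ 2) ^+ n)%:C * sqr_beta_integrand p s r.
Proof.
rewrite itv01E => /sqr01 r01; rewrite /sqr_beta_integrand -onem_powRX// rmorphM/=; ring.
Qed.

Lemma measurable_hyp_abs : measurable_fun I01 (fun r => hyp_abs a b c (1 - r ^+ 2)).
Proof.
have mN N : measurable_fun I01 (fun r => series (fun n => `|hyp_coeff a b c n| * (1 - r ^+ 2) ^+ n) N).
  apply: measurable_sum => n; apply: measurable_funM => //.
  by apply: measurable_funX; apply: measurable_funB => //; exact: exprn_measurable.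
apply: (measurable_fun_cvg mN) => r; rewrite itv01E => /sqr01 r01.
by have [] := hyp_absP a_gtN1 b_gt0 b_le_c r01.
Qed.

(** The moment of the absolute series is, term by term, a multiple of the absolute
    Gauss series, which is bounded. *)
Lemma integrable_hyp_abs (s : R) : 0 < s -> 0 < s / 2 + (c - b) - a ->
  mu.-integrable I01 (fun r => (hyp_abs a b c (1 - r ^+ 2) * (r `^ (s - 1) * onem_powR c (r ^+ 2)))%:E).
Proof.
move=> s0 sa; have s20 : 0 < s / 2 by rewrite divr_gt0.
have cb : 0 <= c - b by rewrite subr_ge0.
have scb : 0 < s / 2 + (c - b) by rewrite ltr_wpDr.
have [M HM] := gauss_abs_bound a_gtN1 b_gt0 scb sa.
pose w (p r : R) : R := r `^ (s - 1) * onem_powR p (r ^+ 2).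
have cn n : 0 < c + n%:R by rewrite ltr_wpDr.
have wE p : sqr_beta_integrand p s%:C = (fun r => (w p r)%:C).
  apply/funext => r; rewrite /sqr_beta_integrand -[1%R]/((1:R)%:C) -rmorphB/= cpow_real.
  by rewrite -rmorphM.
have iw p : 0 < p -> mu.-integrable I01 (fun r => (w p r)%:E) /\
    \int[mu]_(r in I01) w p r = 1 / 2 * rBeta p (s / 2).
  move=> p0; have [[ir _]] := @sqr_beta p s%:C p0 s0; move: ir; rewrite wE => ir.
  have -> : s%:C / 2 = (s / 2)%:C by rewrite rmorphM fmorphV/= rmorph_nat.
  rewrite cintegral_real Beta_real -rmorphM/= => /complexI ->; split => //.
have wX n r : I01 r -> w (c + n%:R) r = (1 - r ^+ 2) ^+ n * w c r.
  by move=> h; have := sqr_betaX c s%:C n h; rewrite !wE -rmorphM => /complexI.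
pose u n r := `|hyp_coeff a b c n| * w (c + n%:R) r.
apply: (@integrable_series_le _ _ u _ (`|Re (beta_ratio b c (s / 2)%:C)| * (1 / 2) * M)) => //.
- by move=> n; apply: integrable_mull => //; exact: (iw _ (cn n)).1.
- by move=> n r _; rewrite mulr_ge0// mulr_ge0 ?powR_ge0.
- move=> r h; have r01 : 0 < r ^+ 2 < 1 by apply: sqr01; rewrite -itv01E.
  have [H _ _] := hyp_absP a_gtN1 b_gt0 b_le_c r01.
  have -> : series (u ^~ r) = (fun N => series (fun n => `|hyp_coeff a b c n| * (1 - r ^+ 2) ^+ n) N * w c r).
    apply/funext => N; rewrite /series/= mulr_suml; apply: eq_bigr => n _.
    by rewrite /u wX// mulrA.
  by apply: cvgM => //; exact: cvg_cst.
move=> N.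
have -> : series (fun n => \int[mu]_(r in I01) u n r) N =
   `|Re (beta_ratio b c (s / 2)%:C)| * (1 / 2) *
   series (fun n => `|binomial_coeff a n| * rBeta (b + n%:R) (s / 2 + (c - b))) N.
  rewrite /series/= mulr_sumr; apply: eq_bigr => n _.
  rewrite RintegralZl//; last exact: (iw _ (cn n)).1.
  by rewrite (iw _ (cn n)).2 mulrCA hyp_coeff_rBeta//; ring.
by rewrite ler_wpM2l// mulr_ge0.
Qed.

(** The series of moments is a multiple of the one of [gauss_sum] with
    [d = s / 2 + (c - b)]; the [Gamma b] of [beta_ratio] cancels against that of
    [Beta b (d - a)]. *)
Lemma hyp_moment (s : R[i]) : 0 < Re s -> 0 < Re s / 2 + (c - b) - a ->
  cintegrable I01 (fun r => (hyp2F1 a b c (1 - r ^+ 2))%:C * sqr_beta_integrand c s r) /\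
  cintegral I01 (fun r => (hyp2F1 a b c (1 - r ^+ 2))%:C * sqr_beta_integrand c s r) =
  (1 / 2)%:C * (Gamma c%:C * Gamma (s / 2) * Gamma (s / 2 + (c - b)%:C - a%:C) /
    (Gamma (s / 2 + (c - b)%:C) * Gamma (s / 2 + (c - a)%:C))).
Proof.
move=> s0 sa.
have cn n : 0 < c + n%:R by rewrite ltr_wpDr.
have cb : 0 <= c - b by rewrite subr_ge0.
have Re2 : Re (s / 2) = Re s / 2.
  have -> : s / 2 = (2^-1)%:C * s by rewrite mulrC fmorphV rmorph_nat.
  by rewrite Re_realM mulrC.
have s20 : 0 < Re (s / 2) by rewrite Re2 divr_gt0.
have scb : 0 < Re (s / 2 + (c - b)%:C) by rewrite Re_addc/= ltr_wpDr.
have scba : 0 < Re (s / 2 + (c - b)%:C - a%:C) by rewrite !Re_addc Re_oppc/= Re2.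
have mW := cmeasurable_sqr_beta c s.
have [|||||i H] := @termwise_integral R I01 (sqr_beta_integrand c s) (hyp_coeff a b c)
  (fun r => 1 - r ^+ 2) (fun r => hyp2F1 a b c (1 - r ^+ 2)) (fun r => hyp_abs a b c (1 - r ^+ 2)) mI.
- exact: cmeasurableS mW.
- by move=> r; rewrite itv01E => /sqr01 r01; have [] := hyp2F1P a_gtN1 b_gt0 b_le_c r01.
- by move=> r N; rewrite itv01E => /sqr01 r01; have [_ h _] := hyp2F1P a_gtN1 b_gt0 b_le_c r01.
- apply: le_integrable (integrable_mull 2 mI (integrable_hyp_abs s0 sa)) => //.
    apply: measurable_EFin; apply: measurable_funM; first exact: measurable_hyp_abs.
    by apply: measurable_abs1; apply: cmeasurableS mW.
  move=> r; rewrite itv01E => r01; rewrite lee_fin.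
  have h0 := hyp_abs_ge0 a_gtN1 b_gt0 b_le_c (sqr01 r01).
  rewrite normrM !ger0_norm ?abs1_ge0// ?mulr_ge0 ?powR_ge0// mulrCA ler_wpM2l//.
  rewrite (le_trans (abs1_cpowM _ _ _))// Re_addc Re_oppc /abs1/= normr0 addr0.
  by rewrite ger0_norm ?powR_ge0// mulrA.
- move=> n; apply: (eq_cintegrable mI (fun r h => sqr_betaX c s n h)).
  by have [] := sqr_beta (cn n) s0.
split => //; apply: (ccvg_unique H).
have G := ccvgZ ((1 / 2)%:C * beta_ratio b c (s / 2)) (gauss_sum a_gtN1 b_gt0 scb scba).
have -> : (1 / 2)%:C * (Gamma c%:C * Gamma (s / 2) * Gamma (s / 2 + (c - b)%:C - a%:C) /
    (Gamma (s / 2 + (c - b)%:C) * Gamma (s / 2 + (c - a)%:C))) =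
    (1 / 2)%:C * beta_ratio b c (s / 2) * Beta b (s / 2 + (c - b)%:C - a%:C).
  rewrite Beta_GammaE// /beta_ratio.
  have -> : s / 2 + (c - b)%:C - a%:C + b%:C = s / 2 + (c - a)%:C.
    by rewrite !rmorphB/=; ring.
  have gb : Gamma b%:C != 0 by apply: Gamma_neq0.
  have g1 := Gamma_neq0 scb.
  have g2 : Gamma (s / 2 + (c - a)%:C) != 0.
    apply: Gamma_neq0; rewrite Re_addc/= Re2.
    by move: sa b_gt0; lra.
  move: gb g1 g2; move: (Gamma b%:C) (Gamma (s / 2 + (c - b)%:C)) (Gamma (s / 2 + (c - a)%:C)).
  move: (Gamma (s / 2 + (c - b)%:C - a%:C)) (Gamma c%:C) (Gamma (s / 2)) => x1 x2 x3 x4 x5 x6 n4 n5 n6.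
  by field; rewrite n4 n5 n6.
move: G; congr (ccvg _ _); apply/funext => N.
rewrite /series/= mulr_sumr; apply: eq_bigr => n _.
rewrite -(eq_cintegral (fun r h => sqr_betaX c s n h)).
have [_ ->] := sqr_beta (cn n) s0.
by rewrite [RHS]mulrCA hyp_coeff_Beta// [RHS]mulrA.
Qed.

End KernelMoment.

(** * Pointwise growth of the kernel *)

Section BesselKernel.
Local Set Implicit Arguments.
Local Unset Strict Implicit.
Local Open Scope classical_set_scope.
Context {R : realType}.
Local Notation mu := (@lebesgue_measure R).
Local Notation P := (`]0%R : R, +oo[%classic).
Local Notation I01 := (`]0%R : R, 1%R[%classic).

Let mP : measurable P. Proof. by []. Qed.
Let mI : measurable I01. Proof. by []. Qed.
Let IP : I01 `<=` P.
Proof. by move=> x; rewrite itv_oyE itv01E => /andP[]. Qed.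

Lemma powR_pred_le (p w : R) : 0 < p -> 1 / 2 <= w <= 1 -> w `^ (p - 1) <= 2.
Proof.
move=> p0 /andP[w2 w1]; have w0 : 0 < w by apply: lt_le_trans w2; rewrite divr_gt0.
rewrite powRB ?(gt_eqF w0) ?implybT// powRr1 ?(ltW w0)// ler_pdivrMr//.
apply: (@le_trans _ _ 1); last by lra.
by rewrite -(powRr0 w) ger_powR ?w0// ltW.
Qed.

Lemma powR_pred_ge (p w : R) : 0 < p -> 1 / 2 <= w <= 1 -> (1 / 2) `^ p <= w `^ (p - 1).
Proof.
move=> p0 /andP[w2 w1]; have w0 : 0 < w by apply: lt_le_trans w2; rewrite divr_gt0.
apply: (@le_trans _ _ (w `^ p)).
  by apply: ge0_ler_powR => //; rewrite ?nnegrE ?(ltW p0) ?(ltW w0)// divr_ge0.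
by apply: ger_powR; [rewrite w0|lra].
Qed.

Lemma powR_half (c y : R) : 0 <= y -> (y / 2) `^ (c - 1) = 2 `^ (1 - c) * y `^ (c - 1).
Proof.
move=> y0; rewrite powRM ?invr_ge0// mulrC; congr (_ * _).
by rewrite -(@powR_inv1 _ 2)// -powRrM mulN1r opprB.
Qed.

Section hypergeometric_kernel.
Context (a b c : R) (a_gtN1 : -1 < a) (b_gt0 : 0 < b) (b_le_c : b <= c).

Let c0 : 0 < c. Proof. exact: lt_le_trans b_le_c. Qed.

(** As [hyp_abs a b c (1 - r ^+ 2)] is nonincreasing in [r], its value at [r] is at most
    its values on [[r / 2, r]], where the other factor of the convergent
    integral is at least a constant times [r `^ (s - 1)]; the interval has length
    [r / 2], so that the value times [r `^ s] is bounded. *)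
Lemma hyp_abs_le_powR (s : R) : 0 < s -> 0 < s / 2 + (c - b) - a ->
  exists A, 0 <= A /\ forall r : R, 0 < r <= 1 / 2 -> hyp_abs a b c (1 - r ^+ 2) <= A * r `^ (- s).
Proof.
move=> s0 sa; have iH := integrable_hyp_abs a_gtN1 b_gt0 b_le_c s0 sa.
pose g r := hyp_abs a b c (1 - r ^+ 2) * (r `^ (s - 1) * onem_powR c (r ^+ 2)).
have g0 r : I01 r -> 0 <= g r.
  rewrite itv01E => r01; rewrite mulr_ge0 ?mulr_ge0 ?powR_ge0//.
  by apply: hyp_abs_ge0 => //; exact: sqr01.
pose M := \int[mu]_(r in I01) g r.
have M0 : 0 <= M by apply: Rintegral_ge0.
pose k : R := 2^-1 * (2^-1 `^ s * (1 / 2) `^ c).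
have k0 : 0 < k by rewrite !mulr_gt0 ?powR_gt0// divr_gt0.
(* [k] collects the factors lost in passing from the integral to the value at [r]:
   the length of [[r / 2, r]] relative to [r], and lower bounds for the two weights
   there. *)
exists (M / k); split; first by rewrite divr_ge0// ltW.
move=> r /andP[r0 r2]; have r1 : r < 1 by lra.
have r01 : 0 < r < 1 by rewrite r0.
rewrite powRN ler_pdivlMr ?powR_gt0// ler_pdivlMr// -mulrA.
set H := hyp_abs _ _ _ _.
have H0 : 0 <= H by apply: hyp_abs_ge0 => //; exact: sqr01.
pose m := H * ((r / 2) `^ s / r * (1 / 2) `^ c).
have n0 : 0 <= (r / 2) `^ s / r * (1 / 2) `^ c.
  by rewrite mulr_ge0 ?powR_ge0// divr_ge0 ?powR_ge0// ltW.
have m0 : 0 <= m by rewrite mulr_ge0.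
pose J : set R := `[r / 2, r].
have mJ : measurable J by rewrite /J.
have JI : J `<=` I01.
  by move=> y; rewrite itv01E /J/= in_itv/= => /andP[y1 y2]; apply/andP; split; lra.
have -> : H * (r `^ s * k) = m * (r / 2).
  rewrite /m /k powRM ?(ltW r0)//; field; by rewrite gt_eqF.
rewrite -lee_fin /M /Rintegral fineK; last exact: integrable_fin_num.
apply: (@le_trans _ _ (\int[mu]_(y in J) m%:E)%E).
  have muJ : mu J = (r / 2)%:E.
    rewrite /J lebesgue_measure_itv/= lte_fin ifT; last by lra.
    by rewrite -EFinB; congr EFin; lra.
  by rewrite integral_cst//= muJ -EFinM.
apply: (@le_trans _ _ (\int[mu]_(y in J) (g y)%:E)%E); last first.
  apply: ge0_subset_integral => //; first exact: measurable_int iH.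
apply: ge0_le_integral => //.
- exact: measurable_funS JI (measurable_int _ iH).
- move=> y h; have := JI y h; rewrite itv01E => y01; have /andP[y0 y1] := y01.
  move: h; rewrite /J/= in_itv/= => /andP[yr1 yr2].
  rewrite lee_fin /m /g; apply: ler_pM => //.
  + apply: hyp_abs_le => //; first by rewrite exprn_gt0.
      by rewrite lerXn2r ?nnegrE// ltW.
    by have /andP[] := sqr01 r01.
  apply: ler_pM; rewrite ?powR_ge0 ?divr_ge0 ?powR_ge0 ?(ltW r0)//.
    rewrite powRB ?(gt_eqF y0) ?implybT// powRr1 ?(ltW y0)//.
    apply: ler_pM; rewrite ?powR_ge0 ?invr_ge0 ?(ltW r0)//.
      by apply: ge0_ler_powR; rewrite ?nnegrE ?(ltW s0) ?(ltW y0)// divr_ge0// ltW.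
    by rewrite lef_pV2.
  apply: powR_pred_ge => //; apply/andP; split; last by rewrite gerBl exprn_ge0// ltW.
  have : y ^+ 2 <= (1 / 2) ^+ 2 by rewrite lerXn2r ?nnegrE//; lra.
  by rewrite expr2; lra.
Qed.

Definition hyp_kernel : R -> R :=
  restrict01 (fun r => hyp2F1 a b c (1 - r ^+ 2) * onem_powR c (r ^+ 2)).

Lemma measurable_hyp_kernel : measurable_fun setT hyp_kernel.
Proof.
apply: measurable_restrict01; apply: measurable_funM; last first.
  apply: measurable_funTS; apply: (measurableT_comp (measurable_onem_powR c)).
  exact: exprn_measurable.
have mN N : measurable_fun I01 (fun r => series (fun n => hyp_coeff a b c n * (1 - r ^+ 2) ^+ n) N).
  apply: measurable_sum => n; apply: measurable_funM => //.
  by apply: measurable_funX; apply: measurable_funB => //; exact: exprn_measurable.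
apply: (measurable_fun_cvg mN) => r; rewrite itv01E => /sqr01 r01.
by have [] := hyp2F1P a_gtN1 b_gt0 b_le_c r01.
Qed.

Lemma norm_hyp_kernel_le (r : R) : 0 < r < 1 ->
  `|hyp_kernel r| <= hyp_abs a b c (1 - r ^+ 2) * onem_powR c (r ^+ 2).
Proof.
move=> r01; rewrite /hyp_kernel restrict01_in// normrM.
rewrite [X in _ * X]ger0_norm ?powR_ge0// ler_wpM2r ?powR_ge0//.
by have [] := hyp2F1P a_gtN1 b_gt0 b_le_c (sqr01 r01).
Qed.

Lemma integrable_hyp_kernel (s : R) : 0 < s -> 0 < s / 2 + (c - b) - a ->
  mu.-integrable P (fun r => (r `^ (s - 1) * hyp_kernel r)%:E).
Proof.
move=> s0 sa; apply/(@integrable_subset0 _ I01 P) => //.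
  by move=> r _; rewrite itv01E => /negP r01; rewrite /hyp_kernel restrict01_out// mulr0.
apply: le_integrable (integrable_hyp_abs a_gtN1 b_gt0 b_le_c s0 sa) => //.
  apply: measurable_EFin; apply: measurable_funM; last exact: measurable_funTS measurable_hyp_kernel.
  by apply: measurable_funTS; exact: measurable_powR.
move=> r; rewrite itv01E => r01; rewrite lee_fin (le_trans _ (ler_norm _))//.
rewrite normrM (ger0_norm (powR_ge0 _ _)) mulrCA ler_wpM2l ?powR_ge0//.
exact: norm_hyp_kernel_le.
Qed.

(** For [y <= 2 x] the bound is the translated Gamma integrand, which has the same
    singularity [(y - x) `^ (c - 1)] as the kernel and is already known to be
    integrable. For [y > 2 x], where [r = x / y < 1 / 2], [hyp_abs_le_powR] applies. *)
Lemma cintegrable_hyp_kernel (f : R -> R[i]) (s x : R) :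
  0 < s -> 0 < s / 2 + (c - b) - a -> 0 < x ->
  (forall y, 0 < y -> {for y, continuous (fun y => abs1 (f y))}) ->
  cmeasurable P f -> mu.-integrable P (fun y => (y `^ (c - 1 + s) * abs1 (f y))%:E) ->
  cintegrable `]x, +oo[ (fun y => (hyp_kernel (x / y))%:C * (((y / 2) `^ (c - 1))%:C * f y)).
Proof.
move=> s0 sa x0 cf mf If.
have [A [A0 HA]] := hyp_abs_le_powR s0 sa.
pose D : set R := `]x, +oo[; have mD : measurable D by rewrite /D.
have DE y : D y = (x < y) :> Prop by rewrite /D /= in_itv/= andbT.
have DP : D `<=` P by move=> y; rewrite itv_oyE DE; exact: lt_trans.
have [Mf HMf] : exists Mf, forall y, x <= y <= 2 * x -> abs1 (f y) <= Mf.
  have cw : {within `[x, 2 * x], continuous (fun y => abs1 (f y))}.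
    apply: continuous_in_subspaceT => y; rewrite inE/= in_itv/= => /andP[xy _].
    by apply: cf; exact: lt_le_trans xy.
  have x2 : x <= 2 * x by lra.
  have [z _ Hz] := EVT_max x2 cw.
  by exists (abs1 (f z)) => y xy; apply: Hz; rewrite in_itv.
have Mf0 : 0 <= Mf by apply: le_trans (HMf x _); rewrite ?abs1_ge0// lexx/=; lra.
pose q (t : R) := t `^ (c - 1) * expR (- t).
have iq : mu.-integrable D (fun y => (q (y + - x))%:E).
  have ig := integrable_gamma c0.
  have pre : ((fun y : R => y + - x) @^-1` P)%classic = D.
    by rewrite /D; apply/seteqP; split => y; rewrite /= !in_itv/= !andbT subr_gt0.
  have mq : measurable_fun P q by apply/measurable_EFinP; exact: measurable_int ig.
  have q0 y : 0 <= q y by rewrite mulr_ge0 ?powR_ge0 ?expR_ge0.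
  apply/integrableP; split.
    apply: measurable_EFin; apply: (@measurable_comp _ _ _ _ _ _ P q) => //.
    + by move=> _ [y + <-]; rewrite DE itv_oyE subr_gt0.
    + by apply: measurable_funD.
  have -> : (\int[mu]_(y in D) `|(q (y + - x))%:E| = \int[mu]_(y in D) (q (y + - x))%:E)%E.
    by apply: eq_integral => y _; rewrite /= ger0_norm.
  have := @ge0_integral_shift R (- x) P (EFin \o q) mP.
  rewrite pre => ->.
  - exact: integrable_lty ig.
  - exact/measurable_EFinP.
  - by move=> y _; rewrite lee_fin.
(* [1 / 4] is the least value of [(x / y) ^+ 2] for [y <= 2 * x]. *)
pose H0 := hyp_abs a b c (1 - 1 / 4).
have H00 : 0 <= H0 by apply: hyp_abs_ge0 => //; lra.
(* [expR x] compensates for the decay of the Gamma integrand, as [y - x <= x]. *)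
pose C1 := 2 * H0 * Mf * expR x.
pose C2 := 2 * A * x `^ (- s) * 2 `^ (1 - c).
pose g y := C1 * q (y + - x) + C2 * (y `^ (c - 1 + s) * abs1 (f y)).
have C10 : 0 <= C1 by rewrite !mulr_ge0 ?expR_ge0.
have C20 : 0 <= C2 by rewrite !mulr_ge0 ?powR_ge0.
have q0 y : 0 <= q y by rewrite mulr_ge0 ?powR_ge0 ?expR_ge0.
apply: (@cintegrable_le _ D _ g) => //.
- apply: cmeasurableM.
    apply: cmeasurable_real; apply: measurable_funS mP DP _.
    exact: measurable_div_snd measurable_hyp_kernel.
  apply: cmeasurableM; last exact: cmeasurableS DP mf.
  apply: cmeasurable_real; apply: measurable_funTS.
  by apply: (measurableT_comp (measurable_powR (c - 1))); apply: measurable_funM.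
- move=> y; rewrite DE => xy; have y0 : 0 < y by exact: lt_trans xy.
  pose r := x / y.
  have r0 : 0 < r by rewrite divr_gt0.
  have r1 : r < 1 by rewrite ltr_pdivrMr// mul1r.
  have r01 : 0 < r < 1 by rewrite r0.
  have ry : x = r * y by rewrite divfK// gt_eqF.
  rewrite !abs1_real (ger0_norm (powR_ge0 _ _)) -/r.
  have := norm_hyp_kernel_le r01; set H := hyp_abs _ _ _ _ => Hk.
  have HH : 0 <= H by apply: hyp_abs_ge0 => //; exact: sqr01.
  apply: (@le_trans _ _ (H * onem_powR c (r ^+ 2) * ((y / 2) `^ (c - 1) * abs1 (f y)))).
    by rewrite ler_wpM2r// mulr_ge0 ?powR_ge0 ?abs1_ge0.
  have [yx2|yx2] := leP y (2 * x).
    apply: (@le_trans _ _ (C1 * q (y + - x))); last first.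
      by rewrite lerDl mulr_ge0// mulr_ge0 ?powR_ge0 ?abs1_ge0.
    have r2 : 1 / 2 <= r by rewrite ler_pdivlMr//; lra.
    have HH0 : H <= H0.
      apply: hyp_abs_le => //; last by have /andP[] := sqr01 r01.
      have : (1 / 2) ^+ 2 <= r ^+ 2 by rewrite lerXn2r ?nnegrE//; lra.
      by rewrite expr2; lra.
    have -> : H * onem_powR c (r ^+ 2) * ((y / 2) `^ (c - 1) * abs1 (f y)) =
      H * ((1 / 2 * (1 + r)) `^ (c - 1)) * abs1 (f y) * (y - x) `^ (c - 1).
      have e : onem_powR c (r ^+ 2) * (y / 2) `^ (c - 1) =
          (1 / 2 * (1 + r)) `^ (c - 1) * (y - x) `^ (c - 1).
        rewrite /onem_powR -!powRM.
        - by rewrite (_ : y - x = (1 - r) * y); [congr (_ `^ _); field|rewrite mulrBl mul1r -ry].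
        - by rewrite mulr_ge0//; lra.
        - by lra.
        - by rewrite subr_ge0 exprn_ile1// ltW.
        - by rewrite divr_ge0// ltW.
      transitivity (H * (onem_powR c (r ^+ 2) * (y / 2) `^ (c - 1)) * abs1 (f y)); first by ring.
      by rewrite e; ring.
    rewrite (_ : C1 * q (y + - x) =
        H0 * 2 * Mf * ((y - x) `^ (c - 1) * (expR x * expR (- (y - x))))); last first.
      by rewrite /C1 /q; ring.
    have yx0 : 0 <= (y - x) `^ (c - 1) by rewrite powR_ge0.
    have e1 : 1 <= expR x * expR (- (y - x)).
      by rewrite -expRD -[leLHS]expR0 ler_expR; lra.
    apply: ler_pM; rewrite ?mulr_ge0 ?powR_ge0 ?abs1_ge0//; last by rewrite ler_peMr.
    apply: ler_pM; rewrite ?mulr_ge0 ?powR_ge0 ?abs1_ge0//; last first.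
      by apply: HMf; rewrite yx2 ltW.
    apply: ler_pM; rewrite ?powR_ge0//.
    by apply: powR_pred_le => //; lra.
  apply: (@le_trans _ _ (C2 * (y `^ (c - 1 + s) * abs1 (f y)))); last first.
    by rewrite lerDr mulr_ge0.
  have r2 : r <= 1 / 2 by rewrite ler_pdivrMr//; lra.
  have HA' : H <= A * r `^ (- s) by apply: HA; rewrite r0.
  have o2 : onem_powR c (r ^+ 2) <= 2.
    apply: powR_pred_le => //.
    have : r ^+ 2 <= (1 / 2) ^+ 2 by rewrite lerXn2r ?nnegrE//; lra.
    by have := sqr_ge0 r; rewrite !expr2; lra.
  have rs : r `^ (- s) = x `^ (- s) * y `^ s.
    rewrite /r powRM ?invr_ge0 ?(ltW x0) ?(ltW y0)//.
    by rewrite -(powR_inv1 (ltW y0)) -powRrM mulN1r opprK.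
  rewrite (_ : C2 * _ = A * r `^ (- s) * 2 * ((y / 2) `^ (c - 1) * abs1 (f y))); last first.
    by rewrite rs powR_half ?(ltW y0)// /C2 powRD ?(gt_eqF y0) ?implybT//; ring.
  apply: ler_pM; rewrite ?mulr_ge0 ?powR_ge0 ?abs1_ge0//.
  by apply: ler_pM; rewrite ?powR_ge0.
- apply: integrable_add => //; apply: integrable_mull => //.
  exact: integrableS If.
Qed.

End hypergeometric_kernel.

End BesselKernel.

(** * The Bessel integral as a multiplicative convolution *)

Section MellinBessel.
Local Set Implicit Arguments.
Local Unset Strict Implicit.
Local Open Scope classical_set_scope.
Context {R : realType}.
Local Notation mu := (@lebesgue_measure R).
Local Notation Re := (@complex.Re R).
Local Notation P := (`]0%R : R, +oo[%classic).
Local Notation I01 := (`]0%R : R, 1%R[%classic).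

Let mP : measurable P. Proof. by []. Qed.
Let mI : measurable I01. Proof. by []. Qed.

Lemma real_Cn_pos_continuous n (g : R -> R) (y : R) :
  real_Cn_pos n.+1 g -> 0 < y -> {for y, continuous g}.
Proof.
move=> [dg _] y0; apply: differentiable_continuous; apply/derivable1_diffP.
exact: (dg 0%N).
Qed.

Lemma Cn_pos_abs1_continuous n (f : R -> R[i]) (y : R) :
  Cn_pos n.+1 f -> 0 < y -> {for y, continuous (fun y => abs1 (f y))}.
Proof.
move=> [fr fi] y0; apply: continuousD; apply: continuous_comp; try exact: norm_continuous.
- exact: real_Cn_pos_continuous fr y0.
- exact: real_Cn_pos_continuous fi y0.
Qed.

Lemma Cn_pos_cmeasurable n (f : R -> R[i]) : Cn_pos n.+1 f -> cmeasurable P f.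
Proof.
move=> [fr fi]; split; apply: open_continuous_measurable_fun;
  try (exact: interval_open); move=> y; rewrite inE itv_oyE => y0.
- exact: real_Cn_pos_continuous fr y0.
- exact: real_Cn_pos_continuous fi y0.
Qed.

Section convolution_form.
Context (nu alpha : R) (nu_ge0 : 0 <= nu) (alpha_gt0 : 0 < alpha).

Let c : R := 2 * alpha.
Let a : R := alpha + (nu - 1) / 2.
Let k := hyp_kernel a alpha c.

Let a1 : -1 < a.
Proof. by have [nu0 al0] := (nu_ge0, alpha_gt0); rewrite /a; lra. Qed.
Let bc : alpha <= c.
Proof. by have al0 := alpha_gt0; rewrite /c; lra. Qed.

(** Homogeneity: [(y ^+ 2 - x ^+ 2) / (2 * y)] is [(1 - (x / y) ^+ 2) * (y / 2)]. *)
Lemma bessel_kernelE (x y : R) : 0 < x < y ->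
  bessel_kernel nu alpha x y = hyp_kernel a alpha c (x / y) * (y / 2) `^ (c - 1).
Proof.
move=> /andP[x0 xy]; have y0 : 0 < y by exact: lt_trans xy.
have r01 : 0 < x / y < 1 by rewrite divr_gt0//= ltr_pdivrMr// mul1r.
rewrite /bessel_kernel /hyp_kernel restrict01_in// expr_div_n -mulrA [in RHS]mulrC.
rewrite -powRM; last 2 first.
- by rewrite subr_ge0 -expr_div_n exprn_ile1 ?divr_ge0// ltW//; case/andP: r01.
- by rewrite divr_ge0// ltW.
congr (_ `^ _ * _); field; by rewrite gt_eqF.
Qed.

Lemma hyp_kernel_out (x y : R) : 0 < y <= x -> hyp_kernel a alpha c (x / y) = 0.
Proof.
move=> /andP[y0 yx]; rewrite /hyp_kernel restrict01_out//.
by apply/negP => /andP[_]; rewrite ltr_pdivrMr// mul1r ltNge yx.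
Qed.

Lemma bessel_integrandE (f : R -> R[i]) (x y : R) : 0 < x < y ->
  bessel_integrand nu alpha f x y =
  (hyp_kernel a alpha c (x / y))%:C * (((y / 2) `^ (c - 1))%:C * f y).
Proof. by move=> xy; rewrite /bessel_integrand bessel_kernelE// rmorphM/= mulrA. Qed.


Section of_function.
Context (f : R -> R[i]) (s : R[i]) (s_gt0 : 0 < Re s) (s_gt_nu : nu - 1 < Re s).
Context (f_smooth : Cn_pos (Num.truncn c).+1 f) (f_mellin : mellin_cvg f (c%:C + s)).

Let h (y : R) : R[i] := ((y / 2) `^ (c - 1))%:C * f y.

Let sa : 0 < Re s / 2 + (c - alpha) - a.
Proof. by have := s_gt_nu; rewrite /c /a; lra. Qed.

(** The Mellin convergence of [f] at [c + s], freed from the phase of the complex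
    power. *)
Lemma integrable_mellin_weight :
  mu.-integrable P (fun y => (y `^ (c - 1 + Re s) * abs1 (f y))%:E).
Proof.
have I2 := integrable_mull 2 mP (integrable_abs1 mP f_mellin).
apply: le_integrable I2 => //.
  apply: measurable_EFin; apply: measurable_funM.
    by apply: measurable_funTS; exact: measurable_powR.
  exact: measurable_abs1 (Cn_pos_cmeasurable f_smooth).
move=> y; rewrite itv_oyE => y0; rewrite lee_fin (le_trans _ (ler_norm _))//.
rewrite ger0_norm ?mulr_ge0 ?powR_ge0 ?abs1_ge0// /mellin_integrand.
apply: le_trans (abs1_le_cpowM _ _ y0).
by rewrite !Re_addc Re_oppc/= addrAC.
Qed.

Lemma bessel_cvgP (x : R) : 0 < x -> bessel_cvg nu alpha f x.
Proof.
move=> x0; have mD : measurable (`]x, +oo[%classic : set R) by [].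
have cf y : 0 < y -> {for y, continuous (fun y => abs1 (f y))}.
  exact: Cn_pos_abs1_continuous f_smooth.
have := cintegrable_hyp_kernel a1 alpha_gt0 bc s_gt0 sa x0 cf
  (Cn_pos_cmeasurable f_smooth) integrable_mellin_weight.
apply: eq_cintegrable mD _ => y; rewrite /= in_itv/= andbT => xy.
by rewrite bessel_integrandE ?x0.
Qed.

Lemma bessel_integral_half_line (x : R) : 0 < x ->
  cintegrable P (fun y => (k (x / y))%:C * h y) /\
  cintegral P (fun y => (k (x / y))%:C * h y) =
  cintegral `]x, +oo[ (bessel_integrand nu alpha f x).
Proof.
move=> x0; pose D : set R := `]x, +oo[; have mD : measurable D by rewrite /D.
have DE y : D y = (x < y) :> Prop by rewrite /D /= in_itv/= andbT.
have DP : D `<=` P by move=> y; rewrite itv_oyE DE; exact: lt_trans.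
have EQ y : D y -> bessel_integrand nu alpha f x y = (k (x / y))%:C * h y.
  by rewrite DE => xy; rewrite bessel_integrandE ?x0.
have k0 y : P y -> ~ D y -> (k (x / y))%:C * h y = 0.
  rewrite itv_oyE DE => y0 /negP; rewrite -leNgt => yx.
  by rewrite /k hyp_kernel_out ?y0// mul0r.
have [I ->] := cintegral_subset0 mD mP DP k0.
split; last by apply: eq_cintegral => y Dy; rewrite -EQ.
by apply/I; apply: eq_cintegrable mD EQ _; exact: bessel_cvgP.
Qed.

Lemma hyp_kernel_moment : cintegral P (fun r => cpow r (s - 1) * (k r)%:C) =
  (1 / 2)%:C * (Gamma c%:C * Gamma (s / 2) * Gamma (s / 2 - ((nu - 1) / 2)%:C) /
    (Gamma (alpha%:C + s / 2) * Gamma (alpha%:C + s / 2 - ((nu - 1) / 2)%:C))).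
Proof.
have IP : I01 `<=` P by move=> x; rewrite itv_oyE itv01E => /andP[].
have k0 r : P r -> ~ I01 r -> cpow r (s - 1) * (k r)%:C = 0.
  by move=> _; rewrite itv01E => /negP r01; rewrite /k /hyp_kernel restrict01_out// mulr0.
have [_ ->] := cintegral_subset0 mI mP IP k0.
have [_] := hyp_moment a1 alpha_gt0 bc s_gt0 sa.
have e1 : s / 2 + (c - alpha)%:C - a%:C = s / 2 - ((nu - 1) / 2)%:C.
  by rewrite -addrA -rmorphB -rmorphN/=; congr (_ + _%:C); rewrite /c /a; lra.
have e2 : s / 2 + (c - alpha)%:C = alpha%:C + s / 2.
  by rewrite addrC; congr (_%:C + _); rewrite /c; lra.
have e3 : s / 2 + (c - a)%:C = alpha%:C + s / 2 - ((nu - 1) / 2)%:C.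
  by rewrite [RHS]addrAC -rmorphB [LHS]addrC/=; congr (_%:C + _); rewrite /c /a; lra.
rewrite e1 e2 e3 => <-; apply: eq_cintegral => r; rewrite itv01E => r01.
by rewrite /k /hyp_kernel restrict01_in// /sqr_beta_integrand rmorphM/= mulrCA.
Qed.

Lemma mellin_factor y : 0 < y ->
  cpow y s * h y = (2 `^ (1 - c))%:C * mellin_integrand f (c%:C + s) y.
Proof.
move=> y0; rewrite /h powR_half ?(ltW y0)// rmorphM/= -(cpow_real y) /mellin_integrand.
rewrite (_ : c%:C + s - 1 = s + (c - 1)%:C); last by rewrite rmorphB/=; ring.
rewrite cpowD//; ring.
Qed.

Lemma bessel_convolution :
  cintegrable P (fun x => cpow x (s - 1) * cintegral `]x, +oo[ (bessel_integrand nu alpha f x)) /\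
  cintegral P (fun x => cpow x (s - 1) * cintegral `]x, +oo[ (bessel_integrand nu alpha f x)) =
  cintegral P (fun r => cpow r (s - 1) * (k r)%:C) *
  ((2 `^ (1 - c))%:C * mellin f (c%:C + s)).
Proof.
have mf := Cn_pos_cmeasurable f_smooth.
have mh : cmeasurable P h.
  apply: cmeasurableM mf; apply: cmeasurable_real; apply: measurable_funTS.
  by apply: (measurableT_comp (measurable_powR (c - 1))); apply: measurable_funM.
have Ih : mu.-integrable P (fun y => (y `^ Re s * abs1 (h y))%:E).
  apply: eq_integrable (integrable_mull (2 `^ (1 - c)) mP integrable_mellin_weight) => //.
  move=> y /set_mem; rewrite itv_oyE => y0.
  rewrite /h abs1_real ger0_norm ?powR_ge0// powR_half ?(ltW y0)//.
  by rewrite powRD ?(gt_eqF y0) ?implybT//; congr EFin; ring.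
have [I E] := mellin_convolution (measurable_hyp_kernel a1 alpha_gt0 bc) mh
  (integrable_hyp_kernel a1 alpha_gt0 bc s_gt0 sa) Ih
  (fun x x0 => (bessel_integral_half_line x0).1).
have EQ x : P x -> cpow x (s - 1) * cintegral P (fun y => (k (x / y))%:C * h y) =
    cpow x (s - 1) * cintegral `]x, +oo[ (bessel_integrand nu alpha f x).
  by rewrite itv_oyE => x0; rewrite (bessel_integral_half_line x0).2.
split; first exact: eq_cintegrable mP EQ I.
rewrite -(eq_cintegral EQ) E; congr (_ * _).
rewrite /mellin -(cintegralZ _ mP f_mellin); apply: eq_cintegral => y.
by rewrite itv_oyE => /mellin_factor.
Qed.

End of_function.
End convolution_form.
End MellinBessel.

Theorem theorem4p1 (R : realType) (nu alpha : R) (f : R -> R[i]) (s : R[i])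
  (nu_ge0 : 0 <= nu) (alpha_gt0 : 0 < alpha)
  (f_smooth : Cn_pos (Num.truncn (2 * alpha)).+1 f)
  (s_gt0 : 0 < complex.Re s) (s_gt_nu : nu - 1 < complex.Re s)
  (f_mellin : mellin_cvg f ((2 * alpha)%:C + s)) :
  [/\ (forall x : R, 0 < x -> bessel_cvg nu alpha f x),
      mellin_cvg (bessel_integral nu alpha f) s
    & mellin (bessel_integral nu alpha f) s =
      ((2 `^ (2 * alpha))^-1)%:C *
      ((Gamma (s / 2) * Gamma (s / 2 - ((nu - 1) / 2)%:C)) /
       (Gamma (alpha%:C + s / 2 - ((nu - 1) / 2)%:C) *
        Gamma (alpha%:C + s / 2))) *
      mellin f ((2 * alpha)%:C + s)].
Proof.
have mP : measurable (`]0%R : R, +oo[%classic)%classic by [].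
have [I E] := bessel_convolution nu_ge0 alpha_gt0 s_gt0 s_gt_nu f_smooth f_mellin.
pose G : R[i] := Gamma (2 * alpha)%:C.
have EQ x : G^-1 * (cpow x (s - 1) *
      cintegral `]x, +oo[%classic (bessel_integrand nu alpha f x)) =
    mellin_integrand (bessel_integral nu alpha f) s x.
  by rewrite /mellin_integrand /bessel_integral mulrCA.
split.
- by move=> x; exact: (bessel_cvgP nu_ge0 alpha_gt0 s_gt0 s_gt_nu f_smooth f_mellin).
- exact: eq_cintegrable mP (fun x _ => EQ x) (cintegrableZ G^-1 mP I).
have c0 : 0 < 2 * alpha by rewrite mulr_gt0.
have G0 : G != 0 by exact: Gamma_neq0.
rewrite /mellin -(eq_cintegral (fun x _ => EQ x)) (cintegralZ G^-1 mP I) E.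
rewrite hyp_kernel_moment// -/G.
(* One half comes from the substitution by the square in the moment. *)
have -> : (2 `^ (2 * alpha))^-1 = 1 / 2 * 2 `^ (1 - 2 * alpha) :> R.
  rewrite powRD ?pnatr_eq0 ?implybT// powRr1// powRN; field.
  by rewrite gt_eqF// powR_gt0.
rewrite rmorphM/=; set g1 := Gamma (s / 2); set g2 := Gamma (s / 2 - _).
set g3 := Gamma (_ + s / 2); set g4 := Gamma (_ + s / 2 - _).
rewrite /mellin (mulrC g3); set w := (g4 * g3)^-1.
by field.
Qed.
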